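(* The following integral evaluations hold: $$\int_0^{e^{-2\pi/\sqrt{10}}}\frac{E(q)^8E(q^{10})^3}{E(q^2)^7}\,dq = 1-2\sqrt{\frac{10-4\sqrt5}{5}},$$ $$\int_0^{e^{-2\pi/\sqrt{10}}}\frac{q\,E(q)^3E(q^{10})^8}{E(q^5)^7}\,dq = \frac14\left(\sqrt{10-4\sqrt5}-1\right),$$ $$\int_0^{e^{-2\pi/\sqrt{10}}}\frac{E(q^2)^8E(q^5)^3}{E(q)^7}\,dq = \frac14\left(\sqrt{\frac{10+4\sqrt5}{5}}-1\right).$$
   Context: $E(q)=\prod_{j=1}^\infty(1-q^j)$ for $|q|<1$. *)

(* Defs.v *)
From Stdlib Require Import Reals.
From Coquelicot Require Import Coquelicot.
Open Scope R_scope.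

Fixpoint Epart (q : R) (n : nat) : R :=
  match n with
  | O => 1
  | S m => Epart q m * (1 - q ^ (S m))
  end.

(* E(q) = prod_{j>=1} (1 - q^j), defined as the limit of partial products
   (convergent for |q| < 1, which is the only range used). *)
Definition E (q : R) : R := real (Lim_seq (Epart q)).

(* Main.v *)
(* Let [k = r(q) r(q^2)^2], where [r] is the Rogers-Ramanujan continued fraction. The functions
   [1/k - k], [1/k + 1 - k], [1/k - 4 - k] and [q k'/k] are eta quotients of level 10, so the three
   integrands are, up to constant factors, the derivatives of
     [(1 + k^2) / (1 + k - k^2)],  [(1 + k^2) / (1 - k^2)],  [(1 + k^2) / (1 - 4 k - k^2)].
   The upper limit [exp (-2 pi / sqrt 10)] is the fixed point of the Fricke involution
   [tau -> -1 / (10 tau)], where the transformation of the theta series gives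
   [1/k - 4 - k = 2 sqrt 5].

   The identities between eta quotients follow from the triple product by regrouping products
   of two theta series, seen as sums over [Z[i]], along the cosets of [1 + i] or [2 + i]. The
   formula for [q k'/k] rests on [E(q)^5 / E(q^5) = 5 q r'(q) / r(q)], obtained in the same way by
   comparing a Wronskian of theta series with the square of [E(q)^3 = sum (-1)^n (2 n + 1) q^(n (n + 1) / 2)].
   The theta transformation is the limit of a finite trigonometric identity (Polya). *)
Require Import Defs.
From Stdlib Require Import Reals Lra Lia ZArith Psatz.
From Coquelicot Require Import Coquelicot.
Open Scope R_scope.

(** * Absolutely convergent sums over the integers *)

(** Put [u = 1/k - k], [w = u + 1], [v = u - 4]. Differentiating [1 + k^2] over one of the three
    quadratics with respect to [k] leaves in the numerator only a multiple of [k] or of another of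
    these quadratics. Up to constants the derivatives in [q] are therefore [v / w^2], [1 / u^2] and
    [w / v^2] times [k' / k], hence single eta quotients. That [k' / k] is itself a single quotient
    comes from [v + 4 w = 5 u]. The endpoint 0 shapes the analytic side. [E] is a limit of products
    and real powers of [q] break down at 0, while the fundamental theorem of calculus is applied on
    a closed interval. So [E] is replaced with Euler's pentagonal series and [k] is built from two
    theta series, all with natural exponents; they are differentiated term by term for [|q| < 1],
    and at 0 every value is explicit. The identities between theta series only rearrange absolutely
    convergent double sums, so domination by weights stable under affine maps of the indices carries
    all the convergence arguments. *)

Lemma sum_n_S (a : nat -> R) n : sum_n a (S n) = sum_n a n + a (S n).
Proof. rewrite sum_Sn. reflexivity. Qed.

(** Tannery's theorem: beyond a rank [K] the tail of [g] bounds the tails of all the series at once,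
    and the first terms, finite in number, converge together. *)
Lemma series_dominated (f : nat -> nat -> R) (l g : nat -> R) :
  eventually (fun n => forall k, Rabs (f n k) <= g k) -> ex_series g ->
  (forall k, is_lim_seq (fun n => f n k) (l k)) ->
  is_lim_seq (fun n => Series (f n)) (Series l).
Proof.
  intros [N0 Hd] Hg Hl.
  assert (Hlg : forall k, Rabs (l k) <= g k).
  { intros k.
    refine (is_lim_seq_le_loc (fun n => Rabs (f n k)) (fun _ => g k) (Rabs (l k)) (g k) _ _ _).
    - exists N0. intros n Hn. apply Hd, Hn.
    - apply (is_lim_seq_abs _ (Finite (l k))), Hl.
    - apply is_lim_seq_const. }
  assert (Hexf : forall n, (N0 <= n)%nat -> ex_series (f n)).
  { intros n Hn. apply (@ex_series_le R_AbsRing R_CompleteNormedModule (f n) g); [|exact Hg].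
    intros k. apply Hd, Hn. }
  assert (Hexl : ex_series l).
  { apply (@ex_series_le R_AbsRing R_CompleteNormedModule l g); auto. }
  apply is_lim_seq_spec. intros eps.
  pose proof (Series_correct _ Hg) as HG.
  unfold is_series in HG.
  apply (is_lim_seq_spec (sum_n g) (Series g)) in HG.
  assert (He : 0 < eps / 3) by (destruct eps; simpl; lra).
  destruct (HG (mkposreal _ He)) as [K HK]. specialize (HK K (le_n _)). simpl in HK.
  assert (Htail : forall h, (forall k, Rabs (h k) <= g k) -> ex_series h ->
     Rabs (Series h - sum_n h K) < eps / 3).
  { intros h Hh Hexh.
    rewrite (Series_incr_n h (S K)); [|lia|assumption]. simpl pred.
    rewrite sum_n_Reals.
    replace (sum_f_R0 h K + _ - _) with (Series (fun k => h (S K + k)%nat)) by ring.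
    rewrite (Series_incr_n g (S K)) in HK; [|lia|assumption]. simpl pred in HK.
    rewrite sum_n_Reals in HK.
    assert (Hexg' : ex_series (fun k => g (S K + k)%nat)).
    { apply (ex_series_incr_n g (S K)) in Hg. exact Hg. }
    assert (Rabs (Series (fun k => h (S K + k)%nat)) <= Series (fun k => g (S K + k)%nat)).
    { eapply Rle_trans; [apply Series_Rabs|].
      - apply (@ex_series_le R_AbsRing R_CompleteNormedModule _ (fun k => g (S K + k)%nat)); auto.
        intros k. unfold norm; simpl. unfold abs; simpl. rewrite Rabs_Rabsolu. apply Hh.
      - apply Series_le; auto. intros k. split; [apply Rabs_pos|apply Hh]. }
    apply Rabs_def2 in HK. lra. }
  assert (Hfin : is_lim_seq (fun n => sum_n (f n) K) (sum_n l K)).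
  { clear -Hl. induction K.
    - apply (is_lim_seq_ext (fun n => f n O)). intros n. now rewrite sum_O.
      rewrite sum_O. apply Hl.
    - apply (is_lim_seq_ext (fun n => sum_n (f n) K + f n (S K))).
      intros n. now rewrite sum_n_S. rewrite sum_n_S.
      apply (is_lim_seq_plus' _ _ _ _ IHK (Hl _)). }
  apply is_lim_seq_spec in Hfin. destruct (Hfin (mkposreal _ He)) as [N1 HN1]. simpl in HN1.
  exists (max N0 N1). intros n Hn.
  specialize (HN1 n ltac:(lia)).
  pose proof (Htail (f n) (Hd n ltac:(lia)) (Hexf n ltac:(lia))) as H1.
  pose proof (Htail l Hlg Hexl) as H2.
  apply Rabs_def2 in HN1. apply Rabs_def2 in H1. apply Rabs_def2 in H2.
  apply Rabs_def1; lra.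
Qed.

Definition zw (n : Z) : R := / (1 + IZR n ^ 2).

(* The terms of index [n] and [-1 - n] are paired, so that a sum over [Z] is one [Series]. *)
Definition zsum (f : Z -> R) : R :=
  Series (fun n => f (Z.of_nat n) + f (-1 - Z.of_nat n)%Z).

(** Domination by [1 / (1 + n^2)] rather than bare summability: this weight is preserved, up to a
    constant, by injective affine changes of index, so each rearrangement costs one inequality. *)
Definition zdom (f : Z -> R) : Prop := exists C, forall n, Rabs (f n) <= C * zw n.

Lemma zw_pos n : 0 < zw n.
Proof. unfold zw. apply Rinv_0_lt_compat. nra. Qed.

Lemma ex_series_zw : ex_series (fun n => zw (Z.of_nat n)).
Proof.
  (* Telescoping majorant, from [1 + n^2 >= (n + 1) (n + 2) / 4]. *)
  apply (@ex_series_le R_AbsRing R_CompleteNormedModule _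
    (fun n => 4 * (/ (INR n + 1) - / (INR n + 2)))).
  - intros n. unfold norm; simpl; unfold abs; simpl.
    rewrite Rabs_pos_eq by (left; apply zw_pos).
    unfold zw. rewrite <- INR_IZR_INZ. pose proof (pos_INR n).
    replace (4 * (/ (INR n + 1) - / (INR n + 2))) with (/ (((INR n + 1) * (INR n + 2)) / 4))
      by (field; lra).
    apply Rinv_le_contravar; nra.
  - apply (ex_series_scal_l 4 (fun n => / (INR n + 1) - / (INR n + 2))).
    exists 1. unfold is_series.
    change (is_lim_seq (sum_n (fun n => / (INR n + 1) - / (INR n + 2))) 1).
    apply (is_lim_seq_ext (fun n => 1 - / (INR n + 2))).
    + intros n. induction n.
      * rewrite sum_O. simpl. field.
      * rewrite sum_n_S, <- IHn.  rewrite !S_INR.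
        pose proof (pos_INR n). field. lra.
    + replace (Finite 1) with (Rbar_minus 1 0) by (simpl; f_equal; ring).
      apply is_lim_seq_minus'. apply is_lim_seq_const.
      replace (Finite 0) with (Rbar_inv p_infty) by reflexivity.
      apply is_lim_seq_inv; [|discriminate].
      eapply is_lim_seq_plus; [apply is_lim_seq_INR|apply is_lim_seq_const|reflexivity].
Qed.

Lemma zdom_pos f : zdom f -> exists C, 0 <= C /\ forall n, Rabs (f n) <= C * zw n.
Proof.
  intros [C HC]. exists C. split; [|exact HC].
  specialize (HC 0%Z). pose proof (zw_pos 0). pose proof (Rabs_pos (f 0%Z)). nra.
Qed.

Lemma zdom_ext f g : (forall n, f n = g n) -> zdom f -> zdom g.
Proof. intros H [C HC]. exists C. intros n. rewrite <- H. apply HC. Qed.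

Lemma zdom_plus f g : zdom f -> zdom g -> zdom (fun n => f n + g n).
Proof.
  intros [C HC] [D HD]. exists (C + D). intros n.
  specialize (HC n). specialize (HD n). pose proof (Rabs_triang (f n) (g n)). lra.
Qed.

Lemma zdom_scal c f : zdom f -> zdom (fun n => c * f n).
Proof.
  intros [C HC]. exists (Rabs c * C). intros n. rewrite Rabs_mult, Rmult_assoc.
  apply Rmult_le_compat_l; [apply Rabs_pos|apply HC].
Qed.

Lemma zw_affine (a b n : Z) : (a <> 0)%Z ->
  zw (a * n + b) <= (2 + 2 * IZR b ^ 2) * zw n.
Proof.
  intros Ha. unfold zw. rewrite plus_IZR, mult_IZR.
  assert (1 <= IZR a ^ 2).
  { assert (1 <= a * a)%Z by (assert (a <= -1 \/ 1 <= a)%Z as [|] by lia; nia). apply IZR_le in H. rewrite mult_IZR in H. nra. }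
  set (x := IZR n) in *. set (y := IZR b) in *. set (z := IZR a) in *.
  pose proof (pow2_ge_0 (z * x + y)). pose proof (pow2_ge_0 x). pose proof (pow2_ge_0 y).
  apply Rmult_le_reg_r with ((1 + (z * x + y) ^ 2)); [lra|].
  rewrite Rinv_l by lra.
  apply Rmult_le_reg_l with (1 + x ^ 2); [lra|].
  replace ((1 + x ^ 2) * ((2 + 2 * y ^ 2) * / (1 + x ^ 2) * (1 + (z * x + y) ^ 2)))
    with ((2 + 2 * y ^ 2) * (1 + (z * x + y) ^ 2)) by (field; lra).
  assert (1 * x ^ 2 <= z ^ 2 * x ^ 2) by (apply Rmult_le_compat_r; lra).
  (* Expanded, this square says [(z x)^2 <= 2 (z x + y)^2 + 2 y^2]. *)
  pose proof (pow2_ge_0 (z * x + 2 * y)).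
  assert (0 <= y ^ 2 * (z * x + y) ^ 2) by (apply Rmult_le_pos; lra).
  replace ((z * x + y) ^ 2) with (z ^ 2 * x ^ 2 + 2 * (z * x * y) + y ^ 2) in * by ring.
  replace ((z * x + 2 * y) ^ 2) with (z ^ 2 * x ^ 2 + 4 * (z * x * y) + 4 * y ^ 2) in * by ring.
  lra.
Qed.

Lemma zdom_affine (a b : Z) f : (a <> 0)%Z -> zdom f -> zdom (fun n => f (a * n + b)%Z).
Proof.
  intros Ha Hf. destruct (zdom_pos _ Hf) as [C [HC0 HC]].
  exists (C * (2 + 2 * IZR b ^ 2)). intros n. eapply Rle_trans; [apply HC|].
  rewrite Rmult_assoc. apply Rmult_le_compat_l; auto. now apply zw_affine.
Qed.

Lemma ex_series_half f : zdom f -> ex_series (fun n => f (Z.of_nat n)).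
Proof.
  intros Hf. destruct (zdom_pos _ Hf) as [C [HC0 HC]].
  apply (@ex_series_le R_AbsRing R_CompleteNormedModule _ (fun n => C * zw (Z.of_nat n))).
  - intros n. apply HC.
  - apply (ex_series_scal_l C (fun n => zw (Z.of_nat n))), ex_series_zw.
Qed.

Lemma zdom_refl f : zdom f -> zdom (fun n => f (-1 - n)%Z).
Proof.
  intros Hf. apply (zdom_ext (fun n => f (-1 * n + -1)%Z)).
  - intros n. f_equal. lia.
  - now apply zdom_affine.
Qed.

Lemma ex_series_z f : zdom f -> ex_series (fun n => f (Z.of_nat n) + f (-1 - Z.of_nat n)%Z).
Proof.
  intros Hf. apply (ex_series_plus (fun n => f (Z.of_nat n)) (fun n => f (-1 - Z.of_nat n)%Z)).
  - now apply ex_series_half.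
  - apply (ex_series_half (fun n => f (-1 - n)%Z)). now apply zdom_refl.
Qed.

Lemma zsum_split f : zdom f ->
  zsum f = Series (fun n => f (Z.of_nat n)) + Series (fun n => f (-1 - Z.of_nat n)%Z).
Proof.
  intros Hf. unfold zsum. apply Series_plus.
  - now apply ex_series_half.
  - apply (ex_series_half (fun n => f (-1 - n)%Z)). now apply zdom_refl.
Qed.

Lemma zsum_ext f g : (forall n, f n = g n) -> zsum f = zsum g.
Proof. intros H. apply Series_ext. intros n. now rewrite !H. Qed.

Lemma zsum_plus f g : zdom f -> zdom g -> zsum (fun n => f n + g n) = zsum f + zsum g.
Proof.
  intros Hf Hg. unfold zsum. rewrite <- Series_plus by now apply ex_series_z.
  apply Series_ext. intros n. ring.
Qed.

Lemma zsum_scal c f : zsum (fun n => c * f n) = c * zsum f.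
Proof. unfold zsum. rewrite <- Series_scal_l. apply Series_ext. intros n. ring. Qed.

Lemma zsum_scal_r c f : zsum (fun n => f n * c) = zsum f * c.
Proof. rewrite Rmult_comm, <- zsum_scal. apply zsum_ext. intros n. ring. Qed.

(** The reflection exchanges the two members of each pair of [zsum]. *)
Lemma zsum_refl1 f : zsum (fun n => f (-1 - n)%Z) = zsum f.
Proof.
  unfold zsum. apply Series_ext. intros n. rewrite Rplus_comm. f_equal. f_equal. lia.
Qed.

(** Under the shift the term [f 0] passes from the half series of nonnegative indices to the half
    series of negative ones. *)
Lemma zsum_shift1 f : zdom f -> zsum (fun n => f (n + 1)%Z) = zsum f.
Proof.
  intros Hf.
  assert (H1 : zdom (fun n => f (n + 1)%Z)).
  { apply (zdom_ext (fun n => f (1 * n + 1)%Z)); [intros n; f_equal; lia|].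
    now apply zdom_affine. }
  rewrite !zsum_split by assumption.
  rewrite (Series_incr_1 (fun n => f (Z.of_nat n))) by now apply ex_series_half.
  rewrite (Series_incr_1 (fun n => f (-1 - Z.of_nat n + 1)%Z)).
  2:{ apply (ex_series_half (fun n => f (-1 - n + 1)%Z)).
      apply (zdom_refl (fun n => f (n + 1)%Z)), H1. }
  rewrite (Series_ext (fun n => f (Z.of_nat n + 1)%Z) (fun k => f (Z.of_nat (S k)))).
  rewrite (Series_ext (fun k => f (-1 - Z.of_nat (S k) + 1)%Z) (fun n => f (-1 - Z.of_nat n)%Z)).
  simpl. ring.
  intros n. f_equal. lia. intros n. f_equal. lia.
Qed.

Lemma zdom_shift k f : zdom f -> zdom (fun n => f (n + k)%Z).
Proof.
  intros Hf. apply (zdom_ext (fun n => f (1 * n + k)%Z)); [intros n; f_equal; lia|].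
  now apply zdom_affine.
Qed.

Lemma zsum_shift_nat (k : nat) f : zdom f -> zsum (fun n => f (n + Z.of_nat k)%Z) = zsum f.
Proof.
  intros Hf. induction k.
  - apply zsum_ext. intros n. f_equal. lia.
  - rewrite <- IHk. rewrite <- (zsum_shift1 (fun n => f (n + Z.of_nat k)%Z)).
    + apply zsum_ext. intros n. f_equal. lia.
    + now apply zdom_shift.
Qed.

Lemma zsum_shift (k : Z) f : zdom f -> zsum (fun n => f (n + k)%Z) = zsum f.
Proof.
  intros Hf. destruct (Z_le_gt_dec 0 k).
  - rewrite <- (zsum_shift_nat (Z.to_nat k) f Hf). apply zsum_ext. intros n. f_equal. lia.
  - rewrite <- (zsum_shift_nat (Z.to_nat (- k)) (fun n => f (n + k)%Z)) by now apply zdom_shift.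
    apply zsum_ext. intros n. f_equal. lia.
Qed.

Lemma zsum_opp_index f : zdom f -> zsum (fun n => f (- n)%Z) = zsum f.
Proof.
  intros Hf. rewrite <- (zsum_shift1 f Hf), <- (zsum_refl1 (fun n => f (n + 1)%Z)).
  apply zsum_ext. intros n. f_equal. lia.
Qed.

Lemma zsum_dominated (f : nat -> Z -> R) (l g : Z -> R) :
  eventually (fun n => forall k, Rabs (f n k) <= g k) -> zdom g ->
  (forall k, is_lim_seq (fun n => f n k) (l k)) ->
  is_lim_seq (fun n => zsum (f n)) (zsum l).
Proof.
  intros [N Hd] Hg Hl. unfold zsum.
  apply (series_dominated (fun n k => f n (Z.of_nat k) + f n (-1 - Z.of_nat k)%Z)
    (fun k => l (Z.of_nat k) + l (-1 - Z.of_nat k)%Z)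
    (fun k => g (Z.of_nat k) + g (-1 - Z.of_nat k)%Z)).
  - exists N. intros n Hn k. eapply Rle_trans; [apply Rabs_triang|].
    apply Rplus_le_compat; now apply Hd.
  - now apply ex_series_z.
  - intros k. apply is_lim_seq_plus'; apply Hl.
Qed.

Lemma zsum_le f g : (forall n, 0 <= f n <= g n) -> zdom g -> zsum f <= zsum g.
Proof.
  intros H Hg. apply Series_le; [|now apply ex_series_z].
  intros n. pose proof (H (Z.of_nat n)). pose proof (H (-1 - Z.of_nat n)%Z). lra.
Qed.

Lemma zdom_Rabs f : zdom f -> zdom (fun n => Rabs (f n)).
Proof. intros [C HC]. exists C. intros n. rewrite Rabs_Rabsolu. apply HC. Qed.

Lemma zsum_Rabs f : zdom f -> Rabs (zsum f) <= zsum (fun n => Rabs (f n)).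
Proof.
  intros Hf. unfold zsum. eapply Rle_trans; [apply Series_Rabs|].
  - apply (@ex_series_le R_AbsRing R_CompleteNormedModule _
      (fun n => Rabs (f (Z.of_nat n)) + Rabs (f (-1 - Z.of_nat n)%Z))).
    + intros n. unfold norm; simpl; unfold abs; simpl. rewrite Rabs_Rabsolu. apply Rabs_triang.
    + apply (ex_series_z (fun n => Rabs (f n))). now apply zdom_Rabs.
  - apply Series_le; [|apply (ex_series_z (fun n => Rabs (f n))); now apply zdom_Rabs].
    intros n. split; [apply Rabs_pos|apply Rabs_triang].
Qed.

Lemma zdom_zw C : zdom (fun n => C * zw n).
Proof.
  exists (Rabs C). intros n. rewrite Rabs_mult, (Rabs_pos_eq (zw n)). lra.
  left; apply zw_pos.
Qed.

Lemma zdom_le f g : (forall n, Rabs (f n) <= g n) -> zdom g -> zdom f.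
Proof.
  intros H [C HC]. exists C. intros n. eapply Rle_trans; [apply H|].
  eapply Rle_trans; [apply Rle_abs|apply HC].
Qed.

Lemma series_mod2 (g : nat -> R) : ex_series g ->
  Series g = Series (fun k => g (2 * k)%nat + g (2 * k + 1)%nat).
Proof.
  intros Hg. symmetry. apply is_series_unique.
  pose proof (Series_correct _ Hg) as H.
  change (is_lim_seq (sum_n g) (Series g)) in H.
  change (is_lim_seq (sum_n (fun k => g (2 * k)%nat + g (2 * k + 1)%nat)) (Series g)).
  apply (is_lim_seq_ext (fun n => sum_n g (2 * n + 1))).
  - intros n. induction n.
    + simpl (2 * 0 + 1)%nat. now rewrite sum_n_S, !sum_O.
    + rewrite sum_n_S, <- IHn. replace (2 * S n + 1)%nat with (S (S (2 * n + 1))) by lia.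
      rewrite !sum_n_S. 
      replace (2 * S n)%nat with (S (2 * n + 1)) by lia.
      replace (S (2 * n + 1) + 1)%nat with (S (S (2 * n + 1))) by lia. ring.
  - apply (is_lim_seq_subseq (sum_n g) _ (fun n => (2 * n + 1)%nat)); auto.
    apply eventually_subseq. intros n. lia.
Qed.

Lemma series_mod5 (g : nat -> R) : ex_series g ->
  Series g = Series (fun k => g (5 * k)%nat + g (5 * k + 1)%nat + g (5 * k + 2)%nat
    + g (5 * k + 3)%nat + g (5 * k + 4)%nat).
Proof.
  intros Hg. symmetry. apply is_series_unique.
  pose proof (Series_correct _ Hg) as H.
  change (is_lim_seq (sum_n g) (Series g)) in H.
  match goal with |- is_series ?h _ => change (is_lim_seq (sum_n h) (Series g)) end.
  apply (is_lim_seq_ext (fun n => sum_n g (5 * n + 4))).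
  - intros n. induction n.
    + simpl (5 * 0 + 4)%nat. now rewrite !sum_n_S, !sum_O.
    + rewrite sum_n_S, <- IHn.
      replace (5 * S n + 4)%nat with (S (S (S (S (S (5 * n + 4)))))) by lia.
      rewrite !sum_n_S. 
      replace (5 * S n)%nat with (S (5 * n + 4)) by lia.
      rewrite !(Nat.add_comm (S (5 * n + 4))). simpl. ring.
  - apply (is_lim_seq_subseq (sum_n g) _ (fun n => (5 * n + 4)%nat)); auto.
    apply eventually_subseq. intros n. lia.
Qed.

(** The reflection [n -> -1 - n] maps the residue [r] modulo [d] to [d - 1 - r], so grouping [d]
    consecutive terms of the paired series yields paired series again, here for [d = 2] and below
    for [d = 5]. *)
Lemma zsum_mod2 f : zdom f ->
  zsum f = zsum (fun k => f (2 * k)%Z) + zsum (fun k => f (2 * k + 1)%Z).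
Proof.
  intros Hf.
  rewrite <- zsum_plus.
  2:{ apply (zdom_ext (fun n => f (2 * n + 0)%Z)); [intros n; f_equal; lia|].
        now apply zdom_affine. }
  2: now apply zdom_affine.
  unfold zsum. rewrite series_mod2 by now apply ex_series_z.
  apply Series_ext. intros n.
  replace (Z.of_nat (2 * n)) with (2 * Z.of_nat n)%Z by lia.
  replace (Z.of_nat (2 * n + 1)) with (2 * Z.of_nat n + 1)%Z by lia.
  replace (-1 - 2 * Z.of_nat n)%Z with (2 * (-1 - Z.of_nat n) + 1)%Z by lia.
  replace (-1 - (2 * Z.of_nat n + 1))%Z with (2 * (-1 - Z.of_nat n))%Z by lia.
  ring.
Qed.

Lemma zsum_mod5 f : zdom f ->
  zsum f = zsum (fun k => f (5 * k)%Z) + zsum (fun k => f (5 * k + 1)%Z)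
    + zsum (fun k => f (5 * k + 2)%Z) + zsum (fun k => f (5 * k + 3)%Z)
    + zsum (fun k => f (5 * k + 4)%Z).
Proof.
  intros Hf.
  assert (H : forall r, zdom (fun n => f (5 * n + r)%Z)) by (intros r; now apply zdom_affine).
  rewrite (zsum_ext (fun k => f (5 * k)%Z) (fun k => f (5 * k + 0)%Z))
    by (intros n; f_equal; lia).
  rewrite <- !zsum_plus by auto using zdom_plus.
  unfold zsum. rewrite series_mod5 by now apply ex_series_z.
  apply Series_ext. intros n.
  replace (Z.of_nat (5 * n)) with (5 * Z.of_nat n + 0)%Z by lia.
  replace (Z.of_nat (5 * n + 1)) with (5 * Z.of_nat n + 1)%Z by lia.
  replace (Z.of_nat (5 * n + 2)) with (5 * Z.of_nat n + 2)%Z by lia.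
  replace (Z.of_nat (5 * n + 3)) with (5 * Z.of_nat n + 3)%Z by lia.
  replace (Z.of_nat (5 * n + 4)) with (5 * Z.of_nat n + 4)%Z by lia.
  replace (-1 - (5 * Z.of_nat n + 0))%Z with (5 * (-1 - Z.of_nat n) + 4)%Z by lia.
  replace (-1 - (5 * Z.of_nat n + 1))%Z with (5 * (-1 - Z.of_nat n) + 3)%Z by lia.
  replace (-1 - (5 * Z.of_nat n + 2))%Z with (5 * (-1 - Z.of_nat n) + 2)%Z by lia.
  replace (-1 - (5 * Z.of_nat n + 3))%Z with (5 * (-1 - Z.of_nat n) + 1)%Z by lia.
  replace (-1 - (5 * Z.of_nat n + 4))%Z with (5 * (-1 - Z.of_nat n) + 0)%Z by lia.
  ring.
Qed.

(** * Double sums and cosets of Gaussian integers *)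

Definition zsum2 (F : Z -> Z -> R) : R := zsum (fun a => zsum (fun b => F a b)).

(* This weight is preserved, up to a constant, by invertible affine changes of the indices,
   and it is dominated by the product [zw a * zw b]. *)
Definition zw2 (a b : Z) : R := / (1 + IZR a ^ 2 + IZR b ^ 2) ^ 2.

Definition zdom2 (F : Z -> Z -> R) : Prop :=
  exists C, 0 <= C /\ forall a b, Rabs (F a b) <= C * zw2 a b.

(** Decay fast enough for a product [f a * g b] to be dominated by [zw2], see [zw2_ge]. *)
Definition zrap (f : Z -> R) : Prop :=
  exists C, 0 <= C /\ forall n, Rabs (f n) <= C * zw n ^ 2.

Lemma zw2_le a b : zw2 a b <= zw a * zw b.
Proof.
  unfold zw2, zw. pose proof (pow2_ge_0 (IZR a)). pose proof (pow2_ge_0 (IZR b)).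
  rewrite <- Rinv_mult. apply Rinv_le_contravar; nra.
Qed.

Lemma zw2_ge a b : zw a ^ 2 * zw b ^ 2 <= zw2 a b.
Proof.
  unfold zw2, zw. pose proof (pow2_ge_0 (IZR a)). pose proof (pow2_ge_0 (IZR b)).
  rewrite !pow_inv, <- Rinv_mult, <- Rpow_mult_distr.
  apply Rinv_le_contravar; [nra|]. apply pow_incr. nra.
Qed.

Lemma zdom2_bound F : zdom2 F ->
  exists C, 0 <= C /\ forall a b, Rabs (F a b) <= C * (zw a * zw b).
Proof.
  intros [C [HC0 HC]]. exists C. split; auto. intros a b. eapply Rle_trans; [apply HC|].
  apply Rmult_le_compat_l; auto. apply zw2_le.
Qed.

Lemma zdom2_row F a : zdom2 F -> zdom (F a).
Proof.
  intros HF. destruct (zdom2_bound _ HF) as [C [HC0 HC]]. exists (C * zw a). intros b.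
  rewrite Rmult_assoc. apply HC.
Qed.

Lemma zdom2_rows F : zdom2 F -> zdom (fun a => zsum (F a)).
Proof.
  intros HF. destruct (zdom2_bound _ HF) as [C [HC0 HC]].
  exists (C * zsum zw). intros a.
  eapply Rle_trans; [apply zsum_Rabs; now apply zdom2_row|].
  apply Rle_trans with (zsum (fun b => C * zw a * zw b)).
  - apply zsum_le; [|apply zdom_zw]. intros b. split; [apply Rabs_pos|].
    rewrite Rmult_assoc. apply HC.
  - rewrite (zsum_scal (C * zw a) zw). right. ring.
Qed.

Lemma zdom2_ext F G : (forall a b, F a b = G a b) -> zdom2 F -> zdom2 G.
Proof. intros H [C [HC0 HC]]. exists C. split; auto. intros a b. rewrite <- H. apply HC. Qed.

Lemma zdom2_swap F : zdom2 F -> zdom2 (fun a b => F b a).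
Proof.
  intros [C [HC0 HC]]. exists C. split; auto. intros a b. eapply Rle_trans; [apply HC|].
  right. unfold zw2.
  now replace (1 + IZR b ^ 2 + IZR a ^ 2) with (1 + IZR a ^ 2 + IZR b ^ 2) by ring.
Qed.

Lemma zdom2_plus F G : zdom2 F -> zdom2 G -> zdom2 (fun a b => F a b + G a b).
Proof.
  intros [C [HC0 HC]] [D [HD0 HD]]. exists (C + D). split; [lra|]. intros a b.
  specialize (HC a b). specialize (HD a b). pose proof (Rabs_triang (F a b) (G a b)). lra.
Qed.

Lemma zdom2_scal c F : zdom2 F -> zdom2 (fun a b => c * F a b).
Proof.
  intros [C [HC0 HC]]. exists (Rabs c * C). split.
  - apply Rmult_le_pos; auto; apply Rabs_pos.
  - intros a b. rewrite Rabs_mult, Rmult_assoc.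
    apply Rmult_le_compat_l; [apply Rabs_pos|apply HC].
Qed.

(** An integer matrix with nonzero determinant has determinant at least 1 in absolute value; by
    Cramer's rule and Cauchy-Schwarz, [m^2 + n^2] is then at most a constant times the squared norm
    of the image. The translation costs one more constant. *)
Lemma zdom2_affine (a b c d e f : Z) F : (a * d - b * c <> 0)%Z -> zdom2 F ->
  zdom2 (fun m n => F (a * m + b * n + e)%Z (c * m + d * n + f)%Z).
Proof.
  intros HD [C [HC0 HC]].
  set (S := IZR a ^ 2 + IZR b ^ 2 + IZR c ^ 2 + IZR d ^ 2).
  set (K := 1 + 2 * S * (1 + IZR e ^ 2 + IZR f ^ 2)).
  assert (HS : 0 <= S) by (unfold S; nra).
  assert (HK : 1 <= K).
  { unfold K. assert (0 <= 2 * S * (1 + IZR e ^ 2 + IZR f ^ 2)); [|lra].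
    apply Rmult_le_pos; nra. }
  exists (C * K ^ 2). split; [apply Rmult_le_pos; [lra|apply pow2_ge_0]|].
  intros m n. eapply Rle_trans; [apply HC|]. rewrite Rmult_assoc.
  apply Rmult_le_compat_l; auto. unfold zw2. rewrite !plus_IZR, !mult_IZR.
  set (x := IZR m). set (y := IZR n).
  set (X := IZR a * x + IZR b * y). set (Y := IZR c * x + IZR d * y).
  set (p := X + IZR e). set (r := Y + IZR f).
  assert (HDD : 1 <= (IZR a * IZR d - IZR b * IZR c) ^ 2).
  { rewrite <- !mult_IZR, <- minus_IZR.
    assert (1 <= (a * d - b * c) * (a * d - b * c))%Z.
    { assert (a * d - b * c <= -1 \/ 1 <= a * d - b * c)%Z as [|] by lia; nia. }
    apply IZR_le in H. rewrite mult_IZR in H. nra. }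
  assert (Hx : x ^ 2 <= (IZR b ^ 2 + IZR d ^ 2) * (X ^ 2 + Y ^ 2)).
  { assert (1 * x ^ 2 <= (IZR a * IZR d - IZR b * IZR c) ^ 2 * x ^ 2)
      by (apply Rmult_le_compat_r; [apply pow2_ge_0|lra]).
    pose proof (pow2_ge_0 (IZR d * Y + IZR b * X)).
    replace ((IZR a * IZR d - IZR b * IZR c) ^ 2 * x ^ 2) with ((IZR d * X - IZR b * Y) ^ 2) in H
      by (unfold X, Y; ring). nra. }
  assert (Hy : y ^ 2 <= (IZR a ^ 2 + IZR c ^ 2) * (X ^ 2 + Y ^ 2)).
  { assert (1 * y ^ 2 <= (IZR a * IZR d - IZR b * IZR c) ^ 2 * y ^ 2)
      by (apply Rmult_le_compat_r; [apply pow2_ge_0|lra]).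
    pose proof (pow2_ge_0 (IZR a * X + IZR c * Y)).
    replace ((IZR a * IZR d - IZR b * IZR c) ^ 2 * y ^ 2) with ((IZR a * Y - IZR c * X) ^ 2) in H
      by (unfold X, Y; ring). nra. }
  assert (Hxy : x ^ 2 + y ^ 2 <= S * (X ^ 2 + Y ^ 2)) by (unfold S; nra).
  assert (HX : X ^ 2 <= 2 * (p ^ 2 + IZR e ^ 2)) 
    by (unfold p; pose proof (pow2_ge_0 (X + 2 * IZR e)); lra).
  assert (HY : Y ^ 2 <= 2 * (r ^ 2 + IZR f ^ 2)) 
    by (unfold r; pose proof (pow2_ge_0 (Y + 2 * IZR f)); lra).
  assert (0 <= x ^ 2) by apply pow2_ge_0. assert (0 <= y ^ 2) by apply pow2_ge_0.
  assert (0 <= p ^ 2) by apply pow2_ge_0. assert (0 <= r ^ 2) by apply pow2_ge_0.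
  assert (HM : 1 + x ^ 2 + y ^ 2 <= K * (1 + p ^ 2 + r ^ 2)).
  { assert (S * (X ^ 2 + Y ^ 2) <= S * (2 * (p ^ 2 + IZR e ^ 2) + 2 * (r ^ 2 + IZR f ^ 2)))
      by (apply Rmult_le_compat_l; lra).
    assert (0 <= S * (IZR e ^ 2 + IZR f ^ 2) * (p ^ 2 + r ^ 2)).
    { apply Rmult_le_pos; [apply Rmult_le_pos; auto|]; nra. }
    unfold K. lra. }
  apply Rle_trans with (K ^ 2 * / (K * (1 + p ^ 2 + r ^ 2)) ^ 2).
  - right. field. split; lra.
  - apply Rmult_le_compat_l; [nra|]. apply Rinv_le_contravar; [nra|].
    apply pow_incr. lra.
Qed.

Lemma zsum2_ext F G : (forall a b, F a b = G a b) -> zsum2 F = zsum2 G.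
Proof. intros H. apply zsum_ext. intros a. apply zsum_ext. intros b. apply H. Qed.

Lemma zsum2_plus F G : zdom2 F -> zdom2 G ->
  zsum2 (fun a b => F a b + G a b) = zsum2 F + zsum2 G.
Proof.
  intros HF HG. unfold zsum2. rewrite <- zsum_plus by now apply zdom2_rows.
  apply zsum_ext. intros a. apply zsum_plus; now apply zdom2_row.
Qed.

Lemma zsum2_scal c F : zsum2 (fun a b => c * F a b) = c * zsum2 F.
Proof.
  unfold zsum2. rewrite <- zsum_scal. apply zsum_ext. intros a. apply zsum_scal.
Qed.

Lemma zsum2_prod f g : zsum2 (fun a b => f a * g b) = zsum f * zsum g.
Proof.
  unfold zsum2. rewrite <- zsum_scal_r. apply zsum_ext. intros a. apply zsum_scal.
Qed.

Lemma zdom2_prod f g : zrap f -> zrap g -> zdom2 (fun a b => f a * g b).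
Proof.
  intros [C [HC0 HC]] [D [HD0 HD]]. exists (C * D). split; [nra|]. intros a b.
  rewrite Rabs_mult. eapply Rle_trans.
  - apply Rmult_le_compat; [apply Rabs_pos|apply Rabs_pos|apply HC|apply HD].
  - pose proof (zw2_ge a b).
    replace (C * zw a ^ 2 * (D * zw b ^ 2)) with (C * D * (zw a ^ 2 * zw b ^ 2)) by ring.
    apply Rmult_le_compat_l; [nra|auto].
Qed.

Lemma zrap_zdom f : zrap f -> zdom f.
Proof.
  intros [C [HC0 HC]]. exists C. intros n. eapply Rle_trans; [apply HC|].
  apply Rmult_le_compat_l; auto. pose proof (zw_pos n).
  assert (zw n <= 1); [|nra].
  unfold zw. rewrite <- Rinv_1. apply Rinv_le_contravar; nra.
Qed.

Lemma zsum_sum_n (f : nat -> Z -> R) N : (forall i, zdom (f i)) ->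
  zdom (fun b => sum_n (fun i => f i b) N) /\
  zsum (fun b => sum_n (fun i => f i b) N) = sum_n (fun i => zsum (f i)) N.
Proof.
  intros H. induction N as [|N [IHd IHs]].
  - split.
    + apply (zdom_ext (f O)); [intros b; now rewrite sum_O|auto].
    + rewrite sum_O. apply zsum_ext. intros b. now rewrite sum_O.
  - split.
    + apply (zdom_ext (fun b => sum_n (fun i => f i b) N + f (S N) b)).
      * intros b. now rewrite sum_n_S.
      * now apply zdom_plus.
    + rewrite sum_n_S, <- IHs, <- zsum_plus by auto.
      apply zsum_ext. intros b. now rewrite sum_n_S.
Qed.

Lemma zsum_is_lim f : zdom f ->
  is_lim_seq (fun N => sum_n (fun n => f (Z.of_nat n) + f (-1 - Z.of_nat n)%Z) N) (zsum f).
Proof.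
  intros Hf. pose proof (Series_correct _ (ex_series_z _ Hf)) as H. exact H.
Qed.

(** Fubini. The partial sums over the first index, summed over the second, have two limits: one by
    dominated convergence, the other by exchanging a finite sum with [zsum]. *)
Lemma zsum2_swap F : zdom2 F -> zsum2 F = zsum2 (fun a b => F b a).
Proof.
  intros HF. pose proof (zdom2_swap _ HF) as HF'.
  destruct (zdom2_bound _ HF) as [C [HC0 HC]].
  pose (f := fun N b => sum_n (fun n => F (Z.of_nat n) b + F (-1 - Z.of_nat n)%Z b) N).
  assert (H1 : is_lim_seq (fun N => zsum (f N)) (zsum2 (fun a b => F b a))).
  { apply (zsum_dominated f _ (fun b => (C * zsum zw) * zw b)).
    - exists O. intros N _ b. unfold f.
      assert (Hz : zdom (fun a => C * zw b * zw a)) by apply zdom_zw.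
      assert (H : sum_n (fun n => C * zw b * zw (Z.of_nat n) + C * zw b * zw (-1 - Z.of_nat n)%Z) N
        <= C * zsum zw * zw b).
      { replace (C * zsum zw * zw b) with (zsum (fun a => C * zw b * zw a))
          by (rewrite (zsum_scal (C * zw b) zw); ring).
        pose proof (zsum_is_lim _ Hz) as H.
        refine (is_lim_seq_incr_compare _ _ H _ N).
        intros n. rewrite sum_n_S.
        pose proof (zw_pos b). pose proof (zw_pos (Z.of_nat (S n))).
        pose proof (zw_pos (-1 - Z.of_nat (S n))).
        assert (0 <= C * zw b * zw (Z.of_nat (S n))) by (apply Rmult_le_pos; nra).
        assert (0 <= C * zw b * zw (-1 - Z.of_nat (S n))%Z) by (apply Rmult_le_pos; nra).
        lra. }
      eapply Rle_trans; [|apply H]. clear H. induction N.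
      + rewrite !sum_O. eapply Rle_trans; [apply Rabs_triang|].
        pose proof (HC (Z.of_nat 0) b). pose proof (HC (-1 - Z.of_nat 0)%Z b). lra.
      + rewrite !sum_n_S. eapply Rle_trans; [apply Rabs_triang|]. apply Rplus_le_compat; [exact IHN|].
        eapply Rle_trans; [apply Rabs_triang|].
        pose proof (HC (Z.of_nat (S N)) b). pose proof (HC (-1 - Z.of_nat (S N))%Z b). lra.
    - apply zdom_zw.
    - intros b. apply (zsum_is_lim (fun a => F a b)). now apply (zdom2_row (fun a b => F b a)). }
  assert (H2 : is_lim_seq (fun N => zsum (f N)) (zsum2 F)).
  { apply (is_lim_seq_ext (fun N => sum_n (fun n => zsum (F (Z.of_nat n)) + zsum (F (-1 - Z.of_nat n)%Z)) N)).
    - intros N. unfold f.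
      destruct (zsum_sum_n (fun n b => F (Z.of_nat n) b + F (-1 - Z.of_nat n)%Z b) N) as [_ ->].
      + intros i. apply zdom_plus; now apply zdom2_row.
      + apply sum_n_ext. intros n. rewrite zsum_plus; auto using zdom2_row.
    - apply (zsum_is_lim (fun a => zsum (F a))). now apply zdom2_rows. }
  apply is_lim_seq_unique in H1. apply is_lim_seq_unique in H2. rewrite H1 in H2.
  now inversion H2.
Qed.

(** Each inner sum is shifted by its own amount. The changes of variables below are composed of such
    shears, swaps, reflections and translations. *)
Lemma zsum2_shear (k : Z -> Z) F : zdom2 F ->
  zsum2 (fun a b => F a (b + k a)%Z) = zsum2 F.
Proof.
  intros HF. apply zsum_ext. intros a. apply (zsum_shift (k a) (F a)). now apply zdom2_row.
Qed.

Ltac zaff a b c d e f F :=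
  apply (zdom2_ext (fun m n => F (a * m + b * n + e)%Z (c * m + d * n + f)%Z));
  [intros ? ?; f_equal; lia | apply zdom2_affine; [lia | assumption]].

(* [m = i + j (+ 1)], [n = i - j]: the two cosets of [Z[i] / (1 + i)]. *)
Lemma zsum2_mod2 G : zdom2 G ->
  zsum2 G = zsum2 (fun i j => G (i + j)%Z (i - j)%Z)
          + zsum2 (fun i j => G (i + j + 1)%Z (i - j)%Z).
Proof.
  intros HG.
  (* After the shear the second index is [b - a], so the parity of [b] is that of the sum of the two
     indices and selects the coset. *)
  rewrite <- (zsum2_shear (fun a => - a)%Z G HG).
  assert (H0 : zdom2 (fun a i => G a (2 * i - a)%Z)) by zaff 1%Z 0%Z (-1)%Z 2%Z 0%Z 0%Z G.
  assert (H1 : zdom2 (fun a i => G a (2 * i + 1 - a)%Z)) by zaff 1%Z 0%Z (-1)%Z 2%Z 0%Z 1%Z G.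
  transitivity (zsum2 (fun a i => G a (2 * i - a)%Z) + zsum2 (fun a i => G a (2 * i + 1 - a)%Z)).
  - unfold zsum2. rewrite <- zsum_plus by now apply zdom2_rows.
    apply zsum_ext. intros a.
    rewrite (zsum_mod2 (fun b => G a (b + - a)%Z)).
    + f_equal; apply zsum_ext; intros n; f_equal; lia.
    + apply (zdom_shift (- a)%Z (G a)). now apply zdom2_row.
  - f_equal.
    + rewrite zsum2_swap by assumption.
      rewrite <- (zsum2_shear (fun i => i)).
      * apply zsum2_ext. intros; f_equal; lia.
      * now apply (zdom2_swap (fun a i => G a (2 * i - a)%Z)).
    + rewrite zsum2_swap by assumption.
      rewrite <- (zsum2_shear (fun i => i + 1)%Z).
      * apply zsum2_ext. intros; f_equal; lia.
      * now apply (zdom2_swap (fun a i => G a (2 * i + 1 - a)%Z)).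
Qed.

Lemma zdom2_coset5 G r : zdom2 G -> zdom2 (fun m n => G (2 * m - n + r)%Z (m + 2 * n)%Z).
Proof. intros HG. zaff 2%Z (-1)%Z 1%Z 2%Z r 0%Z G. Qed.

Lemma zsum2_refl1 F : zdom2 F -> zsum2 (fun a b => F (- a)%Z b) = zsum2 F.
Proof.
  intros HF. apply (zsum_opp_index (fun a => zsum (F a))). now apply zdom2_rows.
Qed.

(* The five cosets of [Z[i] / (2 + i)]. *)
Lemma zsum2_mod5 G : zdom2 G ->
  zsum2 G = zsum2 (fun m n => G (2 * m - n)%Z (m + 2 * n)%Z)
    + zsum2 (fun m n => G (2 * m - n + 1)%Z (m + 2 * n)%Z)
    + zsum2 (fun m n => G (2 * m - n + 2)%Z (m + 2 * n)%Z)
    + zsum2 (fun m n => G (2 * m - n + 3)%Z (m + 2 * n)%Z)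
    + zsum2 (fun m n => G (2 * m - n + 4)%Z (m + 2 * n)%Z).
Proof.
  intros HG.
  assert (Hd : forall r, zdom2 (fun b k => G (5 * k + r + 2 * b)%Z b))
    by (intros r; zaff 2%Z 5%Z 1%Z 0%Z r 0%Z G).
  assert (Hc : forall r, zsum2 (fun b k => G (5 * k + r + 2 * b)%Z b)
    = zsum2 (fun m n => G (2 * m - n + r)%Z (m + 2 * n)%Z)).
  { intros r. rewrite zsum2_swap by apply Hd.
    rewrite <- (zsum2_shear (fun k => -2 * k)%Z) by apply (zdom2_swap _ (Hd r)).
    rewrite <- zsum2_refl1 by zaff 1%Z 2%Z (-2)%Z 1%Z r 0%Z G.
    rewrite zsum2_swap by zaff (-1)%Z 2%Z 2%Z 1%Z r 0%Z G.
    apply zsum2_ext. intros; f_equal; lia. }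
  rewrite (zsum2_ext (fun m n => G (2 * m - n)%Z (m + 2 * n)%Z)
    (fun m n => G (2 * m - n + 0)%Z (m + 2 * n)%Z)) by (intros; f_equal; lia).
  rewrite <- !Hc.
  rewrite zsum2_swap by assumption.
  (* Modulo [2 + i] one has [i = -2], so the class of [a + b i] is the residue of [a - 2 b] modulo
     5; the shear makes this number the summation index. *)
  rewrite <- (zsum2_shear (fun b => 2 * b)%Z) by now apply zdom2_swap.
  rewrite <- !zsum2_plus by auto using zdom2_plus.
  apply zsum_ext. intros b.
  rewrite (zsum_mod5 (fun a => G (a + 2 * b)%Z b)).
  2:{ apply (zdom_shift (2 * b) (fun a => G a b)). now apply (zdom2_row (fun b a => G a b)), zdom2_swap. }
  rewrite (zsum_ext (fun k => G (5 * k + 2 * b)%Z b) (fun k => G (5 * k + 0 + 2 * b)%Z b))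
    by (intros; f_equal; lia).
  assert (Hr : forall r, zdom (fun k => G (5 * k + r + 2 * b)%Z b))
    by (intros r; apply (zdom2_row _ b (Hd r))).
  rewrite !zsum_plus by auto using zdom_plus. reflexivity.
Qed.

(** * Theta series *)

Definition sg (n : Z) : R := if Z.even n then 1 else -1.

Lemma sg_add a b : sg (a + b) = sg a * sg b.
Proof. unfold sg. rewrite Z.even_add. destruct (Z.even a), (Z.even b); simpl; ring. Qed.

Lemma sg_opp a : sg (- a) = sg a.
Proof. unfold sg. now rewrite Z.even_opp. Qed.

Lemma sg_sub a b : sg (a - b) = sg a * sg b.
Proof. unfold Z.sub. now rewrite sg_add, sg_opp. Qed.

Lemma sg_double a : sg (2 * a) = 1.
Proof. unfold sg. now rewrite Z.even_mul. Qed.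

Lemma sg_abs a : Rabs (sg a) = 1.
Proof. unfold sg. destruct (Z.even a); unfold Rabs; destruct Rcase_abs; lra. Qed.

Lemma Rpower_nat q x n : 0 < q -> x = INR n -> Rpower q x = q ^ n.
Proof. intros Hq ->. now apply Rpower_pow. Qed.

(** Half of the quadratic term absorbs the linear one by completing the square. The other half is a
    fourth power of [exp (- a x^2 / 4)], and [exp (a x^2 / 4) >= 1 + a x^2 / 4]. The exponent 4
    leaves room for the polynomial weights of [zrap_weight]. *)
Lemma gauss_bound q A B : 0 < q < 1 -> 0 < A ->
  exists C, 0 <= C /\ forall n, Rpower q (A * IZR n ^ 2 + B * IZR n) <= C * zw n ^ 4.
Proof.
  intros Hq HA.
  assert (HL : ln q < 0) by (rewrite <- ln_1; apply ln_increasing; lra).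
  set (L := - ln q). assert (HL0 : 0 < L) by (unfold L; lra).
  set (a := L * A / 2). assert (Ha : 0 < a) by (unfold a; apply Rdiv_lt_0_compat; nra).
  set (mm := Rmin 1 (a / 4)).
  assert (Hm : 0 < mm) by (unfold mm; apply Rmin_pos; lra).
  exists (exp ((L * B) ^ 2 / (4 * a)) * / mm ^ 4). split.
  { apply Rmult_le_pos. left; apply exp_pos. left. apply Rinv_0_lt_compat. now apply pow_lt. }
  intros n. set (x := IZR n). unfold Rpower.
  assert (Hx : 0 <= x ^ 2) by apply pow2_ge_0.
  apply Rle_trans with (exp ((L * B) ^ 2 / (4 * a)) * exp (- (a * x ^ 2))).
  - rewrite <- exp_plus.
    assert (H : (A * x ^ 2 + B * x) * ln q <= (L * B) ^ 2 / (4 * a) + - (a * x ^ 2)).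
    { replace ((A * x ^ 2 + B * x) * ln q) with (- (2 * a * x ^ 2) - L * B * x)
        by (unfold a, L; field).
      assert (0 <= (2 * a * x + L * B) ^ 2 / (4 * a)).
      { apply Rdiv_le_0_compat; [apply pow2_ge_0|lra]. }
      replace ((2 * a * x + L * B) ^ 2 / (4 * a)) with
        (a * x ^ 2 + L * B * x + (L * B) ^ 2 / (4 * a)) in H by (field; lra).
      lra. }
    destruct H as [H|H]; [left; now apply exp_increasing|right; now rewrite H].
  - rewrite Rmult_assoc. apply Rmult_le_compat_l; [left; apply exp_pos|].
    replace (exp (- (a * x ^ 2))) with ((/ exp (a * x ^ 2 / 4)) ^ 4).
    2:{ rewrite <- exp_Ropp. set (e := exp (- (a * x ^ 2 / 4))).
      replace (e ^ 4) with (e * e * (e * e)) by ring.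
      unfold e. rewrite <- !exp_plus. f_equal. field. }
    rewrite <- pow_inv, <- Rpow_mult_distr.
    apply pow_incr. split; [left; apply Rinv_0_lt_compat, exp_pos|].
    unfold zw. fold x. rewrite <- Rinv_mult.
    apply Rinv_le_contravar; [apply Rmult_lt_0_compat; lra|].
    eapply Rle_trans; [|apply exp_ineq1_le].
    assert (mm <= 1) by apply Rmin_l. assert (mm <= a / 4) by apply Rmin_r.
    assert (mm * x ^ 2 <= a / 4 * x ^ 2) by (apply Rmult_le_compat_r; lra). lra.
Qed.

Lemma zrap_weight (w f : Z -> R) c C : 0 <= C ->
  (forall n, Rabs (f n) <= C * zw n ^ 4) ->
  (forall n, Rabs (w n) <= c * (1 + IZR n ^ 2)) -> zrap (fun n => w n * f n).
Proof.
  intros HC0 HC Hw.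
  assert (Hc : 0 <= c).
  { specialize (Hw 0%Z). pose proof (Rabs_pos (w 0%Z)). simpl in Hw. lra. }
  exists (c * C). split; [now apply Rmult_le_pos|]. intros n. rewrite Rabs_mult.
  apply Rle_trans with (c * (1 + IZR n ^ 2) * (C * zw n ^ 4)).
  - apply Rmult_le_compat; auto; apply Rabs_pos.
  - pose proof (zw_pos n) as Hp. pose proof (pow2_ge_0 (IZR n)).
    assert (E1 : (1 + IZR n ^ 2) * zw n = 1) by (unfold zw; field; lra).
    assert (zw n <= 1) by (pose proof (Rmult_le_pos _ _ (pow2_ge_0 (IZR n)) (Rlt_le _ _ Hp)); lra).
    replace (c * (1 + IZR n ^ 2) * (C * zw n ^ 4)) with
      (c * C * (zw n ^ 2 * (((1 + IZR n ^ 2) * zw n) * zw n))) by ring.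
    rewrite E1. apply Rmult_le_compat_l; [now apply Rmult_le_pos|].
    assert (0 <= zw n ^ 2) by apply pow2_ge_0. nra.
Qed.

Lemma zrap_gauss q A B w c : 0 < q < 1 -> 0 < A ->
  (forall n, Rabs (w n) <= c * (1 + IZR n ^ 2)) ->
  zrap (fun n => w n * Rpower q (A * IZR n ^ 2 + B * IZR n)).
Proof.
  intros Hq HA Hw. destruct (gauss_bound q A B Hq HA) as [C [HC0 HC]].
  apply (zrap_weight _ _ c C); auto. intros n.
  rewrite Rabs_pos_eq; [apply HC|left; apply exp_pos].
Qed.

Lemma sg_bound n : Rabs (sg n) <= 1 * (1 + IZR n ^ 2).
Proof. rewrite sg_abs. pose proof (pow2_ge_0 (IZR n)). lra. Qed.

Lemma sg_lin_bound n : Rabs (sg n * (2 * IZR n + 1)) <= 3 * (1 + IZR n ^ 2).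
Proof.
  rewrite Rabs_mult, sg_abs. set (x := IZR n). pose proof (pow2_ge_0 x).
  pose proof (pow2_ge_0 (x - 1)). pose proof (pow2_ge_0 (x + 1)).
  rewrite Rmult_1_l. apply Rabs_le. lra.
Qed.

Lemma sg_quad_bound n : Rabs (sg n * (2 * IZR n + 1) ^ 2) <= 8 * (1 + IZR n ^ 2).
Proof.
  rewrite Rabs_mult, sg_abs. set (x := IZR n). pose proof (pow2_ge_0 x).
  pose proof (pow2_ge_0 (x - 1)). pose proof (pow2_ge_0 (2 * x + 1)).
  rewrite Rmult_1_l. rewrite Rabs_pos_eq; lra.
Qed.

Definition theta (q A B : R) : R :=
  zsum (fun n => sg n * Rpower q (A * IZR n ^ 2 + B * IZR n)).

Definition utheta (q A B : R) : R :=
  zsum (fun n => Rpower q (A * IZR n ^ 2 + B * IZR n)).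

Section Theta.
Variable q : R.
Hypothesis Hq : 0 < q < 1.

Lemma zrap_theta A B : 0 < A -> zrap (fun n => sg n * Rpower q (A * IZR n ^ 2 + B * IZR n)).
Proof. intros HA. apply (zrap_gauss q A B sg 1); auto. apply sg_bound. Qed.

Lemma zrap_utheta A B : 0 < A -> zrap (fun n => Rpower q (A * IZR n ^ 2 + B * IZR n)).
Proof.
  intros HA.
  destruct (zrap_gauss q A B (fun _ => 1) 1 Hq HA) as [C [H1 H2]].
  { intros n. rewrite Rabs_R1. pose proof (pow2_ge_0 (IZR n)). lra. }
  exists C. split; auto. intros n. specialize (H2 n). now rewrite Rmult_1_l in H2.
Qed.

Lemma theta_opp A B : 0 < A -> theta q A (- B) = theta q A B.
Proof.
  intros HA. unfold theta.
  rewrite <- (zsum_opp_index (fun n => sg n * Rpower q (A * IZR n ^ 2 + B * IZR n)))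
    by now apply zrap_zdom, zrap_theta.
  apply zsum_ext. intros n. rewrite sg_opp, opp_IZR. f_equal. f_equal. ring.
Qed.

Lemma utheta_opp A B : 0 < A -> utheta q A (- B) = utheta q A B.
Proof.
  intros HA. unfold utheta.
  rewrite <- (zsum_opp_index (fun n => Rpower q (A * IZR n ^ 2 + B * IZR n)))
    by now apply zrap_zdom, zrap_utheta.
  apply zsum_ext. intros n. rewrite opp_IZR. f_equal. ring.
Qed.

Lemma theta_period A B : 0 < A -> theta q A B = - Rpower q (A + B) * theta q A (B + 2 * A).
Proof.
  intros HA. unfold theta. rewrite <- zsum_scal.
  rewrite <- (zsum_shift 1 (fun n => sg n * Rpower q (A * IZR n ^ 2 + B * IZR n)))
    by now apply zrap_zdom, zrap_theta.
  apply zsum_ext. intros n. rewrite sg_add, plus_IZR.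
  replace (A * (IZR n + 1) ^ 2 + B * (IZR n + 1)) with
    ((A + B) + (A * IZR n ^ 2 + (B + 2 * A) * IZR n)) by ring.
  rewrite Rpower_plus. change (sg 1) with (-1). ring.
Qed.

Lemma utheta_period A B : 0 < A -> utheta q A B = Rpower q (A + B) * utheta q A (B + 2 * A).
Proof.
  intros HA. unfold utheta. rewrite <- zsum_scal.
  rewrite <- (zsum_shift 1 (fun n => Rpower q (A * IZR n ^ 2 + B * IZR n)))
    by now apply zrap_zdom, zrap_utheta.
  apply zsum_ext. intros n. rewrite plus_IZR.
  replace (A * (IZR n + 1) ^ 2 + B * (IZR n + 1)) with
    ((A + B) + (A * IZR n ^ 2 + (B + 2 * A) * IZR n)) by ring.
  now rewrite Rpower_plus.
Qed.

(** With [m = i + j (+ 1)] and [n = i - j] the exponent is again a sum of a function of [i] and a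
    function of [j], so the double sum factors on each coset; the sign [(-1)^(m + n)] is constant
    there. *)
Lemma theta_mul A x y : 0 < A ->
  theta q A (x + y) * theta q A (x - y) =
  utheta q (2 * A) (2 * x) * utheta q (2 * A) (2 * y) -
  Rpower q (A + x + y) * (utheta q (2 * A) (2 * A + 2 * x) * utheta q (2 * A) (2 * A + 2 * y)).
Proof.
  intros HA. unfold theta, utheta. rewrite <- !zsum2_prod, <- zsum2_scal.
  rewrite zsum2_mod2 by (apply zdom2_prod; now apply zrap_theta).
  unfold Rminus. f_equal.
  - apply zsum2_ext. intros i j.
    replace (sg (i + j) * Rpower q (A * IZR (i + j) ^ 2 + (x + y) * IZR (i + j)) *
      (sg (i - j) * Rpower q (A * IZR (i - j) ^ 2 + (x + - y) * IZR (i - j))))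
      with ((sg (i + j) * sg (i - j)) * (Rpower q (A * IZR (i + j) ^ 2 + (x + y) * IZR (i + j)) *
        Rpower q (A * IZR (i - j) ^ 2 + (x + - y) * IZR (i - j)))) by ring.
    rewrite <- !Rpower_plus, <- sg_add.
    replace (i + j + (i - j))%Z with (2 * i)%Z by lia. rewrite sg_double, Rmult_1_l.
    f_equal. rewrite minus_IZR, plus_IZR. ring.
  - match goal with |- _ = - ?z => replace (- z) with (-1 * z) by ring end.
    rewrite <- zsum2_scal.
    apply zsum2_ext. intros i j.
    replace (sg (i + j + 1) * Rpower q (A * IZR (i + j + 1) ^ 2 + (x + y) * IZR (i + j + 1)) *
      (sg (i - j) * Rpower q (A * IZR (i - j) ^ 2 + (x + - y) * IZR (i - j))))
      with ((sg (i + j + 1) * sg (i - j)) * (Rpower q (A * IZR (i + j + 1) ^ 2 + (x + y) * IZR (i + j + 1)) *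
        Rpower q (A * IZR (i - j) ^ 2 + (x + - y) * IZR (i - j)))) by ring.
    rewrite <- !Rpower_plus, <- sg_add.
    replace (i + j + 1 + (i - j))%Z with (2 * i + 1)%Z by lia. rewrite sg_add, sg_double.
    change (sg 1) with (-1).
    rewrite Rmult_1_l.
    f_equal. f_equal. rewrite minus_IZR, !plus_IZR. ring.
Qed.
End Theta.

(** * Relations between theta series of level 10 *)

Lemma zsum2_trans c d F : zdom2 F -> zsum2 (fun m n => F (m + c)%Z (n + d)%Z) = zsum2 F.
Proof.
  intros HF. rewrite (zsum2_shear (fun _ => d) (fun m n => F (m + c)%Z n)).
  - apply (zsum_shift c (fun a => zsum (F a))). now apply zdom2_rows.
  - zaff 1%Z 0%Z 0%Z 1%Z c 0%Z F.
Qed.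

Lemma zsum2_rot c d F : zdom2 F -> zsum2 (fun m n => F (c - n)%Z (m + d)%Z) = zsum2 F.
Proof.
  intros HF. rewrite <- (zsum2_refl1 F HF).
  assert (H1 : zdom2 (fun m n => F (- m)%Z n)) by zaff (-1)%Z 0%Z 0%Z 1%Z 0%Z 0%Z F.
  rewrite <- (zsum2_trans (- c) d _ H1).
  rewrite zsum2_swap by zaff 0%Z (-1)%Z 1%Z 0%Z c d F.
  apply zsum2_ext. intros; f_equal; lia.
Qed.

(* Multiplication by [i] on the odd Gaussian integers [(2 a + 1) + (2 b + 1) i] permutes
   the four nonzero residues modulo [2 + i]. *)
Lemma zsum2_mod5_rot G : zdom2 G -> (forall a b, G (-1 - b)%Z a = G a b) ->
  zsum2 G = 4 * zsum2 (fun m n => G (2 * m - n)%Z (m + 2 * n)%Z)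
    + zsum2 (fun m n => G (2 * m - n)%Z (m + 2 * n + 1)%Z).
Proof.
  intros HG Hrot. rewrite zsum2_mod5 by assumption.
  assert (H4 : zsum2 (fun m n => G (2 * m - n)%Z (m + 2 * n)%Z)
    = zsum2 (fun m n => G (2 * m - n + 4)%Z (m + 2 * n)%Z)).
  { rewrite <- (zsum2_rot (-2) 1 _ (zdom2_coset5 G 4 HG)).
    apply zsum2_ext. intros m n. rewrite <- Hrot. f_equal; lia. }
  assert (H1 : zsum2 (fun m n => G (2 * m - n + 4)%Z (m + 2 * n)%Z)
    = zsum2 (fun m n => G (2 * m - n + 1)%Z (m + 2 * n)%Z)).
  { rewrite <- (zsum2_rot 0 2 _ (zdom2_coset5 G 1 HG)).
    apply zsum2_ext. intros m n. rewrite <- Hrot. f_equal; lia. }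
  assert (H2 : zsum2 (fun m n => G (2 * m - n + 1)%Z (m + 2 * n)%Z)
    = zsum2 (fun m n => G (2 * m - n + 2)%Z (m + 2 * n)%Z)).
  { rewrite <- (zsum2_rot (-1) 1 _ (zdom2_coset5 G 2 HG)).
    apply zsum2_ext. intros m n. rewrite <- Hrot. f_equal; lia. }
  (* The class fixed by the rotation: with [A = 2 a + 1], [B = 2 b + 1], [a = 2 m - n + 3],
     [b = m + 2 n] one finds [A - 2 B = 5 - 10 n], so these are the multiples of [2 + i]. *)
  assert (H3 : zsum2 (fun m n => G (2 * m - n + 3)%Z (m + 2 * n)%Z)
    = zsum2 (fun m n => G (2 * m - n)%Z (m + 2 * n + 1)%Z)).
  { rewrite <- (zsum2_trans (-1) 1 _ (zdom2_coset5 G 3 HG)).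
    apply zsum2_ext. intros m n. f_equal; lia. }
  rewrite H3, <- H2, <- H1, <- H4. ring.
Qed.

Section Level10.
Variable q : R.
Hypothesis Hq : 0 < q < 1.

Lemma Rpower_cancel x : Rpower q x * Rpower q (- x) = 1.
Proof. rewrite <- Rpower_plus, Rplus_opp_r. apply Rpower_O. lra. Qed.

Notation t B := (theta q 5 B).
Notation u B := (utheta q 10 B).

Lemma theta_mul5 x y s d x2 y2 n : x + y = s -> x - y = d -> 2 * x = x2 -> 2 * y = y2 ->
  INR n = 5 + s ->
  t s * t d = u x2 * u y2 - q ^ n * (u (10 + x2) * u (10 + y2)).
Proof.
  intros <- <- <- <- Hn. rewrite theta_mul by (auto; lra).
  replace (2 * 5) with 10 by ring. rewrite (Rpower_nat q _ n); [ring|lra|lra].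
Qed.

Lemma utheta_half x y n : y = 10 - x -> INR n = 10 - x -> u x = q ^ n * u (10 + y).
Proof.
  intros -> Hn. rewrite <- utheta_opp, utheta_period by (auto; lra).
  rewrite (Rpower_nat q _ n) by lra. do 2 f_equal. ring.
Qed.

(* Writing [theta_mul] as [t (x + y) * t (x - y) = U x * U y - V x * V y], half-period shifts
   exchange [U] and [V]; this relation and the next one are then instances of
   [(a c - b d)^2 - (b c - a d)^2 = (a^2 - b^2) (c^2 - d^2)]. *)
Lemma theta10_relation1 :
  t 2 ^ 2 * t 1 ^ 2 - q ^ 2 * (t 4 ^ 2 * t 3 ^ 2) = t 3 * t 1 * t 0 ^ 2.
Proof.
  assert (H21 := theta_mul5 (3/2) (1/2) 2 1 3 1 7 ltac:(lra) ltac:(lra) ltac:(lra) ltac:(lra) ltac:(simpl; lra)).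
  assert (H43 := theta_mul5 (7/2) (1/2) 4 3 7 1 9 ltac:(lra) ltac:(lra) ltac:(lra) ltac:(lra) ltac:(simpl; lra)).
  assert (H30 := theta_mul5 (3/2) (3/2) 3 0 3 3 8 ltac:(lra) ltac:(lra) ltac:(lra) ltac:(lra) ltac:(simpl; lra)).
  assert (H10 := theta_mul5 (1/2) (1/2) 1 0 1 1 6 ltac:(lra) ltac:(lra) ltac:(lra) ltac:(lra) ltac:(simpl; lra)).
  assert (E1 := utheta_half 7 3 3 ltac:(lra) ltac:(simpl; lra)).
  assert (E2 := utheta_half 3 7 7 ltac:(lra) ltac:(simpl; lra)).
  replace (t 2 ^ 2 * t 1 ^ 2) with ((t 2 * t 1) ^ 2) by ring.
  replace (t 4 ^ 2 * t 3 ^ 2) with ((t 4 * t 3) ^ 2) by ring.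
  replace (t 3 * t 1 * t 0 ^ 2) with ((t 3 * t 0) * (t 1 * t 0)) by ring.
  rewrite H21, H43, H30, H10, E1, E2. ring.
Qed.

Lemma theta10_relation2 :
  t 3 ^ 2 * t 1 ^ 2 = q * (t 4 ^ 2 * t 2 ^ 2) + t 4 * t 2 * t 0 ^ 2.
Proof.
  assert (H31 := theta_mul5 2 1 3 1 4 2 8 ltac:(lra) ltac:(lra) ltac:(lra) ltac:(lra) ltac:(simpl; lra)).
  assert (H42 := theta_mul5 3 1 4 2 6 2 9 ltac:(lra) ltac:(lra) ltac:(lra) ltac:(lra) ltac:(simpl; lra)).
  assert (H40 := theta_mul5 2 2 4 0 4 4 9 ltac:(lra) ltac:(lra) ltac:(lra) ltac:(lra) ltac:(simpl; lra)).
  assert (H20 := theta_mul5 1 1 2 0 2 2 7 ltac:(lra) ltac:(lra) ltac:(lra) ltac:(lra) ltac:(simpl; lra)).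
  assert (E1 := utheta_half 6 4 4 ltac:(lra) ltac:(simpl; lra)).
  assert (E2 := utheta_half 4 6 6 ltac:(lra) ltac:(simpl; lra)).
  replace (t 3 ^ 2 * t 1 ^ 2) with ((t 3 * t 1) ^ 2) by ring.
  replace (t 4 ^ 2 * t 2 ^ 2) with ((t 4 * t 2) ^ 2) by ring.
  replace (t 4 * t 2 * t 0 ^ 2) with ((t 4 * t 0) * (t 2 * t 0)) by ring.
  rewrite H31, H42, H40, H20, E1, E2. ring.
Qed.

(* [theta q 1 0 ^ 2] is a sum over [Z[i]] with exponent the norm; the multiples of [2 + i]
   contribute [t 0 ^ 2], and the other four cosets contribute equally. *)
Lemma theta10_relation3 : theta q 1 0 ^ 2 = t 0 ^ 2 - 4 * q * (t 4 * t 2).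
Proof.
  replace (theta q 1 0 ^ 2) with (theta q 1 0 * theta q 1 0) by ring.
  unfold theta at 1 2. rewrite <- zsum2_prod.
  rewrite zsum2_mod5 by (apply zdom2_prod; apply zrap_theta; auto; lra).
  (* On the coset [r] the norm is [5 m^2 + 5 n^2 + 4 r m - 2 r n + r^2] and the sign is
     [(-1)^(r + m + n)]. *)
  assert (Hc : forall r s k, s = sg r -> INR k = IZR r ^ 2 ->
    zsum2 (fun m n => sg (2 * m - n + r) * Rpower q (1 * IZR (2 * m - n + r) ^ 2 + 0 * IZR (2 * m - n + r)) *
      (sg (m + 2 * n) * Rpower q (1 * IZR (m + 2 * n) ^ 2 + 0 * IZR (m + 2 * n))))
    = s * q ^ k * (t (4 * IZR r) * t (2 * IZR r))).
  { intros r s k -> Hk. rewrite <- (theta_opp q Hq 5 (2 * IZR r)) by lra.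
    unfold theta. rewrite <- zsum2_prod, <- zsum2_scal. apply zsum2_ext. intros m n.
    rewrite <- (Rpower_nat q (IZR r ^ 2) k) by lra.
    replace (sg (2 * m - n + r) * Rpower q (1 * IZR (2 * m - n + r) ^ 2 + 0 * IZR (2 * m - n + r)) *
      (sg (m + 2 * n) * Rpower q (1 * IZR (m + 2 * n) ^ 2 + 0 * IZR (m + 2 * n))))
    with (sg (2 * m - n + r) * sg (m + 2 * n) *
      (Rpower q (1 * IZR (2 * m - n + r) ^ 2 + 0 * IZR (2 * m - n + r)) *
       Rpower q (1 * IZR (m + 2 * n) ^ 2 + 0 * IZR (m + 2 * n)))) by ring.
    match goal with |- _ = ?l * (?a * ?p * (?b * ?p')) =>
      replace (l * (a * p * (b * p'))) with ((sg r * (a * b)) * (Rpower q (IZR r ^ 2) * (p * p'))) by ring end.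
    rewrite <- !Rpower_plus. f_equal.
    - rewrite sg_add, sg_sub, (sg_add m), !sg_double. ring.
    - f_equal. rewrite !plus_IZR, minus_IZR, !mult_IZR. ring. }
  rewrite (zsum2_ext (fun m n => _ * _ * _) (fun m n => sg (2 * m - n + 0) * Rpower q (1 * IZR (2 * m - n + 0) ^ 2 + 0 * IZR (2 * m - n + 0)) *
      (sg (m + 2 * n) * Rpower q (1 * IZR (m + 2 * n) ^ 2 + 0 * IZR (m + 2 * n)))))
    by (intros; now rewrite Z.add_0_r).
  rewrite (Hc 0%Z 1 0%nat), (Hc 1%Z (-1) 1%nat), (Hc 2%Z 1 4%nat), (Hc 3%Z (-1) 9%nat), (Hc 4%Z 1 16%nat)
    by (try reflexivity; simpl; lra).
  rewrite !Rmult_0_r.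
  replace (4 * 1) with 4 by ring. replace (2 * 1) with 2 by ring.
  replace (4 * 2) with 8 by ring. replace (2 * 2) with 4 by ring.
  replace (4 * 3) with 12 by ring. replace (2 * 3) with 6 by ring.
  replace (4 * 4) with 16 by ring. replace (2 * 4) with 8 by ring.
  (* Quasi-periodicity brings the arguments 6, 8 and 12 back to 4, 2 and 2, and 16 to 6, hence to
     4. *)
  assert (P : forall a b c k, a = - b -> c = b + 10 -> INR k = b + 5 -> t a = - q ^ k * t c).
  { intros a b c k -> -> Hk. rewrite theta_opp, theta_period by (auto; lra).
    rewrite (Rpower_nat q _ k) by lra. now replace (b + 2 * 5) with (b + 10) by ring. }
  assert (P' : forall a b c k, a = - b -> c = 10 + b -> INR k = - b - 5 -> q ^ k * t a = - t c).
  { intros a b c k -> -> Hk. rewrite theta_opp, theta_period by (auto; lra).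
    rewrite <- (Rpower_nat q (- b - 5) k) by lra.
    replace (- b - 5) with (- (5 + b)) by ring.
    replace (b + 2 * 5) with (10 + b) by ring.
    transitivity (- (Rpower q (5 + b) * Rpower q (- (5 + b))) * t (10 + b)); [ring|].
    rewrite Rpower_cancel. ring. }
  assert (E8 := P 2 (-2) 8 3%nat ltac:(lra) ltac:(lra) ltac:(simpl; lra)).
  assert (E12 := P (-2) 2 12 7%nat ltac:(lra) ltac:(lra) ltac:(simpl; lra)).
  assert (E6 := P' 6 (-6) 4 1%nat ltac:(lra) ltac:(lra) ltac:(simpl; lra)).
  assert (E16 := P (-6) 6 16 11%nat ltac:(lra) ltac:(lra) ltac:(simpl; lra)).
  replace (-2) with (- (2)) in E12 by ring. replace (-6) with (- (6)) in E16 by ring.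
  rewrite theta_opp in E12, E16 by (auto; lra).
  transitivity (t 0 ^ 2 - q * (t 4 * t 2) + q * (q ^ 3 * t 8) * t 4
    - q * (q ^ 7 * t 12) * (q ^ 1 * t 6) + q * q * q ^ 11 * t 16 * (q ^ 3 * t 8)); [ring|].
  replace (q ^ 3 * t 8) with (- t 2) by (rewrite E8; ring).
  replace (q ^ 7 * t 12) with (- t 2) by (rewrite E12; ring).
  replace (q * q * q ^ 11 * t 16) with (- (q * (q ^ 1 * t 6))) by (rewrite E16; ring).
  rewrite E6. ring.
Qed.

(** For [A = 1/2] this is twice Jacobi's series for the cube of [E], because the terms of index [n]
    and [-1 - n] are equal. *)
Definition jacobi (A : R) : R :=
  zsum (fun n => sg n * (2 * IZR n + 1) * Rpower q (A * IZR n ^ 2 + A * IZR n)).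

Lemma zsum_odd f : zdom f -> (forall n, f (-1 - n)%Z = - f n) -> zsum f = 0.
Proof.
  intros Hf Ho. pose proof (zsum_refl1 f) as H.
  rewrite (zsum_ext _ (fun n => -1 * f n)) in H by (intros n; rewrite Ho; ring).
  rewrite zsum_scal in H. lra.
Qed.

Lemma sg_refl1 n : sg (-1 - n) = - sg n.
Proof. rewrite sg_sub. change (sg (-1)) with (-1). ring. Qed.

(* With [A = 2 a + 1] and [B = 2 b + 1], the weights [A B] and [A ^ 2 - B ^ 2] are both
   compatible with the rotation; on the coset [a = 2 m - n], [b = m + 2 n] the combination
   [8 A B + 3 (A ^ 2 - B ^ 2)] equals [(10 m + 3) ^ 2 - (10 n + 1) ^ 2]. *)
Lemma wronskian_sum :
  zsum2 (fun m n => sg m * sg n *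
     (8 + 20 * (5 * IZR m ^ 2 + 3 * IZR m) - 20 * (5 * IZR n ^ 2 + IZR n)) *
     (Rpower q (5/2 * IZR m ^ 2 + 3/2 * IZR m) * Rpower q (5/2 * IZR n ^ 2 + 1/2 * IZR n)))
  = 2 * jacobi (1/2) ^ 2.
Proof.
  pose (p := fun A n => Rpower q (A * IZR n ^ 2 + A * IZR n)).
  pose (e := fun A n => sg n * p A n).
  pose (f := fun A n => sg n * (2 * IZR n + 1) * p A n).
  pose (g := fun A n => sg n * (2 * IZR n + 1) ^ 2 * p A n).
  assert (Hp : forall A n, p A (-1 - n)%Z = p A n).
  { intros A n. unfold p. f_equal. rewrite minus_IZR. ring. }
  assert (He : forall A, 0 < A -> zrap (e A)).
  { intros A HA. exact (zrap_gauss q A A sg 1 Hq HA sg_bound). }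
  assert (Hf : forall A, 0 < A -> zrap (f A)).
  { intros A HA. apply (zrap_gauss q A A _ 3 Hq HA sg_lin_bound). }
  assert (Hg : forall A, 0 < A -> zrap (g A)).
  { intros A HA. apply (zrap_gauss q A A _ 8 Hq HA sg_quad_bound). }
  assert (Oe : forall A n, e A (-1 - n)%Z = - e A n).
  { intros A n. unfold e. rewrite sg_refl1, Hp. ring. }
  assert (Of : forall A n, f A (-1 - n)%Z = f A n).
  { intros A n. unfold f. rewrite sg_refl1, Hp, minus_IZR. ring. }
  assert (Og : forall A n, g A (-1 - n)%Z = - g A n).
  { intros A n. unfold g. rewrite sg_refl1, Hp, minus_IZR. ring. }
  assert (Se : forall A, 0 < A -> zsum (e A) = 0).
  { intros A HA. apply zsum_odd; [now apply zrap_zdom, He|apply Oe]. }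
  assert (h : 0 < 1 / 2) by lra. assert (h5 : 0 < 5 / 2) by lra.
  pose (G1 := fun a b => f (1/2) a * f (1/2) b).
  pose (G2 := fun a b => g (1/2) a * e (1/2) b + -1 * (e (1/2) a * g (1/2) b)).
  assert (D1 : zdom2 G1) by (apply zdom2_prod; auto).
  assert (D2 : zdom2 G2).
  { apply zdom2_plus; [|apply zdom2_scal]; apply zdom2_prod; auto. }
  assert (S1 := zsum2_mod5_rot G1 D1 ltac:(intros; unfold G1; rewrite Of; ring)).
  assert (S2 := zsum2_mod5_rot G2 D2 ltac:(intros; unfold G2; rewrite Oe, Og; ring)).
  assert (T1 : zsum2 G1 = jacobi (1/2) ^ 2).
  { unfold G1. rewrite zsum2_prod. unfold jacobi, f, p. ring. }
  assert (T2 : zsum2 G2 = 0).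
  { unfold G2. rewrite zsum2_plus by (try apply zdom2_scal; apply zdom2_prod; auto).
    rewrite zsum2_scal, !zsum2_prod, !Se by auto. ring. }
  assert (Hcd : forall c d, p (1/2) (2 * c - d)%Z * p (1/2) (c + 2 * d + 1)%Z
     = q * (p (5/2) c * p (5/2) d)).
  { intros c d. unfold p. rewrite <- (Rpower_1 q) at 3 by lra. rewrite <- !Rpower_plus.
    f_equal. rewrite !plus_IZR, minus_IZR, !mult_IZR. field. }
  assert (Hsg : forall c d, sg (2 * c - d) * sg (c + 2 * d + 1) = - (sg c * sg d)).
  { intros c d. rewrite <- sg_add. replace (2 * c - d + (c + 2 * d + 1))%Z with (2 * c + (c + d + 1))%Z by lia.
    rewrite !sg_add, sg_double. change (sg 1) with (-1). ring. }
  (* With [C = 2 c + 1] and [D = 2 d + 1] the multiples of [2 + i] are [A = 2 C - D], [B = C + 2 D].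
     In both weights the terms in [C^2] and [D^2] contribute 0 since [zsum (e (5/2))] vanishes. What
     remains is [3 C D] for [A B] and [-8 C D] for [A^2 - B^2]: the coefficients 8 and 3 are chosen
     to cancel them. *)
  assert (N1 : zsum2 (fun m n => G1 (2 * m - n)%Z (m + 2 * n + 1)%Z) = - 3 * q * jacobi (5/2) ^ 2).
  { transitivity (zsum2 (fun c d => - 2 * q * (g (5/2) c * e (5/2) d)
      + (2 * q * (e (5/2) c * g (5/2) d) + - 3 * q * (f (5/2) c * f (5/2) d)))).
    - apply zsum2_ext. intros c d. unfold G1, f.
      match goal with |- ?s * ?a * ?x * (?s' * ?b * ?y) = _ =>
        replace (s * a * x * (s' * b * y)) with (s * s' * (a * b) * (x * y)) by ring end.
      rewrite Hcd, Hsg. unfold e, g. rewrite !plus_IZR, minus_IZR, !mult_IZR. ring.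
    - rewrite !zsum2_plus by (repeat apply zdom2_plus; apply zdom2_scal; apply zdom2_prod; auto).
      rewrite !zsum2_scal, !zsum2_prod, !Se by auto. unfold jacobi, f, p. ring. }
  assert (N2 : zsum2 (fun m n => G2 (2 * m - n)%Z (m + 2 * n + 1)%Z) = 8 * q * jacobi (5/2) ^ 2).
  { transitivity (zsum2 (fun c d => - 3 * q * (g (5/2) c * e (5/2) d)
      + (3 * q * (e (5/2) c * g (5/2) d) + 8 * q * (f (5/2) c * f (5/2) d)))).
    - apply zsum2_ext. intros c d. unfold G2, g, e.
      match goal with |- ?s * ?a * ?x * (?s' * ?y) + -1 * (?s * ?x * (?s' * ?b * ?y)) = _ =>
        replace (s * a * x * (s' * y) + -1 * (s * x * (s' * b * y)))
          with (s * s' * (a - b) * (x * y)) by ring end.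
      rewrite Hcd, Hsg. unfold f. rewrite !plus_IZR, minus_IZR, !mult_IZR. ring.
    - rewrite !zsum2_plus by (repeat apply zdom2_plus; apply zdom2_scal; apply zdom2_prod; auto).
      rewrite !zsum2_scal, !zsum2_prod, !Se by auto. unfold jacobi, f, p. ring. }
  rewrite T1, N1 in S1. rewrite T2, N2 in S2.
  assert (C1 : zdom2 (fun m n => G1 (2 * m - n)%Z (m + 2 * n)%Z)) by zaff 2%Z (-1)%Z 1%Z 2%Z 0%Z 0%Z G1.
  assert (C2 : zdom2 (fun m n => G2 (2 * m - n)%Z (m + 2 * n)%Z)) by zaff 2%Z (-1)%Z 1%Z 2%Z 0%Z 0%Z G2.
  transitivity (8 * zsum2 (fun m n => G1 (2 * m - n)%Z (m + 2 * n)%Z)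
     + 3 * zsum2 (fun m n => G2 (2 * m - n)%Z (m + 2 * n)%Z)); [|lra].
  rewrite <- !zsum2_scal, <- zsum2_plus by now apply zdom2_scal.
  apply zsum2_ext. intros m n. unfold G1, G2, f, g, e.
  match goal with |- ?s * ?s' * ?w * (?y * ?z) = 8 * (?s1 * ?a * ?x * (?s1' * ?b * ?x')) + _ =>
    transitivity ((s1 * s1') * (8 * (a * b) + 3 * (a ^ 2 - b ^ 2)) * (x * x')); [|ring] end.
  replace (sg (2 * m - n) * sg (m + 2 * n)) with (sg m * sg n).
  2:{ rewrite <- (sg_add (2 * m - n)). replace (2 * m - n + (m + 2 * n))%Z with (2 * m + (m + n))%Z by lia.
      rewrite (sg_add (2 * m)), sg_double, sg_add. ring. }
  unfold p. rewrite <- !Rpower_plus. f_equal.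
  - f_equal. rewrite !plus_IZR, minus_IZR, !mult_IZR. ring.
  - f_equal. rewrite !plus_IZR, minus_IZR, !mult_IZR. field.
Qed.
End Level10.

(** * The triple product and Jacobi's identity *)

(** The q-Pochhammer symbol [(c; p)_n]; its limit [qp] is the infinite product. *)
Fixpoint qpn (c p : R) (n : nat) : R :=
  match n with O => 1 | S m => qpn c p m * (1 - c * p ^ m) end.

Definition qp (c p : R) : R := real (Lim_seq (qpn c p)).

Lemma qpn_add c p m n : qpn c p (m + n) = qpn c p m * qpn (c * p ^ m) p n.
Proof.
  induction n.
  - rewrite Nat.add_0_r. simpl. ring.
  - rewrite Nat.add_succ_r. simpl. rewrite IHn, pow_add. ring.
Qed.

Lemma qpn_head c p n : qpn c p (S n) = (1 - c) * qpn (c * p) p n.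
Proof.
  change (S n) with (1 + n)%nat. rewrite qpn_add. simpl. rewrite !Rmult_1_r. ring.
Qed.

(** Each factor satisfies [1 - x >= exp (- x / (1 - c))] for [0 < x <= c], and the exponents form a
    geometric sum. Since this sum is bounded in [n], the infinite product is positive. *)
Lemma qpn_lower c p n : 0 < c < 1 -> 0 < p < 1 ->
  exp (- (c / (1 - c) * ((1 - p ^ n) / (1 - p)))) <= qpn c p n.
Proof.
  intros Hc Hp. induction n; simpl qpn.
  - rewrite pow_O. replace (- _) with 0 by (field; lra). rewrite exp_0. lra.
  - assert (Hpn : 0 < p ^ n <= 1) by (split; [apply pow_lt; lra|rewrite <- (pow1 n); apply pow_incr; lra]).
    assert (Hx : c * p ^ n <= c) by nra.
    assert (Hx0 : 0 < c * p ^ n) by nra.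
    replace (- (c / (1 - c) * ((1 - p ^ S n) / (1 - p)))) with
      (- (c / (1 - c) * ((1 - p ^ n) / (1 - p))) + - (c * p ^ n / (1 - c)))
      by (simpl; field; lra).
    rewrite exp_plus. apply Rmult_le_compat; [left; apply exp_pos|left; apply exp_pos|exact IHn|].
    set (x := c * p ^ n) in *.
    rewrite exp_Ropp. rewrite <- (Rinv_inv (1 - x)).
    apply Rinv_le_contravar; [apply Rinv_0_lt_compat; lra|].
    eapply Rle_trans; [|apply exp_ineq1_le].
    apply Rmult_le_reg_l with (1 - x); [lra|]. rewrite Rinv_r by lra.
    assert (x / (1 - c) * (1 - c) = x) by (field; lra).
    assert (0 <= x / (1 - c)) by (apply Rdiv_le_0_compat; lra).
    nra.
Qed.

Lemma qpn_pos c p n : 0 < c < 1 -> 0 < p < 1 -> 0 < qpn c p n.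
Proof.
  intros Hc Hp. eapply Rlt_le_trans; [apply exp_pos|]. now apply qpn_lower.
Qed.

Lemma qpn_decr c p n : 0 < c < 1 -> 0 < p < 1 -> qpn c p (S n) <= qpn c p n.
Proof.
  intros Hc Hp. simpl. pose proof (qpn_pos c p n Hc Hp).
  assert (0 < p ^ n) by (apply pow_lt; lra).
  assert (0 < qpn c p n * (c * p ^ n)) by (apply Rmult_lt_0_compat; [auto|nra]). lra.
Qed.

Lemma qpn_decr_le c p m n : 0 < c < 1 -> 0 < p < 1 -> (m <= n)%nat -> qpn c p n <= qpn c p m.
Proof.
  intros Hc Hp. induction 1; [lra|]. pose proof (qpn_decr c p m0 Hc Hp). lra.
Qed.

Lemma is_lim_qpn c p : 0 < c < 1 -> 0 < p < 1 -> is_lim_seq (qpn c p) (qp c p).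
Proof.
  intros Hc Hp. apply Lim_seq_correct'.
  apply (ex_finite_lim_seq_decr _ 0).
  - intros n. now apply qpn_decr.
  - intros n. left. now apply qpn_pos.
Qed.

Lemma qp_le c p n : 0 < c < 1 -> 0 < p < 1 -> qp c p <= qpn c p n.
Proof.
  intros Hc Hp. apply (is_lim_seq_decr_compare _ _ (is_lim_qpn c p Hc Hp)).
  intros k. now apply qpn_decr.
Qed.

Lemma qp_pos c p : 0 < c < 1 -> 0 < p < 1 -> 0 < qp c p.
Proof.
  intros Hc Hp. apply Rlt_le_trans with (exp (- (c / (1 - c) * (1 / (1 - p))))); [apply exp_pos|].
  refine (is_lim_seq_le (fun _ => exp (- (c / (1 - c) * (1 / (1 - p))))) _ (Finite _) (Finite _) _
    (is_lim_seq_const _) (is_lim_qpn c p Hc Hp)).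
  intros n. eapply Rle_trans; [|now apply qpn_lower].
  assert (H : c / (1 - c) * ((1 - p ^ n) / (1 - p)) <= c / (1 - c) * (1 / (1 - p))).
  { apply Rmult_le_compat_l; [apply Rdiv_le_0_compat; lra|].
    apply Rmult_le_compat_r; [left; apply Rinv_0_lt_compat; lra|].
    assert (0 < p ^ n) by (apply pow_lt; lra). lra. }
  destruct H as [H|H]; [left; apply exp_increasing; lra|right; now rewrite H].
Qed.

Fixpoint tri (n : nat) : nat := match n with O => O | S m => (tri m + m)%nat end.

Lemma tri_INR n : INR (tri n) = INR n * (INR n - 1) / 2.
Proof.
  induction n; [simpl; field|]. change (tri (S n)) with (tri n + n)%nat.
  rewrite plus_INR, IHn, S_INR. field.
Qed.

(** The Gaussian binomial coefficient, defined by its Pascal rule and hence without division. *)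
Fixpoint qbin (p : R) (N i : nat) : R :=
  match N, i with
  | _, O => 1
  | O, S _ => 0
  | S N', S i' => qbin p N' (S i') + p ^ (N' - i') * qbin p N' i'
  end.

Lemma qbin_0 p N : qbin p N 0 = 1.
Proof. now destruct N. Qed.

Lemma qbin_out p N i : (N < i)%nat -> qbin p N i = 0.
Proof.
  revert i. induction N; intros [|i] H; try lia; simpl; auto.
  rewrite !IHN by lia. ring.
Qed.

(* [sum_n] leaves equations over the carrier of [R_AbelianMonoid], which [ring] does not see as [R]. *)
Ltac rring := match goal with |- @eq _ ?a ?b => change (@eq R a b); ring end.

Lemma sum_n_head (a : nat -> R) n : sum_n a (S n) = a O + sum_n (fun i => a (S i)) n.
Proof.
  induction n.
  - now rewrite sum_n_S, !sum_O.
  - rewrite sum_n_S, IHn, (sum_n_S (fun i => a (S i))). rring.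
Qed.

Lemma sum_n_scal (c : R) (a : nat -> R) n : sum_n (fun i => c * a i) n = c * sum_n a n.
Proof. induction n; [now rewrite !sum_O|]. rewrite !sum_n_S, IHn. rring. Qed.

Lemma sum_n_add (a b : nat -> R) n : sum_n (fun i => a i + b i) n = sum_n a n + sum_n b n.
Proof. induction n; [now rewrite !sum_O|]. rewrite !sum_n_S, IHn. rring. Qed.

(** Rothe's q-binomial theorem. Multiplication by the last factor [1 + x p^N] matches the Pascal
    rule through [p^(N - i) p^i = p^N]. *)
Lemma q_binomial p x N :
  qpn (- x) p N = sum_n (fun i => qbin p N i * p ^ tri i * x ^ i) N.
Proof.
  induction N.
  - rewrite sum_O. simpl. ring.
  - rewrite sum_n_head.
    assert (H : forall i, (i <= N)%nat -> qbin p (S N) (S i) * p ^ tri (S i) * x ^ S i =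
      qbin p N (S i) * p ^ tri (S i) * x ^ S i + p ^ N * x * (qbin p N i * p ^ tri i * x ^ i)).
    { intros i Hi. simpl qbin. change (tri (S i)) with (tri i + i)%nat.
      replace (p ^ N) with (p ^ (N - i) * p ^ i) by (rewrite <- pow_add; f_equal; lia).
      rewrite pow_add. simpl. ring. }
    rewrite (sum_n_ext_loc _ _ _ H). clear H.
    rewrite sum_n_add, sum_n_scal, <- IHN. simpl qpn.
    pose proof (sum_n_head (fun i => qbin p N i * p ^ tri i * x ^ i) N) as H.
    rewrite sum_n_S, <- IHN, qbin_out, !qbin_0 in H by lia. rewrite qbin_0. lra.
Qed.

Lemma qbin_closed p N i : 0 < p < 1 -> (i <= N)%nat ->
  qbin p N i * (qpn p p i * qpn p p (N - i)) = qpn p p N.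
Proof.
  intros Hp. revert i. induction N; intros i Hi.
  - replace i with O by lia. simpl. ring.
  - destruct i as [|i].
    + rewrite qbin_0. simpl qpn at 1. rewrite Nat.sub_0_r. ring.
    + simpl qbin. replace (S N - S i)%nat with (N - i)%nat by lia.
      destruct (Nat.eq_dec i N) as [->|Hne].
      * rewrite qbin_out, Nat.sub_diag by lia.
        specialize (IHN N ltac:(lia)). rewrite Nat.sub_diag in IHN. simpl in *.
        assert (0 < qpn p p N) by (apply qpn_pos; lra).
        assert (qbin p N N = 1). { apply Rmult_eq_reg_r with (qpn p p N); lra. }
        rewrite H0. ring.
      * pose proof (IHN (S i) ltac:(lia)) as H1. pose proof (IHN i ltac:(lia)) as H2.
        destruct (N - i)%nat as [|k] eqn:Ek; [lia|].
        replace (N - S i)%nat with k in H1 by lia.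
        simpl qpn in *. replace (p * p ^ N) with (p ^ S k * (p * p ^ i)).
        2:{ replace N with (S k + i)%nat by lia. rewrite pow_add. ring. }
        transitivity ((qbin p N (S i) * (qpn p p i * (1 - p * p ^ i) * qpn p p k)) * (1 - p * p ^ k)
          + p ^ S k * (qbin p N i * (qpn p p i * (qpn p p k * (1 - p * p ^ k)))) * (1 - p * p ^ i)); [ring|].
        rewrite H1, H2. simpl. ring.
Qed.

(** The bound is uniform in [N] and [i]: it is the majorant for the passage to the limit in the
    finite triple product. *)
Lemma qbin_bound p N i : 0 < p < 1 -> 0 <= qbin p N i <= / qp p p.
Proof.
  intros Hp. pose proof (qp_pos p p Hp Hp) as H0.
  destruct (le_lt_dec i N) as [Hi|Hi].
  - pose proof (qbin_closed p N i Hp Hi) as H.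
    assert (H1 : 0 < qpn p p i) by (now apply qpn_pos).
    assert (H2 : qp p p <= qpn p p (N - i)) by (now apply qp_le).
    assert (H3 : qpn p p N <= qpn p p i) by (now apply qpn_decr_le).
    assert (H4 : 0 < qpn p p N) by (now apply qpn_pos).
    assert (H5 : qbin p N i = qpn p p N / qpn p p i / qpn p p (N - i)).
    { rewrite <- H. field. lra. }
    assert (H6 : qpn p p N / qpn p p i <= 1).
    { apply Rmult_le_reg_r with (qpn p p i); auto. unfold Rdiv. rewrite Rmult_assoc, Rinv_l by lra. lra. }
    assert (H7 : 0 < qpn p p N / qpn p p i) by (now apply Rdiv_lt_0_compat).
    assert (H8 : / qpn p p (N - i) <= / qp p p) by (now apply Rinv_le_contravar).
    assert (H9 : 0 < / qpn p p (N - i)) by (apply Rinv_0_lt_compat; lra).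
    rewrite H5. unfold Rdiv at 1 3. split; [unfold Rdiv in *; nra|].
    fold (qpn p p N / qpn p p i). nra.
  - rewrite qbin_out by lia. split; [lra|]. left. now apply Rinv_0_lt_compat.
Qed.

Lemma qbin_lim p j : 0 < p < 1 ->
  is_lim_seq (fun n => qbin p (2 * n) (Z.to_nat (Z.of_nat n + j))) (/ qp p p).
Proof.
  intros Hp. pose proof (qp_pos p p Hp Hp) as H0.
  apply (is_lim_seq_ext_loc (fun n => qpn p p (2 * n) /
     (qpn p p (Z.to_nat (Z.of_nat n + j)) * qpn p p (Z.to_nat (Z.of_nat n - j))))).
  - exists (Z.to_nat (Z.abs j)). intros n Hn.
    rewrite <- (qbin_closed p (2 * n) (Z.to_nat (Z.of_nat n + j)) Hp) by lia.
    replace (2 * n - Z.to_nat (Z.of_nat n + j))%nat with (Z.to_nat (Z.of_nat n - j)) by lia.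
    field. split; apply Rgt_not_eq, qpn_pos; auto.
  - replace (/ qp p p) with (qp p p / (qp p p * qp p p)) by (field; lra).
    assert (Hs : forall phi, filterlim phi eventually eventually ->
      is_lim_seq (fun n => qpn p p (phi n)) (qp p p)).
    { intros phi Hphi. apply (is_lim_seq_subseq (qpn p p)); auto. now apply is_lim_qpn. }
    apply is_lim_seq_div'; [| |nra].
    + apply Hs. apply eventually_subseq. intros; lia.
    + apply is_lim_seq_mult'; apply Hs.
      * intros P [N HN]. exists (N + Z.to_nat (Z.abs j))%nat. intros n Hn. apply HN. lia.
      * intros P [N HN]. exists (N + Z.to_nat (Z.abs j))%nat. intros n Hn. apply HN. lia.
Qed.

(** The term [y^j p^(j (j - 1) / 2)] of the triple product; [y] may be negative, hence [powerRZ]. *)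
Definition jterm (y p : R) (j : Z) : R :=
  powerRZ y j * Rpower p (1/2 * IZR j ^ 2 + - (1/2) * IZR j).

(** Factor by factor, [1 + y / p^k = (y / p^k) (1 + p^k / y)] for [k] from 1 to [n]. *)
Lemma qpn_reverse y p n : y <> 0 -> p <> 0 ->
  qpn (- (y / p ^ n)) p n = y ^ n / p ^ tri (S n) * qpn (- (p / y)) p n.
Proof.
  intros Hy Hp. induction n.
  - simpl. field.
  - rewrite qpn_head. replace (- (y / p ^ S n) * p) with (- (y / p ^ n)).
    2:{ simpl. field. split; auto. now apply pow_nonzero. }
    rewrite IHn. change (tri (S (S n))) with (tri (S n) + S n)%nat. rewrite pow_add.
    assert (p ^ n <> 0) by now apply pow_nonzero.
    assert (p ^ tri (S n) <> 0) by now apply pow_nonzero.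
    cbn [qpn pow]. field. auto.
Qed.

Lemma jterm_nat y p i n : y <> 0 -> 0 < p ->
  p ^ tri i * (y / p ^ n) ^ i = y ^ n / p ^ tri (S n) * jterm y p (Z.of_nat i - Z.of_nat n).
Proof.
  intros Hy Hp. unfold jterm. unfold Rdiv at 1. rewrite Rpow_mult_distr, pow_inv, <- pow_mult.
  unfold Z.sub. rewrite powerRZ_add, <- !pow_powerRZ, powerRZ_neg', <- pow_powerRZ by auto.
  assert (y ^ n <> 0) by now apply pow_nonzero.
  rewrite <- (Rpower_pow (tri i)), <- (Rpower_pow (n * i)), <- (Rpower_pow (tri (S n))) by auto.
  rewrite plus_IZR, opp_IZR, <- !INR_IZR_INZ, mult_INR, !tri_INR, S_INR.
  transitivity (y ^ i * (Rpower p (INR i * (INR i - 1) / 2) * Rpower p (- (INR n * INR i)))).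
  { rewrite (Rpower_Ropp p (INR n * INR i)). ring. }
  transitivity (y ^ i * (Rpower p (- ((INR n + 1) * (INR n + 1 - 1) / 2)) *
     Rpower p (1/2 * (INR i + - INR n) ^ 2 + - (1/2) * (INR i + - INR n)))).
  { f_equal. rewrite <- !Rpower_plus. f_equal. field. }
  rewrite Rpower_Ropp. field. split; auto. apply Rgt_not_eq, exp_pos.
Qed.

(** The q-binomial theorem with [2 n] factors at [x = y / p^n], which centres the sum at index 0;
    the first [n] factors are reversed by [qpn_reverse]. *)
Lemma finite_jacobi y p n : y <> 0 -> 0 < p ->
  qpn (- y) p n * qpn (- (p / y)) p n =
  sum_n (fun i => qbin p (2 * n) i * jterm y p (Z.of_nat i - Z.of_nat n)) (2 * n).
Proof.
  intros Hy Hp.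
  assert (y ^ n <> 0) by now apply pow_nonzero.
  assert (p ^ n <> 0) by (apply pow_nonzero; lra).
  assert (p ^ tri (S n) <> 0) by (apply pow_nonzero; lra).
  pose proof (q_binomial p (y / p ^ n) (2 * n)) as H2.
  replace (2 * n)%nat with (n + n)%nat in H2 at 1 by lia.
  rewrite qpn_add, qpn_reverse in H2 by (auto; lra).
  replace (- (y / p ^ n) * p ^ n) with (- y) in H2 by (field; auto).
  rewrite (sum_n_ext _ (fun i => y ^ n / p ^ tri (S n) *
    (qbin p (2 * n) i * jterm y p (Z.of_nat i - Z.of_nat n)))) in H2.
  2:{ intros i. rewrite Rmult_assoc, jterm_nat by auto. rring. }
  rewrite sum_n_scal in H2.
  apply Rmult_eq_reg_l with (y ^ n / p ^ tri (S n)).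
  2:{ unfold Rdiv. apply Rmult_integral_contrapositive_currified; auto. now apply Rinv_neq_0_compat. }
  rewrite <- H2. ring.
Qed.

Lemma sum_sym_S (f : Z -> R) m :
  sum_n (fun i => f (Z.of_nat i - Z.of_nat (S m))%Z) (2 * S m) =
  f (- Z.of_nat (S m))%Z + sum_n (fun i => f (Z.of_nat i - Z.of_nat m)%Z) (2 * m) + f (Z.of_nat (S m)).
Proof.
  replace (2 * S m)%nat with (S (S (2 * m))) by lia.
  rewrite sum_n_head, sum_n_S.
  rewrite (sum_n_ext (fun i => f (Z.of_nat (S i) - Z.of_nat (S m))%Z)
      (fun i => f (Z.of_nat i - Z.of_nat m)%Z)) by (intros; f_equal; lia).
  replace (Z.of_nat (S (S (2 * m))) - Z.of_nat (S m))%Z with (Z.of_nat (S m)) by lia.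
  replace (Z.of_nat 0 - Z.of_nat (S m))%Z with (- Z.of_nat (S m))%Z by lia. rring.
Qed.

Lemma zsum_finite (h : Z -> R) n : (forall j, (Z.of_nat n < Z.abs j)%Z -> h j = 0) ->
  zsum h = sum_n (fun i => h (Z.of_nat i - Z.of_nat n)%Z) (2 * n).
Proof.
  intros Hh.
  (* The paired partial sum up to [m] contains one index more than the symmetric one, namely
     [-1 - m]. *)
  assert (H : forall m, sum_n (fun i => h (Z.of_nat i - Z.of_nat m)%Z) (2 * m) + h (-1 - Z.of_nat m)%Z =
     sum_n (fun k => h (Z.of_nat k) + h (-1 - Z.of_nat k)%Z) m).
  { induction m; [now rewrite !sum_O|].
    rewrite sum_n_S, <- IHm, (sum_sym_S h).
    replace (- Z.of_nat (S m))%Z with (-1 - Z.of_nat m)%Z by lia. rring. }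
  specialize (H n). rewrite (Hh (-1 - Z.of_nat n)%Z) in H by lia. rewrite Rplus_0_r in H.
  rewrite H. apply is_series_unique.
  match goal with |- is_series ?a ?l => change (is_lim_seq (sum_n a) l) end.
  match goal with |- is_lim_seq _ ?l => apply (is_lim_seq_ext_loc (fun _ => l)); [|apply is_lim_seq_const] end.
  exists n. intros m Hm. induction Hm; [reflexivity|].
  rewrite sum_n_S, <- IHHm, !Hh by lia. ring.
Qed.

Lemma powerRZ_abs x z : Rabs (powerRZ x z) = powerRZ (Rabs x) z.
Proof.
  destruct z; simpl; [apply Rabs_R1|now rewrite RPow_abs|now rewrite Rabs_inv, RPow_abs].
Qed.

Lemma jterm_bound y p : y <> 0 -> 0 < p < 1 -> exists C, 0 <= C /\ forall j, Rabs (jterm y p j) <= C * zw j ^ 4.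
Proof.
  intros Hy Hp. destruct (gauss_bound p (1/2) (ln (Rabs y) / ln p - 1/2) Hp ltac:(lra)) as [C [HC0 HC]].
  exists C. split; auto. intros j. eapply Rle_trans; [|apply HC]. right.
  unfold jterm. rewrite Rabs_mult, (Rabs_pos_eq (Rpower _ _)) by (left; apply exp_pos).
  assert (Hln : ln p <> 0).
  { assert (ln p < 0); [|lra]. rewrite <- ln_1. apply ln_increasing; lra. }
  assert (Hj : Rabs (powerRZ y j) = Rpower p (ln (Rabs y) / ln p * IZR j)).
  { rewrite powerRZ_abs, powerRZ_Rpower by now apply Rabs_pos_lt.
    unfold Rpower. f_equal. field. auto. }
  rewrite Hj, <- Rpower_plus. f_equal. ring.
Qed.

Lemma zdom_jterm w y p : y <> 0 -> 0 < p < 1 -> (forall j, Rabs (w j) <= 1 + IZR j ^ 2) ->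
  zdom (fun j => w j * jterm y p j).
Proof.
  intros Hy Hp Hw. destruct (jterm_bound y p Hy Hp) as [C [HC0 HC]].
  apply zrap_zdom, (zrap_weight w _ 1 C); auto. intros n. now rewrite Rmult_1_l.
Qed.

(** The weight [w] is 1 for the triple product itself and [j] for its derivative in [y]. *)
Lemma jacobi_sum_lim (w : Z -> R) y p : y <> 0 -> 0 < p < 1 ->
  (forall j, Rabs (w j) <= 1 + IZR j ^ 2) ->
  is_lim_seq (fun n => sum_n (fun i => qbin p (2 * n) i *
      (w (Z.of_nat i - Z.of_nat n)%Z * jterm y p (Z.of_nat i - Z.of_nat n))) (2 * n))
    (zsum (fun j => w j * jterm y p j) / qp p p).
Proof.
  intros Hy Hp Hw. pose proof (qp_pos p p Hp Hp) as H0.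
  destruct (zdom_jterm w y p Hy Hp Hw) as [C HC].
  pose (h := fun n j => (if Z_le_dec (Z.abs j) (Z.of_nat n)
    then qbin p (2 * n) (Z.to_nat (Z.of_nat n + j)) else 0) * (w j * jterm y p j)).
  apply (is_lim_seq_ext (fun n => zsum (h n))).
  - intros n. rewrite (zsum_finite (h n) n).
    + apply sum_n_ext_loc. intros i Hi. unfold h. destruct Z_le_dec as [|Hn]; [|lia].
      f_equal. f_equal. lia.
    + intros j Hj. unfold h. destruct Z_le_dec; [lia|]. ring.
  - unfold Rdiv. rewrite <- zsum_scal_r.
    apply (zsum_dominated h _ (fun j => / qp p p * C * zw j)).
    + exists O. intros n _ j. unfold h. rewrite Rabs_mult, Rmult_assoc.
      apply Rmult_le_compat; [apply Rabs_pos|apply Rabs_pos| |apply HC].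
      destruct Z_le_dec.
      * pose proof (qbin_bound p (2 * n) (Z.to_nat (Z.of_nat n + j)) Hp).
        rewrite Rabs_pos_eq; lra.
      * rewrite Rabs_R0. left. now apply Rinv_0_lt_compat.
    + apply zdom_zw.
    + intros j. unfold h. rewrite (Rmult_comm (w j * jterm y p j)).
      apply is_lim_seq_mult'; [|apply is_lim_seq_const].
      apply (is_lim_seq_ext_loc (fun n => qbin p (2 * n) (Z.to_nat (Z.of_nat n + j)))); [|now apply qbin_lim].
      exists (Z.to_nat (Z.abs j)). intros n Hn. destruct Z_le_dec; [reflexivity|lia].
Qed.

(** Kept in the form of a limit because [qp] is studied only for arguments between 0 and 1, whereas
    [psi_product] takes a positive [y]. *)
Lemma triple_product_lim y p : y <> 0 -> 0 < p < 1 ->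
  is_lim_seq (fun n => qpn (- y) p n * qpn (- (p / y)) p n) (zsum (jterm y p) / qp p p).
Proof.
  intros Hy Hp.
  rewrite (zsum_ext (jterm y p) (fun j => 1 * jterm y p j)) by (intros; ring).
  eapply is_lim_seq_ext; [|apply (jacobi_sum_lim (fun _ => 1)); auto].
  - intros n. rewrite finite_jacobi by (auto; lra). apply sum_n_ext. intros i. simpl. ring.
  - intros j. rewrite Rabs_R1. pose proof (pow2_ge_0 (IZR j)). lra.
Qed.

Lemma triple_product c p : 0 < p < c -> c < 1 ->
  zsum (jterm (- c) p) = qp c p * qp (p / c) p * qp p p.
Proof.
  intros Hc Hc1. assert (Hp : 0 < p < 1) by lra.
  pose proof (qp_pos p p Hp Hp) as H0.
  assert (Hpc : 0 < p / c < 1).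
  { split; [apply Rdiv_lt_0_compat; lra|]. apply Rmult_lt_reg_r with c; [lra|].
    unfold Rdiv. rewrite Rmult_assoc, Rinv_l by lra. lra. }
  assert (H := triple_product_lim (- c) p ltac:(lra) Hp).
  apply (is_lim_seq_ext _ (fun n => qpn c p n * qpn (p / c) p n)) in H.
  2:{ intros n. f_equal; f_equal; field; lra. }
  assert (H' := is_lim_seq_mult' _ _ _ _ (is_lim_qpn c p ltac:(lra) Hp) (is_lim_qpn _ p Hpc Hp)).
  apply is_lim_seq_unique in H. apply is_lim_seq_unique in H'. rewrite H in H'.
  apply (f_equal real) in H'. simpl in H'. rewrite <- H'. field. lra.
Qed.

Lemma ex_derive_qpn a p n x : ex_derive (fun x => qpn (- (x * a)) p n) x.
Proof.
  induction n; simpl.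
  - apply ex_derive_const.
  - apply (ex_derive_mult (fun x => qpn (- (x * a)) p n)); auto.
    auto_derive. auto.
Qed.

(* The derivative of the finite triple product with respect to [y] at its zero [y = -1]. *)
Lemma finite_jacobi_derive p n : 0 < p < 1 ->
  sum_n (fun i => qbin p (2 * S n) i * (IZR (Z.of_nat i - Z.of_nat (S n)) * jterm (-1) p (Z.of_nat i - Z.of_nat (S n)))) (2 * S n)
  = - (qpn p p (S n) * qpn p p n).
Proof.
  intros Hp.
  assert (Hpn : p ^ S n <> 0) by (apply pow_nonzero; lra).
  assert (Hpt : p ^ tri (S (S n)) <> 0) by (apply pow_nonzero; lra).
  (* The zero of the factor of index [S n] in [qpn (- x) p (2 * S n)]; it corresponds to [y = -1].
     In the derivative of the product only the term that differentiates this factor survives. *)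
  pose (x0 := -1 / p ^ S n).
  assert (Hx0 : x0 * p ^ S n = -1) by (unfold x0; field; auto).
  assert (Hx0' : x0 <> 0) by (intros He; rewrite He in Hx0; lra).
  pose (u := fun x => qpn (- (x * 1)) p (S n) * qpn (- (x * p ^ S (S n))) p n).
  assert (Hu : ex_derive u x0) by (apply @ex_derive_mult; apply ex_derive_qpn).
  assert (D1 : is_derive (fun x => qpn (- x) p (2 * S n)) x0 (u x0 * p ^ S n)).
  { apply (is_derive_ext (fun x => u x * (1 + x * p ^ S n))).
    - intros x. unfold u. replace (2 * S n)%nat with (S n + S n)%nat by lia.
      rewrite qpn_add, (qpn_head (- x * p ^ S n)), Rmult_1_r.
      replace (- (x * p ^ S (S n))) with (- x * p ^ S n * p) by (simpl; ring). rring.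
    - evar_last.
      + apply (is_derive_mult u (fun x => 1 + x * p ^ S n) x0 (Derive u x0) (p ^ S n)).
        * now apply Derive_correct.
        * auto_derive; auto. simpl; ring.
        * intros; apply Rmult_comm.
      + unfold plus, mult; simpl. simpl in Hx0. rewrite Hx0. ring. }
  assert (D2 : is_derive (fun x => qpn (- x) p (2 * S n)) x0
    (sum_n (fun i => qbin p (2 * S n) i * p ^ tri i * (INR i * x0 ^ pred i)) (2 * S n))).
  { apply (is_derive_ext (fun x => sum_n (fun i => qbin p (2 * S n) i * p ^ tri i * x ^ i) (2 * S n))).
    - intros x. now rewrite <- q_binomial.
    - apply (is_derive_sum_n (fun i x => qbin p (2 * S n) i * p ^ tri i * x ^ i)).
      intros i _. generalize (qbin p (2 * S n) i * p ^ tri i). intros c. auto_derive; auto. ring. }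
  apply is_derive_unique in D1. apply is_derive_unique in D2. rewrite D1 in D2.
  (* The sum itself vanishes at [x0], so the weight [i] produced by differentiation can be replaced
     with [i - S n]. *)
  assert (Hsum : sum_n (fun i => qbin p (2 * S n) i * p ^ tri i * x0 ^ i) (2 * S n) = 0).
  { rewrite <- q_binomial. replace (2 * S n)%nat with (S n + S n)%nat by lia.
    rewrite qpn_add, (qpn_head (- x0 * p ^ S n)).
    replace (- x0 * p ^ S n) with 1 by lra. rring. }
  pose (k := (-1) ^ S n / p ^ tri (S (S n))).
  assert (Hk : k <> 0).
  { unfold k, Rdiv. apply Rmult_integral_contrapositive_currified; [apply pow_nonzero; lra|now apply Rinv_neq_0_compat]. }
  apply Rmult_eq_reg_l with k; auto.
  rewrite <- sum_n_scal.
  transitivity (x0 * (u x0 * p ^ S n)).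
  - rewrite D2, <- sum_n_scal.
    transitivity (sum_n (fun i => x0 * (qbin p (2 * S n) i * p ^ tri i * (INR i * x0 ^ pred i))
       + - INR (S n) * (qbin p (2 * S n) i * p ^ tri i * x0 ^ i)) (2 * S n)).
    2:{ rewrite sum_n_add, (sum_n_scal (- INR (S n))), Hsum. ring. }
    apply sum_n_ext. intros i.
    match goal with |- @eq _ ?a ?b => change (@eq R a b) end.
    pose proof (jterm_nat (-1) p i (S n) ltac:(lra) ltac:(lra)) as Hj. fold x0 k in Hj.
    transitivity (qbin p (2 * S n) i * IZR (Z.of_nat i - Z.of_nat (S n)) * (k * jterm (-1) p (Z.of_nat i - Z.of_nat (S n)))); [ring|].
    rewrite <- Hj, minus_IZR, <- !INR_IZR_INZ. destruct i; simpl pred; [simpl; ring|].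
    simpl (x0 ^ S i). ring.
  - unfold u. rewrite Rmult_1_r.
    replace (- x0) with (- (-1 / p ^ S n)) by reflexivity.
    rewrite qpn_reverse by lra. fold k.
    replace (- (p / -1)) with p by field.
    replace (- (x0 * p ^ S (S n))) with p.
    2:{ change (p ^ S (S n)) with (p * p ^ S n). replace (- (x0 * (p * p ^ S n))) with (- (p * (x0 * p ^ S n))) by ring.
        rewrite Hx0. ring. }
    transitivity (k * qpn p p (S n) * qpn p p n * (x0 * p ^ S n)); [ring|]. rewrite Hx0. ring.
Qed.

Lemma powerRZ_m1 j : powerRZ (-1) j = sg j.
Proof.
  unfold sg. destruct (Z.even j) eqn:He.
  - apply Z.even_spec in He. destruct He as [k ->].
    replace (2 * k)%Z with (k + k)%Z by lia.
    rewrite powerRZ_add, <- powerRZ_mult by lra.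
    replace (-1 * -1) with 1 by ring. apply powerRZ_R1.
  - assert (Ho : Z.odd j = true) by (rewrite <- Z.negb_even, He; reflexivity).
    apply Z.odd_spec in Ho. destruct Ho as [k ->].
    replace (2 * k + 1)%Z with (k + k + 1)%Z by lia.
    rewrite !powerRZ_add, <- powerRZ_mult by lra.
    replace (-1 * -1) with 1 by ring. rewrite powerRZ_R1. simpl. ring.
Qed.

Lemma jterm_m1 p j : jterm (-1) p j = sg j * Rpower p (1/2 * IZR j ^ 2 + - (1/2) * IZR j).
Proof. unfold jterm. now rewrite powerRZ_m1. Qed.

Lemma IZR_bound j : Rabs (IZR j) <= 1 + IZR j ^ 2.
Proof.
  pose proof (pow2_ge_0 (IZR j - 1)). pose proof (pow2_ge_0 (IZR j + 1)).
  apply Rabs_le. nra.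
Qed.

Lemma jacobi_cube p : 0 < p < 1 -> zsum (fun j => IZR j * jterm (-1) p j) = - qp p p ^ 3.
Proof.
  intros Hp. pose proof (qp_pos p p Hp Hp) as H0.
  assert (H := jacobi_sum_lim IZR (-1) p ltac:(lra) Hp).
  specialize (H IZR_bound). apply is_lim_seq_incr_1 in H.
  apply (is_lim_seq_ext _ (fun n => - (qpn p p (S n) * qpn p p n))) in H.
  2:{ intros n. now apply finite_jacobi_derive. }
  assert (H1 := is_lim_qpn p p Hp Hp). assert (H2 := H1). apply is_lim_seq_incr_1 in H2.
  assert (H3 := is_lim_seq_mult' _ _ _ _ H2 H1). apply is_lim_seq_opp in H3.
  apply is_lim_seq_unique in H. apply is_lim_seq_unique in H3. rewrite H in H3.
  apply (f_equal real) in H3. simpl real in H3.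
  transitivity (zsum (fun j => IZR j * jterm (-1) p j) / qp p p * qp p p); [field; lra|].
  rewrite H3. ring.
Qed.

(** * Euler products *)

Fixpoint prodn (f : nat -> R) (d : nat) : R :=
  match d with O => 1 | S d' => prodn f d' * f d' end.

Lemma prodn_mul f g d : prodn (fun r => f r * g r) d = prodn f d * prodn g d.
Proof. induction d; simpl; [ring|rewrite IHd; ring]. Qed.

Lemma qpn_prodn c p d : qpn c p d = prodn (fun r => 1 - c * p ^ r) d.
Proof. induction d; simpl; [reflexivity|now rewrite IHd]. Qed.

Lemma prodn_ext f g d : (forall r, f r = g r) -> prodn f d = prodn g d.
Proof. intros H. induction d; simpl; [reflexivity|now rewrite IHd, H]. Qed.

Lemma prodn_1 d : prodn (fun _ => 1) d = 1.
Proof. induction d; simpl; [reflexivity|rewrite IHd; ring]. Qed.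

(** The [n * d] factors are grouped by the residue of their exponent modulo [d]. *)
Lemma qpn_dissect c p d n :
  qpn c p (n * d) = prodn (fun r => qpn (c * p ^ r) (p ^ d) n) d.
Proof.
  induction n; simpl qpn.
  - now rewrite prodn_1.
  - replace (d + n * d)%nat with (n * d + d)%nat by lia.
    rewrite qpn_add, IHn, prodn_mul. f_equal. rewrite qpn_prodn. apply prodn_ext. intros r.
    rewrite <- pow_mult, (Nat.mul_comm d n). ring.
Qed.

Lemma is_lim_prodn (f : nat -> nat -> R) (l : nat -> R) d :
  (forall r, is_lim_seq (fun n => f n r) (l r)) ->
  is_lim_seq (fun n => prodn (f n) d) (prodn l d).
Proof.
  intros H. induction d; simpl; [apply is_lim_seq_const|].
  now apply is_lim_seq_mult'.
Qed.

Lemma qp_dissect c p d : 0 < c < 1 -> 0 < p < 1 -> (0 < d)%nat ->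
  qp c p = prodn (fun r => qp (c * p ^ r) (p ^ d)) d.
Proof.
  intros Hc Hp Hd.
  assert (H1 : is_lim_seq (fun n => qpn c p (n * d)) (qp c p)).
  { apply (is_lim_seq_subseq (qpn c p)); [|now apply is_lim_qpn].
    apply eventually_subseq. intros n. nia. }
  assert (H2 : is_lim_seq (fun n => prodn (fun r => qpn (c * p ^ r) (p ^ d) n) d)
    (prodn (fun r => qp (c * p ^ r) (p ^ d)) d)).
  { apply is_lim_prodn. intros r.
    assert (Hr : forall k, 0 < p ^ k <= 1).
    { intros k. split; [apply pow_lt; lra|]. rewrite <- (pow1 k). apply pow_incr. lra. }
    apply is_lim_qpn.
    - specialize (Hr r). nra.
    - destruct d as [|d]; [lia|]. specialize (Hr d). simpl. nra. }
  apply (is_lim_seq_ext _ (fun n => qpn c p (n * d))) in H2; [|intros n; now rewrite qpn_dissect].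
  apply is_lim_seq_unique in H1. apply is_lim_seq_unique in H2. rewrite H1 in H2.
  now apply (f_equal real) in H2.
Qed.

Lemma Epart_qpn q n : Epart q n = qpn q q n.
Proof. induction n; simpl; [reflexivity|now rewrite IHn]. Qed.

Lemma E_qp q : E q = qp q q.
Proof.
  unfold E, qp. f_equal. apply Lim_seq_ext. intros n. apply Epart_qpn.
Qed.

Section Products.
Variable q : R.
Hypothesis Hq : 0 < q < 1.

Lemma pow_in01 k : (0 < k)%nat -> 0 < q ^ k < 1.
Proof.
  intros Hk. split; [apply pow_lt; lra|]. apply pow_lt_1_compat; [lra|auto].
Qed.

Lemma theta_product A B a b : INR a = A + B -> INR b = A - B -> (0 < a)%nat -> (0 < b)%nat ->
  theta q A B = qp (q ^ a) (q ^ (a + b)) * qp (q ^ b) (q ^ (a + b)) * qp (q ^ (a + b)) (q ^ (a + b)).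
Proof.
  intros Ha Hb Ha0 Hb0.
  assert (Hqa := pow_in01 a Ha0). assert (Hqb := pow_in01 b Hb0).
  replace (q ^ b) with (q ^ (a + b) / q ^ a) by (rewrite pow_add; field; lra).
  assert (Hqab : 0 < q ^ (a + b) < q ^ a).
  { rewrite pow_add. split; [apply Rmult_lt_0_compat; lra|].
    rewrite <- (Rmult_1_r (q ^ a)) at 2. apply Rmult_lt_compat_l; lra. }
  rewrite <- triple_product by lra.
  apply zsum_ext. intros n. unfold jterm.
  replace (- q ^ a) with (-1 * q ^ a) by ring.
  rewrite powerRZ_mult, powerRZ_m1, powerRZ_Rpower, Rmult_assoc by lra.
  f_equal. rewrite <- (Rpower_pow a), <- (Rpower_pow (a + b)), !Rpower_mult, <- Rpower_plus by tauto. f_equal.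
  rewrite plus_INR, Ha, Hb. field.
Qed.

(** The shift [j = n + 1] aligns the exponents with those of [jacobi_cube]. Since
    [2 n + 1 = 2 (n + 1) - 1], what is left is a constant weight, whose sum vanishes by
    antisymmetry. *)
Lemma jacobi_E : jacobi q (1/2) = 2 * E q ^ 3.
Proof.
  pose (e := fun n => sg n * Rpower q (1/2 * IZR n ^ 2 + 1/2 * IZR n)).
  assert (He : zdom e).
  { apply zrap_zdom. apply (zrap_gauss q (1/2) (1/2) sg 1 Hq ltac:(lra) sg_bound). }
  assert (Hf : zdom (fun n => sg n * (2 * IZR n + 1) * Rpower q (1/2 * IZR n ^ 2 + 1/2 * IZR n))).
  { apply zrap_zdom. apply (zrap_gauss q (1/2) (1/2) _ 3 Hq ltac:(lra) sg_lin_bound). }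
  assert (Se : zsum e = 0).
  { apply zsum_odd; auto. intros n. unfold e. rewrite sg_refl1, minus_IZR.
    replace (1 / 2 * (-1 - IZR n) ^ 2 + 1 / 2 * (-1 - IZR n)) with
      (1/2 * IZR n ^ 2 + 1/2 * IZR n) by ring. ring. }
  pose proof (jacobi_cube q Hq) as H. rewrite <- E_qp in H.
  rewrite <- (zsum_shift 1) in H.
  2: now apply zdom_jterm; [lra| |apply IZR_bound].
  unfold jacobi.
  rewrite (zsum_ext _ (fun n => -2 * (IZR (n + 1) * jterm (-1) q (n + 1)) + -1 * e n)).
  - rewrite zsum_plus, !zsum_scal, H, Se; [ring| |now apply zdom_scal].
    apply (zdom_ext (fun n => sg n * (2 * IZR n + 1) * Rpower q (1/2 * IZR n ^ 2 + 1/2 * IZR n) + e n)).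
    + intros n. rewrite jterm_m1, sg_add, plus_IZR. change (sg 1) with (-1). unfold e.
      replace (1 / 2 * (IZR n + 1) ^ 2 + - (1 / 2) * (IZR n + 1)) with
      (1/2 * IZR n ^ 2 + 1/2 * IZR n) by field. ring.
    + now apply zdom_plus.
  - intros n. rewrite jterm_m1, sg_add, plus_IZR. change (sg 1) with (-1). unfold e.
      replace (1 / 2 * (IZR n + 1) ^ 2 + - (1 / 2) * (IZR n + 1)) with
      (1/2 * IZR n ^ 2 + 1/2 * IZR n) by field. ring.
Qed.

(** Gauss's product for [psi(q)], doubled because the sum runs over all of [Z]: it is the triple
    product at [y = p = q], where the factor [1 + p / y] equals 2. *)
Lemma psi_product : utheta q (1/2) (1/2) = 2 * E (q ^ 2) ^ 2 / E q.
Proof.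
  assert (Hq2 := pow_in01 2 ltac:(lia)).
  assert (H0 := qp_pos q q Hq Hq).
  (* Euler's device [1 + q^k = (1 - q^(2 k)) / (1 - q^k)]. *)
  assert (Hn : forall n, qpn (- q) q n = qpn (q ^ 2) (q ^ 2) n / qpn q q n).
  { intros n. assert (Hqn := fun n => qpn_pos q q n Hq Hq). induction n; cbn [qpn]; [field|].
    rewrite IHn. specialize (Hqn (S n)) as H. simpl in H. specialize (Hqn n).
    assert (q * q ^ n <> 1) by (intros E1; rewrite E1 in H; lra).
    rewrite <- (pow_mult q 2 n), (Nat.mul_comm 2 n), pow_mult.
    field. lra. }
  assert (Hl : is_lim_seq (fun n => qpn (- q) q n) (E (q ^ 2) / E q)).
  { apply (is_lim_seq_ext (fun n => qpn (q ^ 2) (q ^ 2) n / qpn q q n)); [intros n; now rewrite Hn|].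
    rewrite !E_qp. apply is_lim_seq_div'; [now apply is_lim_qpn|now apply is_lim_qpn|lra]. }
  assert (H1 := triple_product_lim q q ltac:(lra) Hq).
  replace (- (q / q)) with (-1) in H1 by (field; lra).
  apply is_lim_seq_incr_1 in H1.
  apply (is_lim_seq_ext _ (fun n => qpn (- q) q (S n) * (2 * qpn (- q) q n))) in H1.
  2:{ intros n. rewrite (qpn_head (-1)). f_equal. f_equal; [ring|f_equal; ring]. }
  assert (Hl' := Hl). apply is_lim_seq_incr_1 in Hl'.
  assert (H2 := is_lim_seq_mult' _ _ _ _ Hl' (is_lim_seq_mult' _ _ _ _ (is_lim_seq_const 2) Hl)).
  apply is_lim_seq_unique in H1. apply is_lim_seq_unique in H2. rewrite H1 in H2.
  apply (f_equal real) in H2. simpl real in H2. rewrite <- E_qp in *.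
  transitivity (zsum (jterm q q)).
  - apply zsum_ext. intros n. unfold jterm. rewrite powerRZ_Rpower, <- Rpower_plus by lra.
    f_equal. field.
  - transitivity (zsum (jterm q q) / E q * E q); [field; lra|]. rewrite H2. change (q * (q * 1)) with (q ^ 2). field. lra.
Qed.

(** All the level 10 products are monomials in these ten infinite products, which turns identities
    between eta quotients into polynomial ones. *)
Notation c j := (qp (q ^ j) (q ^ 10)).

Ltac dissect d :=
  rewrite (qp_dissect _ _ d) by (auto using pow_in01; try lia; apply pow_in01; lia);
  cbn [prodn]; rewrite ?pow_O, ?Rmult_1_r, <- ?pow_mult, <- ?pow_add.

Lemma c_pos j : (0 < j)%nat -> 0 < c j.
Proof. intros Hj. apply qp_pos; apply pow_in01; lia. Qed.

Lemma E10_c : E (q ^ 10) = c 10.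
Proof. apply E_qp. Qed.

Lemma E5_c : E (q ^ 5) = c 5 * c 10.
Proof. rewrite E_qp. dissect 2%nat. simpl Nat.add. simpl Nat.mul. ring. Qed.

Lemma E2_c : E (q ^ 2) = c 2 * c 4 * c 6 * c 8 * c 10.
Proof. rewrite E_qp. dissect 5%nat. simpl Nat.add. simpl Nat.mul. ring. Qed.

Lemma E1_c : E q = c 1 * c 2 * c 3 * c 4 * c 5 * c 6 * c 7 * c 8 * c 9 * c 10.
Proof.
  rewrite E_qp. rewrite <- (pow_1 q) at 1 2. dissect 10%nat. simpl Nat.add. simpl Nat.mul. ring.
Qed.

Lemma theta5_c B a b : INR a = 5 + B -> INR b = 5 - B -> (0 < a)%nat -> (0 < b)%nat ->
  theta q 5 B = c a * c b * c 10.
Proof.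
  intros Ha Hb Ha0 Hb0. rewrite (theta_product _ _ a b) by auto.
  replace (a + b)%nat with 10%nat; [reflexivity|].
  apply INR_eq. rewrite plus_INR, Ha, Hb. simpl. ring.
Qed.

Lemma theta1_c : theta q 1 0 = (c 1 * c 3 * c 5 * c 7 * c 9) ^ 2 * E (q ^ 2).
Proof.
  rewrite (theta_product _ _ 1 1), E_qp by (simpl; lra || lia).
  replace (qp (q ^ 1) (q ^ (1 + 1))) with (c 1 * c 3 * c 5 * c 7 * c 9); [simpl; ring|].
  simpl (1 + 1)%nat. symmetry. dissect 5%nat. simpl Nat.add. simpl Nat.mul. ring.
Qed.

Lemma theta_rr1 : theta q (5/2) (3/2) = c 4 * c 9 * c 1 * c 6 * E (q ^ 5).
Proof.
  rewrite (theta_product _ _ 4 1), E_qp by (simpl; lra || lia).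
  simpl (4 + 1)%nat.
  replace (qp (q ^ 4) (q ^ 5)) with (c 4 * c 9).
  2:{ symmetry. dissect 2%nat. simpl Nat.add. simpl Nat.mul. ring. }
  replace (qp (q ^ 1) (q ^ 5)) with (c 1 * c 6); [ring|].
  symmetry. dissect 2%nat. simpl Nat.add. simpl Nat.mul. ring.
Qed.

Lemma theta_rr2 : theta q (5/2) (1/2) = c 3 * c 8 * c 2 * c 7 * E (q ^ 5).
Proof.
  rewrite (theta_product _ _ 3 2), E_qp by (simpl; lra || lia).
  simpl (3 + 2)%nat.
  replace (qp (q ^ 3) (q ^ 5)) with (c 3 * c 8).
  2:{ symmetry. dissect 2%nat. simpl Nat.add. simpl Nat.mul. ring. }
  replace (qp (q ^ 2) (q ^ 5)) with (c 2 * c 7); [ring|].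
  symmetry. dissect 2%nat. simpl Nat.add. simpl Nat.mul. ring.
Qed.

(** Euler's pentagonal number theorem, from the dissection of [E] modulo 3. *)
Lemma theta_pentagonal : theta q (3/2) (1/2) = E q.
Proof.
  rewrite (theta_product _ _ 2 1), E_qp by (simpl; lra || lia).
  simpl (2 + 1)%nat. rewrite <- (pow_1 q) at 7 8. symmetry. dissect 3%nat.
  simpl Nat.add. simpl Nat.mul. ring.
Qed.
End Products.

(** * The Rogers-Ramanujan series and their Wronskian *)

(* Natural exponents, unlike [Rpower], give the right value and derivative at [q = 0]. *)
Definition lacunary (e : Z -> nat) (q : R) : R := zsum (fun n => sg n * q ^ e n).

Definition lacunary' (e : Z -> nat) (q : R) : R :=
  zsum (fun n => sg n * (INR (e n) * q ^ pred (e n))).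

(** The factor [r ^ 2] on the left replaces the exponent [m - 2] of the usual Taylor remainder and
    so avoids truncated subtraction in the induction. *)
Lemma pow_taylor2 x y r m : Rabs x <= r -> Rabs y <= r ->
  r ^ 2 * Rabs (y ^ m - x ^ m - INR m * x ^ pred m * (y - x)) <= INR m ^ 2 * r ^ m * (y - x) ^ 2.
Proof.
  intros Hx Hy. assert (Hr : 0 <= r) by (pose proof (Rabs_pos x); lra).
  induction m as [|m IH].
  - simpl. replace (1 - 1 - 0 * 1 * (y - x)) with 0 by ring. rewrite Rabs_R0. lra.
  - simpl pred.
    replace (y ^ S m - x ^ S m - INR (S m) * x ^ m * (y - x)) with
      (y * (y ^ m - x ^ m - INR m * x ^ pred m * (y - x)) + INR m * x ^ pred m * (y - x) ^ 2).
    2:{ rewrite S_INR. destruct m; [simpl; ring|]. simpl pred. cbn [pow]. ring. }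
    assert (Hm := pos_INR m).
    assert (Hxm : r * (INR m * Rabs x ^ pred m) <= INR m * r ^ m).
    { destruct m; [simpl; lra|]. simpl pred. change (r ^ S m) with (r * r ^ m).
      assert (Rabs x ^ m <= r ^ m) by (apply pow_incr; split; [apply Rabs_pos|auto]).
      assert (0 <= r * INR (S m)) by (apply Rmult_le_pos; auto). nra. }
    set (D := y ^ m - x ^ m - INR m * x ^ pred m * (y - x)) in *.
    assert (Hd : 0 <= (y - x) ^ 2) by apply pow2_ge_0.
    apply Rle_trans with (r * (r ^ 2 * Rabs D) + r * (r * (INR m * Rabs x ^ pred m)) * (y - x) ^ 2).
    + apply Rle_trans with (r ^ 2 * (Rabs (y * D) + Rabs (INR m * x ^ pred m * (y - x) ^ 2))).
      * apply Rmult_le_compat_l; [apply pow2_ge_0|]. apply Rabs_triang.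
      * rewrite !Rabs_mult, <- RPow_abs, (Rabs_pos_eq (INR m)), (Rabs_pos_eq ((y - x) ^ 2)) by auto.
        assert (Rabs y * Rabs D <= r * Rabs D) by (apply Rmult_le_compat_r; [apply Rabs_pos|auto]).
        assert (r ^ 2 * (Rabs y * Rabs D) <= r ^ 2 * (r * Rabs D))
          by (apply Rmult_le_compat_l; [apply pow2_ge_0|auto]).
        lra.
    + assert (Hp : 0 <= r ^ m) by now apply pow_le.
      assert (r * (r ^ 2 * Rabs D) <= r * (INR m ^ 2 * r ^ m * (y - x) ^ 2))
        by now apply Rmult_le_compat_l.
      assert (r * (r * (INR m * Rabs x ^ pred m)) * (y - x) ^ 2 <= r * (INR m * r ^ m) * (y - x) ^ 2).
      { apply Rmult_le_compat_r; auto. now apply Rmult_le_compat_l. }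
      rewrite S_INR. change (r ^ S m) with (r * r ^ m).
      assert (0 <= r * r ^ m * (y - x) ^ 2) by (apply Rmult_le_pos; [apply Rmult_le_pos; auto|auto]).
      assert (0 <= INR m * (r * r ^ m * (y - x) ^ 2)) by now apply Rmult_le_pos.
      lra.
Qed.

(** [r^m] is the fourth power of a quantity of size at most [1 / (m0 (1 + m))]: two of these factors
    pay for the weight [(1 + m)^2], the other two for [zw n]. *)
Lemma pow_decay r : 0 < r < 1 -> exists C, 0 <= C /\ forall (n : Z) (m : nat),
  (Z.abs n <= Z.of_nat m)%Z -> (1 + INR m) ^ 2 * r ^ m <= C * zw n.
Proof.
  intros Hr.
  assert (HL : ln r < 0) by (rewrite <- ln_1; apply ln_increasing; lra).
  set (L := - ln r). assert (HL0 : 0 < L) by (unfold L; lra).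
  set (m0 := Rmin 1 (L / 4)).
  assert (H0 : 0 < m0) by (unfold m0; apply Rmin_pos; lra).
  exists (/ m0 ^ 4). split; [left; apply Rinv_0_lt_compat; now apply pow_lt|].
  intros n m Hn. assert (Hm := pos_INR m).
  assert (H1 : r ^ m <= (/ (m0 * (1 + INR m))) ^ 4).
  { rewrite <- Rpower_pow by lra. unfold Rpower.
    replace (INR m * ln r) with (- (L * INR m / 4) + - (L * INR m / 4) +
      (- (L * INR m / 4) + - (L * INR m / 4))) by (unfold L; field).
    rewrite !exp_plus.
    assert (H : 0 <= exp (- (L * INR m / 4)) <= / (m0 * (1 + INR m))).
    { split; [left; apply exp_pos|]. rewrite exp_Ropp.
      apply Rinv_le_contravar; [apply Rmult_lt_0_compat; lra|].
      eapply Rle_trans; [|apply exp_ineq1_le].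
      assert (m0 <= 1) by apply Rmin_l. assert (m0 <= L / 4) by apply Rmin_r.
      assert (m0 * INR m <= L / 4 * INR m) by (apply Rmult_le_compat_r; lra). lra. }
    apply (pow_incr _ _ 4) in H. simpl in *. lra. }
  assert (H2 : 1 + IZR n ^ 2 <= (1 + INR m) ^ 2).
  { apply IZR_le in Hn. rewrite abs_IZR, <- INR_IZR_INZ in Hn.
    rewrite <- (pow2_abs (IZR n)). pose proof (Rabs_pos (IZR n)). nra. }
  unfold zw. pose proof (pow2_ge_0 (IZR n)).
  apply Rle_trans with ((1 + INR m) ^ 2 * (/ (m0 * (1 + INR m))) ^ 4).
  { apply Rmult_le_compat_l; auto. apply pow2_ge_0. }
  apply Rle_trans with (/ m0 ^ 4 * / (1 + INR m) ^ 2); [right; field; lra|].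
  apply Rmult_le_compat_l; [left; apply Rinv_0_lt_compat; now apply pow_lt|].
  apply Rinv_le_contravar; lra.
Qed.

Section Lacunary.
Variable e : Z -> nat.
Hypothesis He : forall n, (Z.abs n <= Z.of_nat (e n))%Z.

Lemma zdom_lacunary x : Rabs x < 1 -> zdom (fun n => sg n * x ^ e n).
Proof.
  intros Hx. set (r := (1 + Rabs x) / 2). pose proof (Rabs_pos x).
  destruct (pow_decay r ltac:(unfold r; lra)) as [C [HC0 HC]].
  exists C. intros n. rewrite Rabs_mult, sg_abs, Rmult_1_l, <- RPow_abs.
  eapply Rle_trans; [|apply (HC n (e n)), He].
  assert (Rabs x ^ e n <= r ^ e n) by (apply pow_incr; unfold r; lra).
  assert (0 <= r ^ e n) by (apply pow_le; unfold r; lra).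
  assert (Hm := pos_INR (e n)). nra.
Qed.

Lemma zdom_lacunary' x : Rabs x < 1 -> zdom (fun n => sg n * (INR (e n) * x ^ pred (e n))).
Proof.
  intros Hx. set (r := (1 + Rabs x) / 2). pose proof (Rabs_pos x).
  destruct (pow_decay r ltac:(unfold r; lra)) as [C [HC0 HC]].
  exists (2 * C). intros n. rewrite Rabs_mult, sg_abs, Rmult_1_l, Rabs_mult, <- RPow_abs.
  assert (Hm := pos_INR (e n)). rewrite (Rabs_pos_eq (INR _)) by auto.
  specialize (HC n (e n) (He n)).
  apply Rle_trans with (2 * ((1 + INR (e n)) ^ 2 * r ^ e n)); [|lra].
  destruct (e n) as [|k]; simpl pred.
  - simpl. nra.
  - assert (Hk : Rabs x ^ k <= r ^ k) by (apply pow_incr; unfold r; lra).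
    assert (0 <= Rabs x ^ k) by (apply pow_le; auto).
    change (r ^ S k) with (r * r ^ k). assert (1 <= 2 * r) by (unfold r; lra).
    assert (r ^ k <= 2 * r * r ^ k) by nra.
    apply Rle_trans with (INR (S k) * (2 * r * r ^ k)); [apply Rmult_le_compat_l; lra|].
    assert (0 <= 2 * r * r ^ k) by lra.
    replace (2 * ((1 + INR (S k)) ^ 2 * (r * r ^ k))) with ((1 + INR (S k)) ^ 2 * (2 * r * r ^ k)) by ring.
    apply Rmult_le_compat_r; auto. nra.
Qed.

(** With [r] halfway between [|x|] and 1, the Taylor remainder of the term of index [n] is at most
    [C / r^2 * (y - x)^2 * zw n]; summed over [n], the error is quadratic in [y - x]. *)
Lemma is_derive_lacunary x : Rabs x < 1 -> is_derive (lacunary e) x (lacunary' e x).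
Proof.
  intros Hx. set (r := (1 + Rabs x) / 2). pose proof (Rabs_pos x) as Hx0.
  assert (Hr : 0 < r < 1) by (unfold r; lra).
  destruct (pow_decay r Hr) as [C [HC0 HC]].
  pose (K := C / r ^ 2 * zsum zw).
  assert (HK : forall y, Rabs y <= r ->
    Rabs (lacunary e y - lacunary e x - lacunary' e x * (y - x)) <= K * (y - x) ^ 2).
  { intros y Hy.
    assert (Hd := zdom_lacunary y ltac:(lra)). assert (Hd0 := zdom_lacunary x Hx).
    assert (Hd1 := zdom_lacunary' x Hx).
    replace (lacunary e y - lacunary e x - lacunary' e x * (y - x)) with
      (zsum (fun n => sg n * (y ^ e n - x ^ e n - INR (e n) * x ^ pred (e n) * (y - x)))).
    2:{ unfold lacunary, lacunary'.
        rewrite (zsum_ext _ (fun n => sg n * y ^ e n + (-1 * (sg n * x ^ e n) +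
          - (y - x) * (sg n * (INR (e n) * x ^ pred (e n)))))) by (intros; ring).
        rewrite !zsum_plus, !zsum_scal by (auto using zdom_plus, zdom_scal). ring. }
    assert (Hb : forall n, Rabs (sg n * (y ^ e n - x ^ e n - INR (e n) * x ^ pred (e n) * (y - x)))
      <= C / r ^ 2 * (y - x) ^ 2 * zw n).
    { intros n. rewrite Rabs_mult, sg_abs, Rmult_1_l.
      pose proof (pow_taylor2 x y r (e n) ltac:(unfold r; lra) Hy) as HT.
      specialize (HC n (e n) (He n)). pose proof (pos_INR (e n)) as Hm.
      assert (0 <= r ^ e n) by (apply pow_le; lra).
      assert (Hy2 : 0 <= (y - x) ^ 2) by apply pow2_ge_0.
      assert (INR (e n) ^ 2 * r ^ e n <= C * zw n) by nra.
      assert (INR (e n) ^ 2 * r ^ e n * (y - x) ^ 2 <= C * zw n * (y - x) ^ 2)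
        by now apply Rmult_le_compat_r.
      assert (0 < r ^ 2) by (apply pow_lt; lra).
      apply Rmult_le_reg_l with (r ^ 2); auto.
      replace (r ^ 2 * (C / r ^ 2 * (y - x) ^ 2 * zw n)) with (C * zw n * (y - x) ^ 2) by (field; lra).
      lra. }
    eapply Rle_trans; [apply zsum_Rabs; apply (zdom_le _ _ Hb), zdom_zw|].
    eapply Rle_trans; [apply (zsum_le _ (fun n => C / r ^ 2 * (y - x) ^ 2 * zw n)); [|apply zdom_zw]|].
    - intros n. split; [apply Rabs_pos|apply Hb].
    - rewrite (zsum_scal _ zw). unfold K. right. ring. }
  apply is_derive_Reals. intros eps Heps.
  assert (HK0 : 0 <= K).
  { specialize (HK r ltac:(rewrite Rabs_pos_eq; lra)).
    assert (0 < (r - x) ^ 2).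
    { apply pow_lt. unfold r. pose proof (Rle_abs x). lra. }
    pose proof (Rabs_pos (lacunary e r - lacunary e x - lacunary' e x * (r - x))). nra. }
  assert (Hdel : 0 < Rmin ((1 - Rabs x) / 2) (eps / (K + 1))).
  { apply Rmin_pos; [lra|]. apply Rdiv_lt_0_compat; lra. }
  exists (mkposreal _ Hdel). intros h Hh Hhd. simpl in Hhd.
  assert (H1 := Rlt_le_trans _ _ _ Hhd (Rmin_l _ _)).
  assert (H2 := Rlt_le_trans _ _ _ Hhd (Rmin_r _ _)).
  specialize (HK (x + h)). replace (x + h - x) with h in HK by ring.
  specialize (HK ltac:(unfold r; pose proof (Rabs_triang x h); lra)).
  assert (Hha : 0 < Rabs h) by now apply Rabs_pos_lt.
  replace ((lacunary e (x + h) - lacunary e x) / h - lacunary' e x) with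
    ((lacunary e (x + h) - lacunary e x - lacunary' e x * h) / h) by (field; auto).
  unfold Rdiv. rewrite Rabs_mult, Rabs_inv.
  apply Rmult_lt_reg_r with (Rabs h); auto. rewrite Rmult_assoc, Rinv_l, Rmult_1_r by lra.
  eapply Rle_lt_trans; [apply HK|]. rewrite <- (pow2_abs h).
  assert (H3 : Rabs h * (K + 1) < eps).
  { apply Rmult_lt_reg_r with (/ (K + 1)); [apply Rinv_0_lt_compat; lra|].
    rewrite Rmult_assoc, Rinv_r, Rmult_1_r by lra. exact H2. }
  nra.
Qed.

(** Only the term of index 0 survives, through [0 ^ 0 = 1]; the bound on [e] makes all other
    exponents positive. *)
Lemma lacunary_0 : e 0%Z = O -> lacunary e 0 = 1.
Proof.
  intros H0. unfold lacunary. rewrite (zsum_finite _ 0).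
  - simpl (2 * 0)%nat. rewrite sum_O. simpl Z.sub. rewrite H0. simpl. unfold sg. simpl. ring.
  - intros j Hj. rewrite pow_i; [ring|]. specialize (He j). lia.
Qed.

Variables a b : R.
Hypothesis Hab : forall n, INR (e n) = a * IZR n ^ 2 + b * IZR n.

Lemma lacunary_theta q : 0 < q < 1 -> lacunary e q = theta q a b.
Proof.
  intros Hq. apply zsum_ext. intros n. rewrite <- Hab, Rpower_pow by lra. reflexivity.
Qed.

Lemma lacunary'_theta q : 0 < q < 1 -> q * lacunary' e q =
  zsum (fun n => sg n * (a * IZR n ^ 2 + b * IZR n) * Rpower q (a * IZR n ^ 2 + b * IZR n)).
Proof.
  intros Hq. unfold lacunary'. rewrite <- zsum_scal. apply zsum_ext. intros n.
  rewrite <- Hab, Rpower_pow by lra. destruct (e n); [simpl; ring|]. simpl pred. cbn [pow]. ring.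
Qed.
End Lacunary.

(** Exponents of pentagonal type. The division is exact when [a + b] is even, and the quotient is
    nonnegative when [|b| < a]. *)
Definition ehalf (a b n : Z) : nat := Z.to_nat (n * (a * n + b) / 2).


Lemma ehalf_spec a b n : Z.even (a + b) = true -> (Z.abs b < a)%Z ->
  (2 * Z.of_nat (ehalf a b n) = n * (a * n + b))%Z.
Proof.
  intros Hp Hb. unfold ehalf.
  assert (H : exists k, (n * (a * n + b) = 2 * k)%Z).
  { apply Z.even_spec. rewrite Z.even_mul, Z.even_add, Z.even_mul.
    rewrite Z.even_add in Hp. destruct (Z.even n), (Z.even a), (Z.even b); auto. }
  destruct H as [k Hk]. rewrite Hk, (Z.mul_comm 2 k), Z.div_mul by lia.
  assert (0 <= k)%Z; [|lia].
  assert (0 <= n * (a * n + b))%Z; [|lia].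
  destruct (Z.eq_dec n 0) as [->|]; [lia|].
  assert (n <= -1 \/ 1 <= n)%Z as [|] by lia; nia.
Qed.

Lemma ehalf_INR a b n : Z.even (a + b) = true -> (Z.abs b < a)%Z ->
  INR (ehalf a b n) = IZR a / 2 * IZR n ^ 2 + IZR b / 2 * IZR n.
Proof.
  intros Hp Hb. pose proof (ehalf_spec a b n Hp Hb) as H. apply (f_equal IZR) in H.
  rewrite !mult_IZR, plus_IZR, mult_IZR, <- INR_IZR_INZ in H. lra.
Qed.

Lemma ehalf_ge a b n : Z.even (a + b) = true -> (Z.abs b + 2 <= a)%Z ->
  (Z.abs n <= Z.of_nat (ehalf a b n))%Z.
Proof.
  intros Hp Hb. pose proof (ehalf_spec a b n Hp ltac:(lia)) as H.
  destruct (Z.eq_dec n 0) as [->|]; [lia|].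
  assert (n <= -1 \/ 1 <= n)%Z as [|] by lia; nia.
Qed.

(* The Rogers-Ramanujan continued fraction is [q^(1/5) * rrP q / rrQ q]. *)
Definition rrP : R -> R := lacunary (ehalf 5 3).
Definition rrQ : R -> R := lacunary (ehalf 5 1).
Definition pentagonal : R -> R := lacunary (ehalf 3 1).

(** The left-hand side is [5 rrP rrQ] times the logarithmic derivative [q d/dq] of
    [q^(1/5) rrP / rrQ]. As a double sum it has weight 1 plus 5 times the difference of the two
    exponents, which is one eighth of the weight in [wronskian_sum]. *)
Lemma rr_wronskian q : 0 < q < 1 ->
  rrP q * rrQ q + 5 * q * (lacunary' (ehalf 5 3) q * rrQ q - rrP q * lacunary' (ehalf 5 1) q) = E q ^ 6.
Proof.
  intros Hq.
  pose proof (wronskian_sum q Hq) as H. rewrite jacobi_E in H by auto.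
  assert (H1 : forall n, INR (ehalf 5 3 n) = 5/2 * IZR n ^ 2 + 3/2 * IZR n) by (intros; now rewrite ehalf_INR).
  assert (H2 : forall n, INR (ehalf 5 1 n) = 5/2 * IZR n ^ 2 + 1/2 * IZR n) by (intros; now rewrite ehalf_INR).
  assert (D1 := lacunary'_theta _ _ _ H1 q Hq). assert (D2 := lacunary'_theta _ _ _ H2 q Hq).
  assert (T1 := lacunary_theta _ _ _ H1 q Hq). assert (T2 := lacunary_theta _ _ _ H2 q Hq).
  fold (rrP q) in T1. fold (rrQ q) in T2.
  transitivity (rrP q * rrQ q + 5 * ((q * lacunary' (ehalf 5 3) q) * rrQ q - rrP q * (q * lacunary' (ehalf 5 1) q))); [ring|].
  rewrite D1, D2, T1, T2. unfold theta.
  apply Rmult_eq_reg_l with 8; [|lra].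
  transitivity (2 * (2 * E q ^ 3) ^ 2); [|ring]. rewrite <- H.
  set (p := fun n => sg n * Rpower q (5/2 * IZR n ^ 2 + 3/2 * IZR n)).
  set (p' := fun n => sg n * (5/2 * IZR n ^ 2 + 3/2 * IZR n) * Rpower q (5/2 * IZR n ^ 2 + 3/2 * IZR n)).
  set (r := fun n => sg n * Rpower q (5/2 * IZR n ^ 2 + 1/2 * IZR n)).
  set (r' := fun n => sg n * (5/2 * IZR n ^ 2 + 1/2 * IZR n) * Rpower q (5/2 * IZR n ^ 2 + 1/2 * IZR n)).
  assert (Hp : zrap p) by (apply zrap_theta; auto; lra).
  assert (Hr : zrap r) by (apply zrap_theta; auto; lra).
  assert (Hp' : zrap p').
  { apply (zrap_gauss q (5/2) (3/2) _ 4 Hq ltac:(lra)). intros n. rewrite Rabs_mult, sg_abs, Rmult_1_l.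
    set (x := IZR n). pose proof (pow2_ge_0 x). pose proof (pow2_ge_0 (x - 1)). pose proof (pow2_ge_0 (x + 1)).
    apply Rabs_le. nra. }
  assert (Hr' : zrap r').
  { apply (zrap_gauss q (5/2) (1/2) _ 4 Hq ltac:(lra)). intros n. rewrite Rabs_mult, sg_abs, Rmult_1_l.
    set (x := IZR n). pose proof (pow2_ge_0 x). pose proof (pow2_ge_0 (x - 1)). pose proof (pow2_ge_0 (x + 1)).
    apply Rabs_le. nra. }
  transitivity (zsum2 (fun m n => 8 * (p m * r n) + (40 * (p' m * r n) + -40 * (p m * r' n)))).
  - rewrite !zsum2_plus, !zsum2_scal, !zsum2_prod; [ring|..];
    repeat (apply zdom2_plus || apply zdom2_scal || apply zdom2_prod); auto.
  - apply zsum2_ext. intros m n. unfold p, p', r, r'. field.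
Qed.

(** * The transformation of the theta series *)

(* [cbin m x] is the central binomial coefficient [C (2 m) (m + x)]. *)
Fixpoint cbin (m : nat) (x : Z) : R :=
  match m with
  | O => if Z.eq_dec x 0 then 1 else 0
  | S m' => cbin m' (x - 1)%Z + 2 * cbin m' x + cbin m' (x + 1)%Z
  end.

Lemma cbin_out m x : (Z.of_nat m < Z.abs x)%Z -> cbin m x = 0.
Proof.
  revert x. induction m; intros x Hx; cbn [cbin].
  - destruct Z.eq_dec; [lia|reflexivity].
  - rewrite !IHm by lia. ring.
Qed.

Lemma cbin_opp m x : cbin m (- x)%Z = cbin m x.
Proof.
  revert x. induction m; intros x; cbn [cbin].
  - destruct (Z.eq_dec x 0), (Z.eq_dec (- x) 0); try lia; reflexivity.
  - replace (- x - 1)%Z with (- (x + 1))%Z by lia.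
    replace (- x + 1)%Z with (- (x - 1))%Z by lia. rewrite !IHm. ring.
Qed.

Lemma cbin_ratio m r : (INR m + IZR r + 1) * cbin m (r + 1)%Z = (INR m - IZR r) * cbin m r.
Proof.
  revert r. induction m; intros r.
  - cbn [cbin]. destruct (Z.eq_dec (r + 1) 0) as [H|H], (Z.eq_dec r 0) as [H'|H']; try lia.
    + replace r with (-1)%Z by lia. simpl. ring.
    + subst. simpl. ring.
    + ring.
  - cbn [cbin]. rewrite S_INR.
    replace (r + 1 - 1)%Z with r by lia.
    pose proof (IHm r) as H1. pose proof (IHm (r + 1)%Z) as H2. pose proof (IHm (r - 1)%Z) as H3.
    replace (r - 1 + 1)%Z with r in H3 by lia.
    rewrite plus_IZR in H2. rewrite minus_IZR in H3. lra.
Qed.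

Lemma dirichlet_kernel phi h :
  sin (phi / 2) * sum_n (fun i => cos (IZR (Z.of_nat i - Z.of_nat h) * phi)) (2 * h) =
  sin ((INR h + / 2) * phi).
Proof.
  induction h.
  - rewrite sum_O. simpl. replace (0 * phi) with 0 by ring. rewrite cos_0.
    replace ((0 + / 2) * phi) with (phi / 2) by field. ring.
  - rewrite (sum_sym_S (fun k => cos (IZR k * phi))).
    rewrite opp_IZR, <- INR_IZR_INZ.
    replace (- INR (S h) * phi) with (- (INR (S h) * phi)) by ring. rewrite cos_neg.
    rewrite !Rmult_plus_distr_l, IHh, S_INR.
    replace ((INR h + / 2) * phi) with ((INR h + 1) * phi - phi / 2) by field.
    replace ((INR h + 1 + / 2) * phi) with ((INR h + 1) * phi + phi / 2) by field.
    rewrite sin_plus, sin_minus. ring.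
Qed.

Lemma zdom_cbin m l x : (0 < l)%Z -> zdom (fun j => cbin m (x + l * j)%Z).
Proof.
  intros Hl.
  assert (H : exists C, 0 <= C /\ forall y, Rabs (cbin m y) <= C).
  { induction m as [|m [C [HC0 HC]]].
    - exists 1. split; [lra|]. intros y. cbn [cbin]. destruct Z.eq_dec; rewrite ?Rabs_R1, ?Rabs_R0; lra.
    - exists (4 * C). split; [lra|]. intros y. cbn [cbin].
      pose proof (HC (y - 1)%Z). pose proof (HC y). pose proof (HC (y + 1)%Z).
      eapply Rle_trans; [apply Rabs_triang|].
      eapply Rle_trans; [apply Rplus_le_compat_r, Rabs_triang|].
      rewrite Rabs_mult, (Rabs_pos_eq 2) by lra. lra. }
  destruct H as [C [HC0 HC]].
  exists (C * (1 + (INR m + Rabs (IZR x)) ^ 2)). intros j.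
  destruct (Z_lt_le_dec (Z.of_nat m) (Z.abs (x + l * j))) as [Hj|Hj].
  - rewrite cbin_out by auto. rewrite Rabs_R0. pose proof (zw_pos j).
    apply Rmult_le_pos; [|lra]. apply Rmult_le_pos; [lra|].
    pose proof (pow2_ge_0 (INR m + Rabs (IZR x))). lra.
  - rewrite Rmult_assoc. rewrite <- (Rmult_1_r (Rabs _)).
    apply Rmult_le_compat; [apply Rabs_pos|lra|apply HC|].
    assert (Hjj : (Z.abs j <= Z.of_nat m + Z.abs x)%Z) by nia.
    apply IZR_le in Hjj. rewrite plus_IZR, !abs_IZR, <- INR_IZR_INZ in Hjj.
    unfold zw. pose proof (pow2_ge_0 (IZR j)).
    apply Rmult_le_reg_r with (1 + IZR j ^ 2); [lra|]. rewrite Rmult_assoc, Rinv_l by lra.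
    rewrite <- (pow2_abs (IZR j)). pose proof (Rabs_pos (IZR j)).
    assert (Rabs (IZR j) ^ 2 <= (INR m + Rabs (IZR x)) ^ 2) by (apply pow_incr; lra). lra.
Qed.

(* Both sides, as functions of [m] and [x], satisfy the recursion defining [cbin]. *)
Lemma cos_power_sum m h x :
  let l := (2 * Z.of_nat h + 1)%Z in
  sum_n (fun i => (4 * cos (PI * IZR (Z.of_nat i - Z.of_nat h) / IZR l) ^ 2) ^ m *
     cos (IZR (Z.of_nat i - Z.of_nat h) * (2 * PI * IZR x / IZR l))) (2 * h)
  = IZR l * zsum (fun j => cbin m (x + l * j)%Z).
Proof.
  intros l. assert (Hl : (0 < l)%Z) by (unfold l; lia).
  assert (HlR : 0 < IZR l) by now apply IZR_lt.
  revert x. induction m; intros x.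
  - transitivity (sum_n (fun i => cos (IZR (Z.of_nat i - Z.of_nat h) * (2 * PI * IZR x / IZR l))) (2 * h)).
    { apply sum_n_ext. intros i. simpl. rring. }
    (* Orthogonality of the [l]-th roots of unity: both sides are [l] if [l] divides [x], and 0
       otherwise. *)
    destruct (Z.eq_dec (x mod l) 0) as [Hx|Hx].
    + assert (Hx' : x = (l * (x / l))%Z) by (pose proof (Z.div_mod x l ltac:(lia)); lia).
      set (k := (x / l)%Z) in *.
      rewrite (zsum_ext (fun j => cbin 0 (x + l * j)%Z) (fun j => cbin 0 (l * (j + k))%Z))
        by (intros; f_equal; lia).
      rewrite (zsum_shift k (fun j => cbin 0 (l * j)%Z)).
      2:{ apply (zdom_ext (fun j => cbin 0 (0 + l * j)%Z)); [intros; f_equal; lia|now apply zdom_cbin]. }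
      rewrite (zsum_finite _ 0) by (intros; apply cbin_out; nia).
      simpl (2 * 0)%nat. rewrite sum_O. replace (l * (Z.of_nat 0 - Z.of_nat 0))%Z with 0%Z by lia.
      simpl cbin. rewrite Rmult_1_r.
      rewrite (sum_n_ext _ (fun _ => 1)).
      * unfold l. clear. rewrite plus_IZR, mult_IZR, <- INR_IZR_INZ.
        rewrite sum_n_const, S_INR, mult_INR. simpl. ring.
      * intros i. rewrite Hx', mult_IZR.
        replace (IZR (Z.of_nat i - Z.of_nat h) * (2 * PI * (IZR l * IZR k) / IZR l))
          with (0 + 2 * IZR ((Z.of_nat i - Z.of_nat h) * k) * PI)
          by (rewrite mult_IZR; field; lra).
        set (n := ((Z.of_nat i - Z.of_nat h) * k)%Z).
        destruct (Z_le_gt_dec 0 n).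
        -- replace (IZR n) with (INR (Z.to_nat n)) by (rewrite INR_IZR_INZ; f_equal; lia).
           now rewrite cos_period, cos_0.
        -- rewrite <- cos_neg.
           replace (- (0 + 2 * IZR n * PI)) with (0 + 2 * INR (Z.to_nat (- n)) * PI)
             by (rewrite INR_IZR_INZ, Z2Nat.id, opp_IZR by lia; ring).
           now rewrite cos_period, cos_0.
    + rewrite (zsum_ext _ (fun j => 0 * 0)).
      2:{ intros j. cbn [cbin]. destruct Z.eq_dec as [H|]; [|ring]. exfalso. apply Hx.
          replace x with ((- j) * l)%Z by lia. apply Z.mod_mul. lia. }
      rewrite zsum_scal. 
      assert (Hs : sin (2 * PI * IZR x / IZR l / 2) <> 0).
      { intros H. apply sin_eq_0_0 in H. destruct H as [k Hk]. apply Hx.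
        assert (IZR x = IZR (k * l)).
        { rewrite mult_IZR. pose proof PI_RGT_0.
          apply Rmult_eq_reg_r with (PI / IZR l).
          - transitivity (2 * PI * IZR x / IZR l / 2); [field; lra|]. rewrite Hk. field. lra.
          - apply Rgt_not_eq, Rdiv_lt_0_compat; lra. }
        apply eq_IZR in H. rewrite H. apply Z.mod_mul. lia. }
      pose proof (dirichlet_kernel (2 * PI * IZR x / IZR l) h) as HD.
      replace ((INR h + / 2) * (2 * PI * IZR x / IZR l)) with (IZR x * PI) in HD.
      2:{ replace (INR h + / 2) with (IZR l / 2)
            by (unfold l; rewrite plus_IZR, mult_IZR, <- INR_IZR_INZ; field). field. lra. }
      rewrite (sin_eq_0_1 (IZR x * PI)) in HD by now exists x.
      apply Rmult_integral in HD. destruct HD as [HD|HD]; [contradiction|].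
      rewrite HD. rring.
  - cbn [cbin].
    rewrite (zsum_ext _ (fun j => cbin m (x - 1 + l * j)%Z + (2 * cbin m (x + l * j)%Z + cbin m (x + 1 + l * j)%Z))).
    2:{ intros j. replace (x + l * j - 1)%Z with (x - 1 + l * j)%Z by lia.
        replace (x + l * j + 1)%Z with (x + 1 + l * j)%Z by lia. ring. }
    rewrite !zsum_plus, zsum_scal by (auto using zdom_plus, zdom_scal, zdom_cbin).
    rewrite !Rmult_plus_distr_l.
    replace (IZR l * (2 * zsum (fun j => cbin m (x + l * j)%Z))) with (2 * (IZR l * zsum (fun j => cbin m (x + l * j)%Z))) by ring.
    rewrite <- !IHm, <- sum_n_scal, <- !sum_n_add.
    apply sum_n_ext. intros i. set (k := IZR (Z.of_nat i - Z.of_nat h)).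
    match goal with |- @eq _ ?a ?b => change (@eq R a b) end.
    rewrite minus_IZR, plus_IZR.
    (* The factor [4 cos^2] equals 2 plus twice the cosine of the double angle; multiplied by the
       cosine at [x], the latter gives the cosines at [x - 1] and [x + 1]. *)
    replace (k * (2 * PI * (IZR x - 1) / IZR l)) with
      (k * (2 * PI * IZR x / IZR l) - 2 * (PI * k / IZR l)) by (field; lra).
    replace (k * (2 * PI * (IZR x + 1) / IZR l)) with
      (k * (2 * PI * IZR x / IZR l) + 2 * (PI * k / IZR l)) by (field; lra).
    rewrite cos_minus, cos_plus. rewrite cos_2a_cos. cbn [pow]. ring.
Qed.

Lemma cbin_0 m : (INR m + 1) * cbin (S m) 0 = (4 * INR m + 2) * cbin m 0.
Proof.
  cbn [cbin]. replace (0 - 1)%Z with (- (0 + 1))%Z by lia. rewrite cbin_opp.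
  pose proof (cbin_ratio m 0). simpl IZR in H. lra.
Qed.

(** * Asymptotics of central binomial coefficients and powers of the cosine *)

Definition cbin_norm (m : nat) : R := cbin m 0 / 4 ^ m.

Lemma cbin_norm_S m : (2 * INR m + 2) * cbin_norm (S m) = (2 * INR m + 1) * cbin_norm m.
Proof.
  unfold cbin_norm. pose proof (cbin_0 m) as H. assert (4 ^ m <> 0) by (apply pow_nonzero; lra).
  cbn [pow]. pose proof (pos_INR m).
  transitivity ((INR m + 1) * cbin (S m) 0 / (2 * 4 ^ m)); [field; auto|].
  rewrite H. field. auto.
Qed.

Lemma cbin_norm_pos m : 0 < cbin_norm m.
Proof.
  induction m.
  - unfold cbin_norm. cbn [cbin pow]. destruct Z.eq_dec; [lra|lia].
  - pose proof (cbin_norm_S m). pose proof (pos_INR m).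
    assert (0 < (2 * INR m + 1) * cbin_norm m) by (apply Rmult_lt_0_compat; lra).
    rewrite <- H in H1. nra.
Qed.

(** Writing [c] for [cbin_norm m], the sequence [m c^2] increases while [(m + 1/2) c^2] decreases.
    The value of the limit is not computed here: it comes out of the theta transformation at its
    fixed point. *)
Lemma wallis_lim : exists A : R, is_lim_seq (fun m => sqrt (INR m) * cbin_norm m) A.
Proof.
  assert (H1 : forall m, (INR (S m) + / 2) * cbin_norm (S m) ^ 2 <= (INR m + / 2) * cbin_norm m ^ 2).
  { intros m. pose proof (cbin_norm_S m). pose proof (pos_INR m). pose proof (cbin_norm_pos m).
    rewrite S_INR.
    replace (cbin_norm (S m)) with ((2 * INR m + 1) * cbin_norm m / (2 * INR m + 2)) by (rewrite <- H; field; lra).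
    replace ((INR m + 1 + / 2) * ((2 * INR m + 1) * cbin_norm m / (2 * INR m + 2)) ^ 2)
      with (((2 * INR m + 3) * (2 * INR m + 1)) / (2 * INR m + 2) ^ 2 * ((INR m + / 2) * cbin_norm m ^ 2))
      by (field; lra).
    assert (0 <= (INR m + / 2) * cbin_norm m ^ 2) by (apply Rmult_le_pos; [lra|apply pow2_ge_0]).
    assert (((2 * INR m + 3) * (2 * INR m + 1)) / (2 * INR m + 2) ^ 2 <= 1).
    { apply Rmult_le_reg_r with ((2 * INR m + 2) ^ 2); [apply pow_lt; lra|].
      unfold Rdiv. rewrite Rmult_assoc, Rinv_l by (apply pow_nonzero; lra). nra. }
    nra. }
  assert (H2 : forall m, INR m * cbin_norm m ^ 2 <= INR (S m) * cbin_norm (S m) ^ 2).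
  { intros m. pose proof (cbin_norm_S m). pose proof (pos_INR m). pose proof (cbin_norm_pos m).
    rewrite S_INR.
    replace (cbin_norm (S m)) with ((2 * INR m + 1) * cbin_norm m / (2 * INR m + 2)) by (rewrite <- H; field; lra).
    replace ((INR m + 1) * ((2 * INR m + 1) * cbin_norm m / (2 * INR m + 2)) ^ 2)
      with (((2 * INR m + 1) ^ 2 / (4 * (INR m + 1))) * cbin_norm m ^ 2) by (field; lra).
    apply Rmult_le_compat_r; [apply pow2_ge_0|].
    apply Rmult_le_reg_r with (4 * (INR m + 1)); [lra|].
    unfold Rdiv. rewrite Rmult_assoc, Rinv_l by lra. nra. }
  destruct (ex_finite_lim_seq_incr (fun m => INR m * cbin_norm m ^ 2) (/ 2)) as [A HA]; auto.
  { intros m. assert ((INR m + / 2) * cbin_norm m ^ 2 <= / 2).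
    { induction m; [|specialize (H1 m); lra].
      unfold cbin_norm. cbn [cbin pow]. destruct Z.eq_dec; [simpl; lra|lia]. }
    pose proof (pow2_ge_0 (cbin_norm m)). lra. }
  exists (sqrt A).
  apply (is_lim_seq_ext (fun m => sqrt (INR m * cbin_norm m ^ 2))).
  - intros m. rewrite sqrt_mult_alt, sqrt_pow2 by (try apply pos_INR; left; apply cbin_norm_pos). reflexivity.
  - apply (is_lim_seq_continuous sqrt); auto. apply continuity_pt_sqrt.
    refine (is_lim_seq_le (fun _ => 0) _ (Finite 0) (Finite A) _ (is_lim_seq_const _) HA).
    intros m. apply Rmult_le_pos; [apply pos_INR|apply pow2_ge_0].
Qed.

Lemma exp_le x y : x <= y -> exp x <= exp y.
Proof. intros [H|H]; [left; now apply exp_increasing|right; now rewrite H]. Qed.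

Lemma is_lim_seq_exp u l : is_lim_seq u (Finite l) -> is_lim_seq (fun n => exp (u n)) (exp l).
Proof.
  intros H. apply (is_lim_seq_continuous exp); auto.
  apply derivable_continuous_pt, derivable_pt_exp.
Qed.

Lemma is_lim_seq_opp' u l : is_lim_seq u (Finite l) -> is_lim_seq (fun n => - u n) (- l).
Proof. apply (is_lim_seq_opp u (Finite l)). Qed.

Lemma is_lim_seq_eventually_pos u l : is_lim_seq u (Finite l) -> 0 < l -> eventually (fun n => 0 < u n).
Proof.
  intros H Hl. apply is_lim_seq_spec in H. destruct (H (mkposreal l Hl)) as [N HN].
  exists N. intros n Hn. specialize (HN n Hn). simpl in HN. apply Rabs_def2 in HN. lra.
Qed.

Lemma cbin_0_pos m : 0 < cbin m 0.
Proof.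
  pose proof (cbin_norm_pos m) as H. unfold cbin_norm in H. assert (0 < 4 ^ m) by (apply pow_lt; lra).
  replace (cbin m 0) with (cbin m 0 / 4 ^ m * 4 ^ m) by (field; lra). now apply Rmult_lt_0_compat.
Qed.

Lemma cbin_succ m r : cbin m (Z.of_nat (S r)) = cbin m (Z.of_nat r) * ((INR m - INR r) / (INR m + INR r + 1)).
Proof.
  pose proof (cbin_ratio m (Z.of_nat r)) as H. rewrite <- INR_IZR_INZ in H.
  pose proof (pos_INR m). pose proof (pos_INR r).
  replace (Z.of_nat (S r)) with (Z.of_nat r + 1)%Z by lia.
  apply Rmult_eq_reg_l with (INR m + INR r + 1); [|lra]. rewrite H. field. lra.
Qed.

(** The successive ratios are at most [exp (- (2 r + 1) / (m + D))], and consecutive odd numbers add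
    up to a square. The choice [D = r] is sharp enough for the pointwise limit, [D = 2 m] gives a
    majorant uniform in [r]. *)
Lemma cbin_upper m r D : (r <= m)%nat -> (r <= D)%nat ->
  0 <= cbin m (Z.of_nat r) / cbin m 0 <= exp (- (INR r ^ 2 / (INR m + INR D))).
Proof.
  pose proof (cbin_0_pos m) as H0. intros Hm HD. induction r.
  - simpl. replace (- _) with 0 by (unfold Rdiv; ring). rewrite exp_0. unfold Rdiv. rewrite Rinv_r by lra. lra.
  - specialize (IHr ltac:(lia) ltac:(lia)). rewrite cbin_succ.
    assert (Hm' := le_INR _ _ Hm). assert (HD' := le_INR _ _ HD). rewrite S_INR in Hm', HD'.
    pose proof (pos_INR r).
    replace (cbin m (Z.of_nat r) * ((INR m - INR r) / (INR m + INR r + 1)) / cbin m 0) with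
      (cbin m (Z.of_nat r) / cbin m 0 * ((INR m - INR r) / (INR m + INR r + 1))) by (field; lra).
    replace (- (INR (S r) ^ 2 / (INR m + INR D))) with
      (- (INR r ^ 2 / (INR m + INR D)) + - ((2 * INR r + 1) / (INR m + INR D)))
      by (rewrite S_INR; field; lra).
    rewrite exp_plus.
    assert (H1 : 0 <= (INR m - INR r) / (INR m + INR r + 1) <= exp (- ((2 * INR r + 1) / (INR m + INR D)))).
    { split; [apply Rdiv_le_0_compat; lra|].
      eapply Rle_trans; [|apply exp_ineq1_le].
      replace ((INR m - INR r) / (INR m + INR r + 1)) with (1 + - ((2 * INR r + 1) / (INR m + INR r + 1)))
        by (field; lra).
      apply Rplus_le_compat_l, Ropp_le_contravar. apply Rmult_le_compat_l; [lra|].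
      apply Rinv_le_contravar; lra. }
    split; [apply Rmult_le_pos; lra|]. apply Rmult_le_compat; lra.
Qed.

(** Each ratio is written as [1 / (1 + x)], which is at least [exp (- x)], and the odd numbers are
    summed as in [cbin_upper]. *)
Lemma cbin_lower m r D : (r <= D)%nat -> (D < m)%nat ->
  exp (- (INR r ^ 2 / (INR m - INR D))) <= cbin m (Z.of_nat r) / cbin m 0.
Proof.
  pose proof (cbin_0_pos m) as H0. intros HD Hm. assert (Hm' := lt_INR _ _ Hm). induction r.
  - simpl. replace (- _) with 0 by (unfold Rdiv; ring). rewrite exp_0. unfold Rdiv. rewrite Rinv_r by lra. lra.
  - specialize (IHr ltac:(lia)). rewrite cbin_succ.
    assert (HD' := le_INR _ _ HD). rewrite S_INR in HD'. pose proof (pos_INR r).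
    replace (cbin m (Z.of_nat r) * ((INR m - INR r) / (INR m + INR r + 1)) / cbin m 0) with
      (cbin m (Z.of_nat r) / cbin m 0 * ((INR m - INR r) / (INR m + INR r + 1))) by (field; lra).
    replace (- (INR (S r) ^ 2 / (INR m - INR D))) with
      (- (INR r ^ 2 / (INR m - INR D)) + - ((2 * INR r + 1) / (INR m - INR D)))
      by (rewrite S_INR; field; lra).
    rewrite exp_plus. apply Rmult_le_compat; [left; apply exp_pos|left; apply exp_pos|auto|].
    replace ((INR m - INR r) / (INR m + INR r + 1)) with (/ (1 + (2 * INR r + 1) / (INR m - INR r)))
      by (field; lra).
    assert (0 < (2 * INR r + 1) / (INR m - INR r)) by (apply Rdiv_lt_0_compat; lra).
    rewrite exp_Ropp. apply Rinv_le_contravar; [lra|].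
    eapply Rle_trans; [apply exp_ineq1_le|]. apply exp_le.
    apply Rmult_le_compat_l; [lra|]. apply Rinv_le_contravar; lra.
Qed.

Lemma exp_zw c : 0 < c -> exists C, 0 <= C /\ forall j, exp (- (c * IZR j ^ 2)) <= C * zw j.
Proof.
  intros Hc. set (m := Rmin 1 c). assert (Hm : 0 < m) by (unfold m; apply Rmin_pos; lra).
  exists (/ m). split; [left; now apply Rinv_0_lt_compat|]. intros j.
  pose proof (pow2_ge_0 (IZR j)). unfold zw. rewrite exp_Ropp, <- Rinv_mult.
  apply Rinv_le_contravar; [apply Rmult_lt_0_compat; lra|].
  eapply Rle_trans; [|apply exp_ineq1_le].
  assert (m <= 1) by apply Rmin_l. assert (m <= c) by apply Rmin_r.
  assert (m * IZR j ^ 2 <= c * IZR j ^ 2) by now apply Rmult_le_compat_r. lra.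
Qed.

(** All three come from [1 - x^2 / 2 <= cos x <= 1 - x^2 / 2 + x^4 / 24]. The first, valid with a
    fixed multiple of [x^2] on the whole range, is for domination; the other two have exponent
    equivalent to [- x^2] at 0 and squeeze the limit. *)
Lemma cos_sqr_bounds x : 0 <= x <= PI / 2 ->
  cos x ^ 2 <= exp (- (2 / 3 * x ^ 2)) /\ cos x ^ 2 <= exp (- (x ^ 2 - x ^ 4 / 12)) /\
  (x ^ 2 < 2 -> exp (- (x ^ 2 / (1 - x ^ 2 / 2))) <= cos x ^ 2).
Proof.
  intros Hx. pose proof PI_4. pose proof PI_RGT_0.
  destruct (pre_cos_bound x 0 ltac:(lra) ltac:(lra)) as [HL HU].
  unfold cos_approx, cos_term in HL, HU. simpl in HL, HU.
  assert (HL' : 1 - x ^ 2 / 2 <= cos x) by (simpl; lra).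
  assert (HU' : cos x <= 1 - x ^ 2 / 2 + x ^ 4 / 24) by (simpl; lra).
  assert (Hc : 0 <= cos x) by (apply cos_ge_0; lra).
  assert (Hx2 : 0 <= x ^ 2 <= 4) by (split; [apply pow2_ge_0|nra]).
  split; [|split].
  - replace (- (2 / 3 * x ^ 2)) with (- (x ^ 2 / 3) + - (x ^ 2 / 3)) by field. rewrite exp_plus.
    simpl (cos x ^ 2). rewrite Rmult_1_r.
    assert (cos x <= exp (- (x ^ 2 / 3))).
    { eapply Rle_trans; [|apply exp_ineq1_le]. replace (x ^ 4) with (x ^ 2 * x ^ 2) in HU' by ring. nra. }
    now apply Rmult_le_compat.
  - replace (- (x ^ 2 - x ^ 4 / 12)) with (- (x ^ 2 / 2) + x ^ 4 / 24 + (- (x ^ 2 / 2) + x ^ 4 / 24)) by field.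
    rewrite exp_plus. simpl (cos x ^ 2). rewrite Rmult_1_r.
    assert (cos x <= exp (- (x ^ 2 / 2) + x ^ 4 / 24)).
    { eapply Rle_trans; [|apply exp_ineq1_le]. lra. }
    now apply Rmult_le_compat.
  - intros Hlt.
    replace (- (x ^ 2 / (1 - x ^ 2 / 2))) with
      (- (x ^ 2 / 2 / (1 - x ^ 2 / 2)) + - (x ^ 2 / 2 / (1 - x ^ 2 / 2))) by (field; lra).
    rewrite exp_plus. simpl (cos x ^ 2). rewrite Rmult_1_r.
    assert (exp (- (x ^ 2 / 2 / (1 - x ^ 2 / 2))) <= cos x).
    { eapply Rle_trans; [|exact HL']. rewrite exp_Ropp, <- (Rinv_inv (1 - x ^ 2 / 2)).
      apply Rinv_le_contravar; [apply Rinv_0_lt_compat; lra|].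
      eapply Rle_trans; [|apply exp_ineq1_le]. right. field. lra. }
    apply Rmult_le_compat; auto; left; apply exp_pos.
Qed.

Lemma exp_pow x n : exp x ^ n = exp (INR n * x).
Proof.
  induction n; [simpl; now rewrite Rmult_0_l, exp_0|].
  cbn [pow]. rewrite IHn, S_INR, <- exp_plus. f_equal. ring.
Qed.

(* Polya's proof: in [cos_power_sum] with [x = 0], let the modulus [l] and the exponent [m]
   tend to infinity with [m / l^2 -> t]. *)
Section Polya.
Variable t : R.
Hypothesis Ht : 0 < t.

Let l (h : nat) : R := 2 * INR h + 1.
Let m (h : nat) : nat := Z.to_nat (up (t * l h ^ 2)).
Let a (h : nat) : R := INR (m h) / l h ^ 2.

Lemma l_pos h : 1 <= l h.
Proof. unfold l. pose proof (pos_INR h). lra. Qed.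

Lemma m_bounds h : t * l h ^ 2 <= INR (m h) <= t * l h ^ 2 + 1.
Proof.
  unfold m. destruct (archimed (t * l h ^ 2)) as [H1 H2].
  assert (0 <= t * l h ^ 2) by (apply Rmult_le_pos; [lra|apply pow2_ge_0]).
  assert (0 <= up (t * l h ^ 2))%Z by (apply le_IZR; lra).
  rewrite INR_IZR_INZ, Z2Nat.id by auto. lra.
Qed.

Lemma l_inv_lim : is_lim_seq (fun h => / l h) 0.
Proof.
  replace (Finite 0) with (Rbar_inv p_infty) by reflexivity.
  apply is_lim_seq_inv; [|discriminate].
  apply (is_lim_seq_le_p_loc INR); [|apply is_lim_seq_INR].
  exists O. intros h _. unfold l. pose proof (pos_INR h). lra.
Qed.

Lemma a_bounds h : t <= a h <= t + / l h * / l h.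
Proof.
  pose proof (l_pos h). pose proof (m_bounds h). unfold a.
  assert (0 < l h ^ 2) by (apply pow_lt; lra).
  split; apply Rmult_le_reg_r with (l h ^ 2); auto; unfold Rdiv; rewrite ?Rmult_assoc, ?Rinv_l by lra; [lra|].
  replace ((t + / l h * / l h) * l h ^ 2) with (t * l h ^ 2 + 1) by (field; lra). lra.
Qed.

Lemma a_lim : is_lim_seq a t.
Proof.
  apply (is_lim_seq_le_le (fun _ => t) _ (fun h => t + / l h * / l h)).
  - apply a_bounds.
  - apply is_lim_seq_const.
  - replace (Finite t) with (Finite (t + 0 * 0)) by (f_equal; ring).
    apply is_lim_seq_plus'; [apply is_lim_seq_const|]. apply is_lim_seq_mult'; apply l_inv_lim.
Qed.

Lemma m_lim : filterlim m eventually eventually.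
Proof.
  intros P [N HN]. 
  destruct (INR_unbounded (INR N / t)) as [N' HN'].
  exists N'. intros h Hh. apply HN. apply INR_le.
  pose proof (m_bounds h). apply le_INR in Hh. pose proof (pos_INR N').
  assert (INR N = t * (INR N / t)) by (field; lra).
  assert (INR N / t <= l h) by (unfold l; lra). pose proof (l_pos h).
  assert (t * (INR N / t) <= t * l h) by (apply Rmult_le_compat_l; lra).
  assert (t * l h * 1 <= t * l h * l h) by (apply Rmult_le_compat_l; [apply Rmult_le_pos; lra|lra]).
  simpl in H. lra.
Qed.

Let lz (h : nat) : Z := (2 * Z.of_nat h + 1)%Z.

Lemma lz_l h : IZR (lz h) = l h.
Proof. unfold lz, l. now rewrite plus_IZR, mult_IZR, <- INR_IZR_INZ. Qed.

Lemma cbin_abs k j : cbin k (Z.abs j) = cbin k j.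
Proof. destruct (Z.abs_eq_or_opp j) as [->| ->]; auto using cbin_opp. Qed.

Lemma cbin_term h j r : r = Z.to_nat (lz h * Z.abs j) ->
  cbin (m h) (lz h * j) = cbin (m h) (Z.of_nat r) /\ INR r = l h * Rabs (IZR j).
Proof.
  intros ->. assert (0 < lz h)%Z by (unfold lz; lia). split.
  - rewrite <- cbin_abs, Z2Nat.id by nia. f_equal. rewrite Z.abs_mul, (Z.abs_eq (lz h)) by lia. reflexivity.
  - rewrite INR_IZR_INZ, Z2Nat.id, mult_IZR, abs_IZR, lz_l by nia. reflexivity.
Qed.

Lemma cbin_sum_lim :
  is_lim_seq (fun h => zsum (fun j => cbin (m h) (lz h * j)%Z / cbin (m h) 0))
    (zsum (fun j => exp (- (IZR j ^ 2 / t)))).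
Proof.
  (* In [cbin_upper] with [D = 2 m] the denominator is [3 m], at most [3 (t + 1) l^2], while the
     numerator is [(l j)^2]. *)
  assert (Hc : 0 < / (3 * (t + 1))) by (apply Rinv_0_lt_compat; lra).
  destruct (exp_zw _ Hc) as [C [HC0 HC]].
  apply (zsum_dominated _ _ (fun j => C * zw j)); [|apply zdom_zw|].
  - exists O. intros h _ j. eapply Rle_trans; [|apply HC].
    destruct (cbin_term h j _ eq_refl) as [-> Hr]. set (r := Z.to_nat (lz h * Z.abs j)) in *.
    destruct (le_lt_dec r (m h)) as [Hle|Hlt].
    + pose proof (cbin_upper (m h) r (2 * m h) Hle ltac:(lia)) as [H1 H2].
      rewrite Rabs_pos_eq by auto. eapply Rle_trans; [exact H2|]. apply exp_le.
      apply Ropp_le_contravar. rewrite Hr, Rpow_mult_distr, pow2_abs, mult_INR. simpl (INR 2).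
      pose proof (m_bounds h). pose proof (l_pos h). 
      assert (1 <= l h ^ 2) by nra.
      assert (Hm : 0 < INR (m h) <= (t + 1) * l h ^ 2) by nra.
      replace (/ (3 * (t + 1)) * IZR j ^ 2) with (l h ^ 2 * IZR j ^ 2 * / (3 * ((t + 1) * l h ^ 2)))
        by (field; lra).
      apply Rmult_le_compat_l; [apply Rmult_le_pos; apply pow2_ge_0|].
      apply Rinv_le_contravar; lra.
    + rewrite cbin_out by lia. unfold Rdiv. rewrite Rmult_0_l, Rabs_R0. left; apply exp_pos.
  - intros j.
    assert (Hg : is_lim_seq (fun h => Rabs (IZR j) * / l h) 0).
    { replace (Finite 0) with (Finite (Rabs (IZR j) * 0)) by (f_equal; ring).
      apply is_lim_seq_mult'; [apply is_lim_seq_const|apply l_inv_lim]. }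
    assert (Hm1 : is_lim_seq (fun h => a h - Rabs (IZR j) * / l h) t).
    { replace (Finite t) with (Finite (t - 0)) by (f_equal; ring).
      apply is_lim_seq_minus'; [apply a_lim|auto]. }
    assert (Hp1 : is_lim_seq (fun h => a h + Rabs (IZR j) * / l h) t).
    { replace (Finite t) with (Finite (t + 0)) by (f_equal; ring).
      apply is_lim_seq_plus'; [apply a_lim|auto]. }
    (* For [r = l |j|] the exponents [r^2 / (m - r)] and [r^2 / (m + r)] are [j^2] divided by
       [a - |j| / l] and [a + |j| / l], which both tend to [t]. *)
    apply (is_lim_seq_le_le_loc
      (fun h => exp (- (IZR j ^ 2 / (a h - Rabs (IZR j) * / l h)))) _
      (fun h => exp (- (IZR j ^ 2 / (a h + Rabs (IZR j) * / l h))))).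
    + destruct (is_lim_seq_eventually_pos _ _ Hm1 Ht) as [N HN]. exists N. intros h Hh.
      specialize (HN h Hh).
      destruct (cbin_term h j _ eq_refl) as [-> Hr]. set (r := Z.to_nat (lz h * Z.abs j)) in *.
      pose proof (l_pos h) as Hl. pose proof (Rabs_pos (IZR j)).
      assert (Hrm : (r < m h)%nat).
      { apply INR_lt. rewrite Hr. unfold a in HN.
        assert (0 < (INR (m h) / l h ^ 2 - Rabs (IZR j) * / l h) * l h ^ 2)
          by (apply Rmult_lt_0_compat; [auto|apply pow_lt; lra]).
        replace ((INR (m h) / l h ^ 2 - Rabs (IZR j) * / l h) * l h ^ 2) with
          (INR (m h) - l h * Rabs (IZR j)) in H0 by (field; lra). lra. }
      assert (Hrm' := lt_INR _ _ Hrm). rewrite Hr in Hrm'.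
      pose proof (cbin_upper (m h) r r ltac:(lia) ltac:(lia)) as [_ H2].
      pose proof (cbin_lower (m h) r r ltac:(lia) Hrm) as H3.
      rewrite Hr, Rpow_mult_distr, pow2_abs in H2, H3.
      assert (Hl2 : 0 < l h * Rabs (IZR j) \/ Rabs (IZR j) = 0) by nra.
      assert (0 < t * l h ^ 2) by (apply Rmult_lt_0_compat; [auto|apply pow_lt; lra]).
      pose proof (m_bounds h).
      assert (0 <= l h * Rabs (IZR j)) by (apply Rmult_le_pos; lra).
      split.
      * eapply Rle_trans; [|exact H3]. right. f_equal. f_equal. unfold a. field. repeat split; lra.
      * eapply Rle_trans; [exact H2|]. right. f_equal. f_equal. unfold a. field. repeat split; lra.
    + apply is_lim_seq_exp. apply is_lim_seq_opp'.
      apply is_lim_seq_div'; [apply is_lim_seq_const|auto|lra].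
    + apply is_lim_seq_exp. apply is_lim_seq_opp'.
      apply is_lim_seq_div'; [apply is_lim_seq_const|auto|lra].
Qed.

(** The cosine side of [cos_power_sum] at [x = 0], divided by [4^m] and extended by 0 so that it
    becomes a sum over [Z]. *)
Let cs (h : nat) (k : Z) : R :=
  if Z_le_dec (Z.abs k) (Z.of_nat h) then (cos (PI * IZR k / l h) ^ 2) ^ m h else 0.

Lemma cs_abs h k : cs h (Z.abs k) = cs h k.
Proof.
  unfold cs. rewrite Z.abs_involutive. destruct Z_le_dec; auto.
  destruct (Z.abs_eq_or_opp k) as [->| ->]; auto. rewrite opp_IZR.
  replace (PI * - IZR k / l h) with (- (PI * IZR k / l h)) by (unfold Rdiv; ring).
  now rewrite cos_neg.
Qed.

Lemma cs_arg h k : (Z.abs k <= Z.of_nat h)%Z -> 0 <= PI * IZR (Z.abs k) / l h <= PI / 2.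
Proof.
  intros Hk. apply IZR_le in Hk. rewrite <- INR_IZR_INZ in Hk.
  assert (0 <= IZR (Z.abs k)) by (apply IZR_le; lia).
  pose proof PI_RGT_0. pose proof (l_pos h).
  split; [apply Rdiv_le_0_compat; [apply Rmult_le_pos; lra|lra]|].
  unfold Rdiv. rewrite Rmult_assoc. apply Rmult_le_compat_l; [lra|].
  apply Rmult_le_reg_r with (l h); [lra|]. rewrite Rmult_assoc, Rinv_l by lra. unfold l. lra.
Qed.

Lemma cos_sum_lim :
  is_lim_seq (fun h => zsum (cs h)) (zsum (fun k => exp (- (PI ^ 2 * t * IZR k ^ 2)))).
Proof.
  pose proof PI_RGT_0 as Hpi.
  assert (Hpi2 : 0 < PI ^ 2) by (apply pow_lt; auto).
  assert (Hc : 0 < 2 / 3 * (PI ^ 2 * t)) by (apply Rmult_lt_0_compat; [lra|now apply Rmult_lt_0_compat]).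
  destruct (exp_zw _ Hc) as [C [HC0 HC]].
  assert (Hsq : forall k, IZR (Z.abs k) ^ 2 = IZR k ^ 2) by (intros; rewrite abs_IZR; apply pow2_abs).
  apply (zsum_dominated _ _ (fun j => C * zw j)); [|apply zdom_zw|].
  - exists O. intros h _ k. eapply Rle_trans; [|apply HC]. rewrite <- cs_abs.
    unfold cs. rewrite Z.abs_involutive. destruct Z_le_dec as [Hk|Hk].
    2:{ rewrite Rabs_R0. left. apply exp_pos. }
    rewrite Rabs_pos_eq by (apply pow_le, pow2_ge_0).
    destruct (cos_sqr_bounds _ (cs_arg h k Hk)) as [H1 _].
    eapply Rle_trans; [apply pow_incr; split; [apply pow2_ge_0|exact H1]|].
    rewrite exp_pow. apply exp_le. pose proof (l_pos h). destruct (a_bounds h) as [Ha _].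
    replace (INR (m h) * - (2 / 3 * (PI * IZR (Z.abs k) / l h) ^ 2)) with
      (- (2 / 3 * (PI ^ 2 * a h) * IZR (Z.abs k) ^ 2)) by (unfold a; field; lra).
    rewrite Hsq. apply Ropp_le_contravar. apply Rmult_le_compat_r; [apply pow2_ge_0|].
    apply Rmult_le_compat_l; [lra|]. apply Rmult_le_compat_l; lra.
  - intros k. set (K := IZR (Z.abs k)).
    assert (Hg : is_lim_seq (fun h => (PI * K * / l h) ^ 2) 0).
    { replace (Finite 0) with (Finite ((PI * K * 0) * (PI * K * 0))) by (f_equal; ring).
      apply (is_lim_seq_ext (fun h => (PI * K * / l h) * (PI * K * / l h))); [intros; ring|].
      apply is_lim_seq_mult'; apply is_lim_seq_mult'; try apply is_lim_seq_const; apply l_inv_lim. }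
    assert (Hka : is_lim_seq (fun h => PI ^ 2 * K ^ 2 * a h) (PI ^ 2 * K ^ 2 * t))
      by (apply is_lim_seq_mult'; [apply is_lim_seq_const|apply a_lim]).
    replace (exp (- (PI ^ 2 * t * IZR k ^ 2))) with (exp (- (PI ^ 2 * K ^ 2 * t)))
      by (f_equal; unfold K; rewrite Hsq; ring).
    (* With [x = PI K / l] one has [m x^2 = PI^2 K^2 a]; the corrections [x^2 / 2] and [x^2 / 12]
       tend to 0. *)
    apply (is_lim_seq_le_le_loc
      (fun h => exp (- (PI ^ 2 * K ^ 2 * a h / (1 - (PI * K * / l h) ^ 2 / 2)))) _
      (fun h => exp (- (PI ^ 2 * K ^ 2 * a h * (1 - (PI * K * / l h) ^ 2 / 12))))).
    + assert (H2 : is_lim_seq (fun h => 2 - (PI * K * / l h) ^ 2) 2).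
      { replace (Finite 2) with (Finite (2 - 0)) by (f_equal; ring).
        apply is_lim_seq_minus'; [apply is_lim_seq_const|auto]. }
      destruct (is_lim_seq_eventually_pos _ _ H2 ltac:(lra)) as [N HN].
      exists (max N (Z.to_nat (Z.abs k))). intros h Hh. specialize (HN h ltac:(lia)).
      rewrite <- cs_abs. unfold cs. rewrite Z.abs_involutive.
      destruct Z_le_dec as [Hk|Hk]; [|lia].
      destruct (cos_sqr_bounds _ (cs_arg h k Hk)) as [_ [H3 H4]]. fold K in H3, H4 |- *.
      pose proof (l_pos h). change (PI * K * / l h) with (PI * K / l h) in *.
      specialize (H4 ltac:(lra)). set (x := PI * K / l h) in *.
      assert (Hx : INR (m h) * x ^ 2 = PI ^ 2 * K ^ 2 * a h) by (unfold x, a; field; lra).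
      rewrite <- Hx. split.
      * apply Rle_trans with (exp (- (x ^ 2 / (1 - x ^ 2 / 2))) ^ m h).
        -- rewrite exp_pow. right. f_equal. field. lra.
        -- apply pow_incr. split; [left; apply exp_pos|auto].
      * apply Rle_trans with (exp (- (x ^ 2 - x ^ 4 / 12)) ^ m h).
        -- apply pow_incr. split; [apply pow2_ge_0|auto].
        -- rewrite exp_pow. right. f_equal. field.
    + apply is_lim_seq_exp. apply is_lim_seq_opp'.
      replace (PI ^ 2 * K ^ 2 * t) with (PI ^ 2 * K ^ 2 * t / (1 - 0 / 2)) by field.
      apply is_lim_seq_div'; auto; [|lra].
      apply is_lim_seq_minus'; [apply is_lim_seq_const|].
      apply is_lim_seq_div'; [auto|apply is_lim_seq_const|lra].
    + apply is_lim_seq_exp. apply is_lim_seq_opp'.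
      replace (PI ^ 2 * K ^ 2 * t) with (PI ^ 2 * K ^ 2 * t * (1 - 0 / 12)) by field.
      apply is_lim_seq_mult'; auto.
      apply is_lim_seq_minus'; [apply is_lim_seq_const|].
      apply is_lim_seq_div'; [auto|apply is_lim_seq_const|lra].
Qed.

Lemma cs_cbin h : zsum (cs h) = l h / sqrt (INR (m h)) * (sqrt (INR (m h)) * cbin_norm (m h)) *
   zsum (fun j => cbin (m h) (lz h * j)%Z / cbin (m h) 0).
Proof.
  pose proof (cos_power_sum (m h) h 0) as H. cbv zeta in H. fold (lz h) in H.
  rewrite lz_l in H.
  assert (H4 : 4 ^ m h <> 0) by (apply pow_nonzero; lra).
  assert (Hs : sqrt (INR (m h)) <> 0).
  { apply Rgt_not_eq, sqrt_lt_R0. pose proof (m_bounds h). pose proof (l_pos h).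
    assert (0 < t * l h ^ 2) by (apply Rmult_lt_0_compat; [auto|apply pow_lt; lra]). lra. }
  pose proof (cbin_0_pos (m h)) as H0.
  rewrite (zsum_finite (cs h) h).
  2:{ intros j Hj. unfold cs. destruct Z_le_dec; [lia|reflexivity]. }
  rewrite (zsum_ext _ (fun j => / cbin (m h) 0 * cbin (m h) (0 + lz h * j)%Z)).
  2:{ intros j. rewrite Z.add_0_l. unfold Rdiv. ring. }
  rewrite zsum_scal. unfold cbin_norm.
  transitivity (/ 4 ^ m h * (l h * zsum (fun j => cbin (m h) (0 + lz h * j)%Z))); [|field; repeat split; auto; lra].
  rewrite <- H, <- sum_n_scal. apply sum_n_ext_loc. intros i Hi.
  match goal with |- @eq _ ?a ?b => change (@eq R a b) end.
  unfold cs. destruct Z_le_dec; [|lia].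
  replace (IZR (Z.of_nat i - Z.of_nat h) * (2 * PI * 0 / l h)) with 0 by (unfold Rdiv; ring).
  rewrite cos_0, !Rpow_mult_distr. field. auto.
Qed.

Lemma polya_limit A : is_lim_seq (fun m => sqrt (INR m) * cbin_norm m) (Finite A) ->
  zsum (fun k => exp (- (PI ^ 2 * t * IZR k ^ 2))) =
  / sqrt t * A * zsum (fun j => exp (- (IZR j ^ 2 / t))).
Proof.
  intros HA.
  assert (H1 := cos_sum_lim).
  assert (H2 : is_lim_seq (fun h => l h / sqrt (INR (m h)) * (sqrt (INR (m h)) * cbin_norm (m h)) *
   zsum (fun j => cbin (m h) (lz h * j)%Z / cbin (m h) 0)) (/ sqrt t * A * zsum (fun j => exp (- (IZR j ^ 2 / t))))).
  { apply is_lim_seq_mult'; [|apply cbin_sum_lim]. apply is_lim_seq_mult'.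
    - apply (is_lim_seq_ext (fun h => / sqrt (a h))).
      + intros h. pose proof (l_pos h). pose proof (m_bounds h).
        assert (0 < t * l h ^ 2) by (apply Rmult_lt_0_compat; [auto|apply pow_lt; lra]).
        unfold a. rewrite sqrt_div_alt, sqrt_pow2 by (try apply pow_lt; lra).
        field. split; [|lra]. apply Rgt_not_eq, sqrt_lt_R0. lra.
      + apply (is_lim_seq_inv _ (Finite (sqrt t))).
        * apply (is_lim_seq_continuous sqrt); [apply continuity_pt_sqrt; lra|apply a_lim].
        * intros He. injection He. apply Rgt_not_eq. now apply sqrt_lt_R0.
    - apply (is_lim_seq_subseq (fun k => sqrt (INR k) * cbin_norm k) _ m); [apply m_lim|auto]. }
  apply (is_lim_seq_ext _ _ _ cs_cbin) in H1.
  apply is_lim_seq_unique in H1. apply is_lim_seq_unique in H2. rewrite H1 in H2.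
  now apply (f_equal real) in H2.
Qed.
End Polya.

(** * The functional equation of the theta function *)

Definition gauss_theta (s : R) : R := zsum (fun n => exp (- (PI * s * IZR n ^ 2))).

Lemma gauss_theta_pos s : 0 < s -> 0 < gauss_theta s.
Proof.
  intros Hs. assert (Hps : 0 < PI * s) by (apply Rmult_lt_0_compat; [apply PI_RGT_0|auto]).
  destruct (exp_zw _ Hps) as [C [HC0 HC]].
  assert (Hd : zdom (fun n => exp (- (PI * s * IZR n ^ 2)))).
  { exists C. intros n. rewrite Rabs_pos_eq by (left; apply exp_pos). apply HC. }
  apply Rlt_le_trans with 1; [lra|].
  apply Rle_trans with (zsum (fun j => if Z.eq_dec j 0 then 1 else 0)).
  - rewrite (zsum_finite _ 0).
    + simpl (2 * 0)%nat. rewrite sum_O. simpl. lra.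
    + intros j Hj. destruct Z.eq_dec; [lia|reflexivity].
  - apply zsum_le; auto. intros n. destruct Z.eq_dec as [->|].
    + split; [lra|]. rewrite pow_i by lia. rewrite Rmult_0_r, Ropp_0, exp_0. lra.
    + split; [lra|]. left. apply exp_pos.
Qed.

Lemma gauss_theta_transform s : 0 < s -> gauss_theta s = / sqrt s * gauss_theta (/ s).
Proof.
  intros Hs. destruct wallis_lim as [A HA].
  assert (Hpi := PI_RGT_0).
  assert (H : forall s, 0 < s -> gauss_theta s = / sqrt (s / PI) * A * gauss_theta (/ s)).
  { clear s Hs. intros s Hs.
    pose proof (polya_limit (s / PI) ltac:(apply Rdiv_lt_0_compat; lra) A HA) as HP.
    unfold gauss_theta. rewrite (zsum_ext (fun n => exp (- (PI * s * IZR n ^ 2)))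
      (fun n => exp (- (PI ^ 2 * (s / PI) * IZR n ^ 2)))), HP.
    - f_equal. apply zsum_ext. intros n. f_equal. field. lra.
    - intros n. f_equal. field. lra. }
  (* The case [s = 1] determines the constant [A]. *)
  assert (H1 := H 1 ltac:(lra)). assert (H1p := gauss_theta_pos 1 ltac:(lra)).
  rewrite Rinv_1 in H1.
  assert (H2 : / sqrt (1 / PI) * A = 1).
  { apply Rmult_eq_reg_r with (gauss_theta 1); lra. }
  rewrite (H s Hs). f_equal.
  assert (Hs1 : 0 < sqrt (/ PI)) by (apply sqrt_lt_R0, Rinv_0_lt_compat; lra).
  assert (0 < sqrt s) by now apply sqrt_lt_R0.
  unfold Rdiv in *. rewrite Rmult_1_l in H2. rewrite sqrt_mult_alt by lra.
  replace A with (sqrt (/ PI)).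
  - field. lra.
  - apply Rmult_eq_reg_l with (/ sqrt (/ PI)); [|apply Rinv_neq_0_compat; lra].
    rewrite H2. field. lra.
Qed.

Lemma E_pos q : 0 < q < 1 -> 0 < E q.
Proof. intros Hq. rewrite E_qp. now apply qp_pos. Qed.

Lemma E_pow_pos q : 0 < q < 1 -> forall k, (0 < k)%nat -> 0 < E (q ^ k).
Proof. intros Hq k Hk. now apply E_pos, pow_in01. Qed.

Lemma theta_E q : 0 < q < 1 -> theta q 1 0 = E q ^ 2 / E (q ^ 2).
Proof.
  intros Hq. pose proof (E_pos (q ^ 2) (pow_in01 q Hq 2 ltac:(lia))) as H2.
  assert (H1 := E1_c q Hq). assert (H3 := E2_c q Hq). rewrite theta1_c by auto.
  set (o := qp (q ^ 1) (q ^ 10) * _ * _ * _ * _).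
  replace (E q) with (o * E (q ^ 2)) by (rewrite H1, H3; unfold o; ring).
  field. lra.
Qed.

(** * The modular parameter of level 10 *)

(** The alternating series is twice its even part minus the whole,
    [2 gauss_theta (4 s) - gauss_theta s]. After transformation of both terms the even indices
    cancel and the odd ones remain, a [psi] series with prefactor [exp (- PI / (4 s))]. *)
Lemma theta4_transform s : 0 < s ->
  E (exp (- (PI * s))) ^ 2 / E (exp (- (PI * s)) ^ 2) =
  / sqrt s * exp (- (PI / (4 * s))) * (2 * E (exp (- (2 * PI / s)) ^ 2) ^ 2 / E (exp (- (2 * PI / s)))).
Proof.
  intros Hs. pose proof PI_RGT_0 as Hpi.
  assert (Hexp : forall x, 0 < x -> 0 < exp (- x) < 1).
  { intros x Hx. split; [apply exp_pos|]. rewrite <- exp_0. apply exp_increasing. lra. }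
  assert (Hq := Hexp (PI * s) ltac:(apply Rmult_lt_0_compat; lra)).
  assert (Hx := Hexp (2 * PI / s) ltac:(apply Rdiv_lt_0_compat; lra)).
  assert (Hd : forall s, 0 < s -> zdom (fun n => exp (- (PI * s * IZR n ^ 2)))).
  { intros s' Hs'. destruct (exp_zw (PI * s')) as [C [HC0 HC]]; [apply Rmult_lt_0_compat; lra|].
    exists C. intros n. rewrite Rabs_pos_eq by (left; apply exp_pos). apply HC. }
  assert (Heven : forall s, zsum (fun k => exp (- (PI * s * IZR (2 * k) ^ 2))) = gauss_theta (4 * s)).
  { intros s'. apply zsum_ext. intros n. f_equal. rewrite mult_IZR. ring. }
  rewrite <- theta_E, <- psi_product by auto.
  assert (H1 : theta (exp (- (PI * s))) 1 0 = 2 * gauss_theta (4 * s) - gauss_theta s).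
  { unfold gauss_theta at 2. rewrite (zsum_mod2 _ (Hd s Hs)), Heven.
    unfold theta.
    rewrite (zsum_ext _ (fun n => sg n * exp (- (PI * s * IZR n ^ 2)))).
    2:{ intros n. f_equal. unfold Rpower. rewrite ln_exp. f_equal. ring. }
    rewrite zsum_mod2.
    2:{ apply (zdom_le _ (fun n => exp (- (PI * s * IZR n ^ 2)))); [|auto].
        intros n. rewrite Rabs_mult, sg_abs, Rabs_pos_eq; [lra|left; apply exp_pos]. }
    rewrite (zsum_ext (fun k => sg (2 * k) * _) (fun k => exp (- (PI * s * IZR (2 * k) ^ 2))))
      by (intros; rewrite sg_double; ring).
    rewrite (zsum_ext (fun k => sg (2 * k + 1) * _) (fun k => -1 * exp (- (PI * s * IZR (2 * k + 1) ^ 2))))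
      by (intros; rewrite sg_add, sg_double; change (sg 1) with (-1); ring).
    rewrite zsum_scal, Heven. ring. }
  rewrite H1, (gauss_theta_transform (4 * s)), (gauss_theta_transform s) by lra.
  replace (sqrt (4 * s)) with (2 * sqrt s).
  2:{ rewrite sqrt_mult by lra. f_equal. replace 4 with (2 ^ 2) by ring. rewrite sqrt_pow2; lra. }
  assert (H2 : gauss_theta (/ (4 * s)) = gauss_theta (/ s) + exp (- (PI / (4 * s))) * utheta (exp (- (2 * PI / s))) (1/2) (1/2)).
  { unfold gauss_theta at 1. rewrite zsum_mod2 by (apply Hd, Rinv_0_lt_compat; lra).
    rewrite Heven. f_equal; [f_equal; field; lra|].
    unfold utheta. rewrite <- zsum_scal. apply zsum_ext. intros n. unfold Rpower.
    rewrite ln_exp, <- exp_plus. f_equal. rewrite plus_IZR, mult_IZR. field. lra. }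
  rewrite H2. assert (0 < sqrt s) by now apply sqrt_lt_R0. field. lra.
Qed.

Definition q0 : R := exp (- (2 * PI / sqrt 10)).

Lemma sqrt10_pos : 0 < sqrt 10.
Proof. apply sqrt_lt_R0. lra. Qed.

Lemma q0_01 : 0 < q0 < 1.
Proof.
  unfold q0. split; [apply exp_pos|]. rewrite <- exp_0. apply exp_increasing.
  assert (0 < 2 * PI / sqrt 10); [|lra].
  apply Rdiv_lt_0_compat; [pose proof PI_RGT_0; lra|apply sqrt10_pos].
Qed.

(* With [k] the parameter [modk q] below, [uE], [wE] and [vE] are [1/k - k], [1/k + 1 - k] and [1/k - 4 - k]. *)
Definition vE (q : R) : R := E q ^ 3 * E (q ^ 5) / (q * E (q ^ 2) * E (q ^ 10) ^ 3).

Lemma vE_pos q : 0 < q < 1 -> 0 < vE q.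
Proof.
  intros Hq. unfold vE.
  assert (HE := E_pow_pos q Hq).
  pose proof (E_pos q Hq).
  apply Rdiv_lt_0_compat; repeat apply Rmult_lt_0_compat; auto using pow_lt with arith; try lra.
Qed.

(** At [s = 2 / sqrt 10] and at [s = sqrt 10] the transformation exchanges [q0] and [q0 ^ 5]. This
    gives two relations between the four values of [E], enough to isolate [vE], where the powers of
    [q0] cancel. *)
Lemma vE_q0 : vE q0 = 2 * sqrt 5.
Proof.
  pose proof sqrt10_pos as H10. pose proof PI_RGT_0 as Hpi. pose proof q0_01 as Hq.
  assert (Hss : sqrt 10 * sqrt 10 = 10) by (apply sqrt_sqrt; lra).
  set (w := sqrt 10) in *.
  (* An eighth root of [q0]: the prefactors of the two transformations are [lam] and [lam ^ 5]. *)
  pose (lam := exp (- (PI / (4 * w)))).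
  assert (Hlam : 0 < lam) by apply exp_pos.
  assert (Hlq : q0 = lam ^ 8).
  { unfold q0, lam. rewrite exp_pow. f_equal. simpl INR. fold w. field. lra. }
  assert (Hq5 : q0 ^ 5 = exp (- (PI * w))).
  { unfold q0. rewrite exp_pow. f_equal. simpl INR. fold w.
    replace (PI * w) with (PI * (w * w) / w) by (field; lra). rewrite Hss. field. lra. }
  assert (T1 := theta4_transform (2 / w) ltac:(apply Rdiv_lt_0_compat; lra)).
  assert (T2 := theta4_transform w H10).
  replace (exp (- (PI * (2 / w)))) with q0 in T1 by (unfold q0; fold w; f_equal; field; lra).
  replace (exp (- (2 * PI / (2 / w)))) with (q0 ^ 5) in T1 by (rewrite Hq5; f_equal; field; lra).
  replace (exp (- (PI / (4 * (2 / w))))) with (lam ^ 5) in T1.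
  2:{ unfold lam. rewrite exp_pow. f_equal. simpl INR.
      replace (PI / (4 * (2 / w))) with (PI * (w * w) / (8 * w)) by (field; lra). rewrite Hss. field. lra. }
  rewrite <- Hq5 in T2. fold lam in T2. fold (q0) in T2.
  change (exp (- (2 * PI / w))) with q0 in T2.
  rewrite <- !pow_mult in T1, T2. simpl Nat.mul in T1, T2.
  assert (HE := E_pow_pos q0 Hq).
  pose proof (E_pos q0 Hq) as HA. pose proof (HE 2%nat ltac:(lia)) as HB.
  pose proof (HE 5%nat ltac:(lia)) as HC. pose proof (HE 10%nat ltac:(lia)) as HD.
  pose proof (vE_pos q0 Hq) as Hv. unfold vE in *.
  set (a := E q0) in *. set (b := E (q0 ^ 2)) in *. set (c := E (q0 ^ 5)) in *. set (d := E (q0 ^ 10)) in *.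
  assert (Ha1 : 0 < sqrt (2 / w)) by (apply sqrt_lt_R0, Rdiv_lt_0_compat; lra).
  assert (Hb1 : 0 < sqrt w) by now apply sqrt_lt_R0.
  assert (Ha2 : sqrt (2 / w) ^ 2 = 2 / w) by (rewrite pow2_sqrt; [reflexivity|left; apply Rdiv_lt_0_compat; lra]).
  assert (Hb2 : sqrt w ^ 2 = w) by (rewrite pow2_sqrt; lra).
  set (al := sqrt (2 / w)) in *. set (be := sqrt w) in *.
  assert (T1' : a ^ 2 * c / (b * d ^ 2) = 2 * lam ^ 5 / al).
  { transitivity (a ^ 2 / b * (c / d ^ 2)); [field; lra|]. rewrite T1. field. lra. }
  assert (T2' : c ^ 2 * a / (b ^ 2 * d) = 2 * lam / be).
  { transitivity (c ^ 2 / d * (a / b ^ 2)); [field; lra|]. rewrite T2. field. lra. }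
  (* [v^3] is the fifth power of the left-hand side of [T1'] divided by that of [T2']. *)
  set (v := a ^ 3 * c / (q0 * b * d ^ 3)) in *.
  assert (Hv3 : v ^ 3 = 16 * be / al ^ 5).
  { transitivity ((a ^ 2 * c / (b * d ^ 2)) ^ 5 / (c ^ 2 * a / (b ^ 2 * d)) / q0 ^ 3); [unfold v; field; lra|].
    rewrite T1', T2', Hlq. field. lra. }
  (* [256 w (w / 2)^5 = 8 w^6 = 8000], since [w^2 = 10]. *)
  assert (Hv6 : (v ^ 2) ^ 3 = 20 ^ 3).
  { transitivity ((v ^ 3) ^ 2); [ring|]. rewrite Hv3.
    transitivity (256 * be ^ 2 / (al ^ 2) ^ 5); [field; lra|]. rewrite Ha2, Hb2.
    transitivity (8 * (w * w) * (w * w) * (w * w)); [field; lra|]. rewrite Hss. ring. }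
  assert (Hv2 : v ^ 2 = 20).
  { set (z := v ^ 2) in *. assert (0 < z) by (unfold z; apply pow_lt; auto).
    assert ((z - 20) * (z ^ 2 + 20 * z + 400) = 0) by (transitivity (z ^ 3 - 20 ^ 3); [ring|lra]).
    apply Rmult_integral in H0. destruct H0; [lra|]. nra. }
  assert (H5 : sqrt 5 * sqrt 5 = 5) by (apply sqrt_sqrt; lra).
  assert (0 < sqrt 5) by (apply sqrt_lt_R0; lra).
  assert ((v - 2 * sqrt 5) * (v + 2 * sqrt 5) = 0) by nra.
  apply Rmult_integral in H0. destruct H0; lra.
Qed.

(* [r(q) * r(q^2)^2], with [r] the Rogers-Ramanujan continued fraction. *)
Definition modk (q : R) : R := q * (rrP q / rrQ q) * (rrP (q ^ 2) / rrQ (q ^ 2)) ^ 2.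

Definition uE (q : R) : R := E (q ^ 2) * E (q ^ 5) ^ 5 / (q * E q * E (q ^ 10) ^ 5).

Definition wE (q : R) : R := E (q ^ 2) ^ 4 * E (q ^ 5) ^ 2 / (q * E q ^ 2 * E (q ^ 10) ^ 4).

Lemma theta_sq q a b : 0 < q -> theta (q ^ 2) a b = theta q (2 * a) (2 * b).
Proof.
  intros Hq. apply zsum_ext. intros n. f_equal.
  rewrite <- (Rpower_pow 2 q), Rpower_mult by auto. f_equal. simpl. ring.
Qed.

Lemma rrP_theta q : 0 < q < 1 -> rrP q = theta q (5/2) (3/2).
Proof. intros Hq. apply lacunary_theta; auto. intros n. now rewrite ehalf_INR. Qed.

Lemma rrQ_theta q : 0 < q < 1 -> rrQ q = theta q (5/2) (1/2).
Proof. intros Hq. apply lacunary_theta; auto. intros n. now rewrite ehalf_INR. Qed.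

Lemma pentagonal_E q : 0 < q < 1 -> pentagonal q = E q.
Proof.
  intros Hq. rewrite <- theta_pentagonal by auto. apply lacunary_theta; auto.
  intros n. now rewrite ehalf_INR.
Qed.

(** In terms of the products [c j = (q^j; q^10)] one has [k = q c1 c2 c8 c9 / (c3 c4 c6 c7)]. The
    last three equations are then [theta10_relation1], [theta10_relation2] and [theta10_relation3]
    cleared of common factors, the second and third starting from the expression of [1/k - k] given
    by the first. *)
Lemma level10 q : 0 < q < 1 ->
  0 < modk q /\ rrP q * rrQ q = E q * E (q ^ 5) /\ rrP (q ^ 2) * rrQ (q ^ 2) = E (q ^ 2) * E (q ^ 10) /\
  0 < rrP q /\ 0 < rrQ q /\ 0 < rrP (q ^ 2) /\ 0 < rrQ (q ^ 2) /\
  1 - modk q ^ 2 = modk q * uE q /\ 1 + modk q - modk q ^ 2 = modk q * wE q /\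
  1 - 4 * modk q - modk q ^ 2 = modk q * vE q.
Proof.
  intros Hq. assert (Hq2 := pow_in01 q Hq 2 ltac:(lia)).
  assert (Hc := c_pos q Hq).
  assert (R1 := theta10_relation1 q Hq). assert (R2 := theta10_relation2 q Hq).
  assert (R3 := theta10_relation3 q Hq).
  assert (t0 := theta5_c q Hq 0 5 5 ltac:(simpl; lra) ltac:(simpl; lra) ltac:(lia) ltac:(lia)).
  assert (t1 := theta5_c q Hq 1 6 4 ltac:(simpl; lra) ltac:(simpl; lra) ltac:(lia) ltac:(lia)).
  assert (t2 := theta5_c q Hq 2 7 3 ltac:(simpl; lra) ltac:(simpl; lra) ltac:(lia) ltac:(lia)).
  assert (t3 := theta5_c q Hq 3 8 2 ltac:(simpl; lra) ltac:(simpl; lra) ltac:(lia) ltac:(lia)).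
  assert (t4 := theta5_c q Hq 4 9 1 ltac:(simpl; lra) ltac:(simpl; lra) ltac:(lia) ltac:(lia)).
  assert (HP : rrP q = _) by exact (eq_trans (rrP_theta q Hq) (theta_rr1 q Hq)).
  assert (HQ : rrQ q = _) by exact (eq_trans (rrQ_theta q Hq) (theta_rr2 q Hq)).
  assert (HP2 : rrP (q ^ 2) = theta q 5 3).
  { rewrite rrP_theta, theta_sq by (auto; lra). f_equal; field. }
  assert (HQ2 : rrQ (q ^ 2) = theta q 5 1).
  { rewrite rrQ_theta, theta_sq by (auto; lra). f_equal; field. }
  unfold modk, uE, wE, vE.
  rewrite HP2, HQ2, HP, HQ. rewrite theta1_c in R3 by auto.
  rewrite !(E1_c q Hq), !(E10_c q), !(E5_c q Hq), !(E2_c q Hq). rewrite (E2_c q Hq) in R3.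
  rewrite t0, t1, t2, t3, t4 in R1. rewrite t0, t1, t2, t3, t4 in R2. rewrite t0, t2, t4 in R3.
  rewrite t1, t3. clear t0 t1 t2 t3 t4 HP HQ HP2 HQ2.
  assert (c1 := Hc 1%nat ltac:(lia)). assert (c2 := Hc 2%nat ltac:(lia)).
  assert (c3 := Hc 3%nat ltac:(lia)). assert (c4 := Hc 4%nat ltac:(lia)).
  assert (c5 := Hc 5%nat ltac:(lia)). assert (c6 := Hc 6%nat ltac:(lia)).
  assert (c7 := Hc 7%nat ltac:(lia)). assert (c8 := Hc 8%nat ltac:(lia)).
  assert (c9 := Hc 9%nat ltac:(lia)). assert (c10 := Hc 10%nat ltac:(lia)).
  clear Hc.
  generalize dependent (qp (q ^ 1) (q ^ 10)); intros x1.
  generalize dependent (qp (q ^ 2) (q ^ 10)); intros x2.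
  generalize dependent (qp (q ^ 3) (q ^ 10)); intros x3.
  generalize dependent (qp (q ^ 4) (q ^ 10)); intros x4.
  generalize dependent (qp (q ^ 5) (q ^ 10)); intros x5.
  generalize dependent (qp (q ^ 6) (q ^ 10)); intros x6.
  generalize dependent (qp (q ^ 7) (q ^ 10)); intros x7.
  generalize dependent (qp (q ^ 8) (q ^ 10)); intros x8.
  generalize dependent (qp (q ^ 9) (q ^ 10)); intros x9.
  generalize dependent (qp (q ^ 10) (q ^ 10)); intros x10.
  intros.
  set (k := q * _ * _ ^ 2).
  assert (Hk : k = q * x9 * x1 * x8 * x2 / (x7 * x3 * x6 * x4)) by (unfold k; field; lra).
  assert (P24 : 0 < x7 * x3 * x6 * x4) by (repeat apply Rmult_lt_0_compat; auto).
  clearbody k. subst k.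
  split; [|split; [|split; [|split; [|split; [|split; [|split]]]]]];
    [|ring|ring|repeat apply Rmult_lt_0_compat; auto..|].
  { apply Rdiv_lt_0_compat; auto. repeat apply Rmult_lt_0_compat; auto; lra. }
  assert (Hx : 0 < x1 * x2 * x3 * x4 * x6 * x7 * x8 * x9) by (repeat apply Rmult_lt_0_compat; auto).
  assert (R1' : x7 ^ 2 * x3 ^ 2 * x6 ^ 2 * x4 ^ 2 - q ^ 2 * x9 ^ 2 * x1 ^ 2 * x8 ^ 2 * x2 ^ 2
    = x8 * x2 * x6 * x4 * x5 ^ 4).
  { apply Rmult_eq_reg_l with (x10 ^ 4); [|apply pow_nonzero; lra]. lra. }
  assert (R2' : x8 ^ 2 * x2 ^ 2 * x6 ^ 2 * x4 ^ 2 = q * x9 ^ 2 * x1 ^ 2 * x7 ^ 2 * x3 ^ 2 + x9 * x1 * x7 * x3 * x5 ^ 4).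
  { apply Rmult_eq_reg_l with (x10 ^ 4); [|apply pow_nonzero; lra]. lra. }
  assert (R3' : (x1 * x3 * x5 * x7 * x9) ^ 4 * (x2 * x4 * x6 * x8) ^ 2 = x5 ^ 4 - 4 * q * x9 * x1 * x7 * x3).
  { apply Rmult_eq_reg_l with (x10 ^ 2); [|apply pow_nonzero; lra]. lra. }
  set (k := q * x9 * x1 * x8 * x2 / (x7 * x3 * x6 * x4)).
  assert (Hu : 1 - k ^ 2 = k * (x5 ^ 4 / (q * x1 * x3 * x7 * x9))).
  { transitivity ((x7 ^ 2 * x3 ^ 2 * x6 ^ 2 * x4 ^ 2 - q ^ 2 * x9 ^ 2 * x1 ^ 2 * x8 ^ 2 * x2 ^ 2) / (x7 * x3 * x6 * x4) ^ 2);
      [unfold k; field; lra|]. rewrite R1'. unfold k. field. lra. }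
  split; [|split].
  - rewrite Hu. field. lra.
  - replace (1 + k - k ^ 2) with (k + (1 - k ^ 2)) by ring. rewrite Hu.
    transitivity (k * ((q * x9 ^ 2 * x1 ^ 2 * x7 ^ 2 * x3 ^ 2 + x9 * x1 * x7 * x3 * x5 ^ 4) / (q * x9 ^ 2 * x1 ^ 2 * x7 ^ 2 * x3 ^ 2)));
      [field; lra|]. rewrite <- R2'. field. lra.
  - replace (1 - 4 * k - k ^ 2) with (1 - k ^ 2 - 4 * k) by ring. rewrite Hu.
    transitivity (k * ((x5 ^ 4 - 4 * q * x9 * x1 * x7 * x3) / (q * x1 * x3 * x7 * x9))); [field; lra|].
    rewrite <- R3'. field. lra.
Qed.

(** The quotient rule left unsimplified: the eta quotient of [modk'_E] has [q] in its denominator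
    and does not give the value at 0. *)
Definition modk' (q : R) : R :=
  rrP q / rrQ q * (rrP (q ^ 2) / rrQ (q ^ 2)) ^ 2
  + q * ((lacunary' (ehalf 5 3) q * rrQ q - rrP q * lacunary' (ehalf 5 1) q) / rrQ q ^ 2)
      * (rrP (q ^ 2) / rrQ (q ^ 2)) ^ 2
  + 4 * q ^ 2 * (rrP q / rrQ q) * (rrP (q ^ 2) / rrQ (q ^ 2)) *
     ((lacunary' (ehalf 5 3) (q ^ 2) * rrQ (q ^ 2) - rrP (q ^ 2) * lacunary' (ehalf 5 1) (q ^ 2)) / rrQ (q ^ 2) ^ 2).

Lemma rrP_0 : rrP 0 = 1.
Proof. apply lacunary_0; [intros n; now apply ehalf_ge|reflexivity]. Qed.

Lemma rrQ_0 : rrQ 0 = 1.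
Proof. apply lacunary_0; [intros n; now apply ehalf_ge|reflexivity]. Qed.

Lemma pentagonal_0 : pentagonal 0 = 1.
Proof. apply lacunary_0; [intros n; now apply ehalf_ge|reflexivity]. Qed.

Lemma rrQ_pos q : 0 <= q < 1 -> 0 < rrQ q.
Proof.
  intros [[H|<-] H1]; [now apply level10|]. rewrite rrQ_0. lra.
Qed.

Lemma pentagonal_pos q : 0 <= q < 1 -> 0 < pentagonal q.
Proof.
  intros [[H|<-] H1]; [rewrite pentagonal_E by auto; now apply E_pos|]. rewrite pentagonal_0. lra.
Qed.

Lemma is_derive_modk q : 0 <= q < 1 -> is_derive modk q (modk' q).
Proof.
  intros Hq. assert (Hq2 : 0 <= q ^ 2 < 1) by nra.
  assert (D : forall a b x, Z.even (a + b) = true -> (Z.abs b + 2 <= a)%Z -> 0 <= x < 1 ->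
    is_derive (lacunary (ehalf a b)) x (lacunary' (ehalf a b) x)).
  { intros a b x Hp Hb Hx. apply is_derive_lacunary; [intros n; now apply ehalf_ge|].
    rewrite Rabs_pos_eq; lra. }
  assert (DP := D 5%Z 3%Z q eq_refl ltac:(lia) Hq). assert (DQ := D 5%Z 1%Z q eq_refl ltac:(lia) Hq).
  assert (DP2 := D 5%Z 3%Z (q ^ 2) eq_refl ltac:(lia) Hq2). assert (DQ2 := D 5%Z 1%Z (q ^ 2) eq_refl ltac:(lia) Hq2).
  fold rrP in DP, DP2. fold rrQ in DQ, DQ2.
  assert (Q1 := rrQ_pos q Hq). assert (Q2 := rrQ_pos (q ^ 2) Hq2).
  assert (UP := is_derive_unique _ _ _ DP). assert (UQ := is_derive_unique _ _ _ DQ).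
  assert (UP2 := is_derive_unique _ _ _ DP2). assert (UQ2 := is_derive_unique _ _ _ DQ2).
  unfold modk.
  auto_derive.
  - change (q * (q * 1)) with (q ^ 2).
    repeat split; try (eexists; eassumption); lra.
  - change (q * (q * 1)) with (q ^ 2). 
    change (Derive (fun x => rrP x)) with (Derive rrP). change (Derive (fun x => rrQ x)) with (Derive rrQ).
    rewrite UP, UQ, UP2, UQ2. unfold modk'. field. lra.
Qed.

(** Write [a], [b], [c], [d] for [E] at [q], [q^2], [q^5], [q^10]. The Wronskian at [q] and at [q^2]
    gives [q k' / k = (a^5 / c + 4 b^5 / d) / 5], the 4 coming from the square of the second ratio
    and the chain rule. *)
Lemma modk'_E q : 0 < q < 1 ->
  modk' q = modk q * (E q * E (q ^ 2) ^ 2 * E (q ^ 5) ^ 3 / (q * E (q ^ 10) ^ 2)).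
Proof.
  intros Hq. assert (Hq2 := pow_in01 q Hq 2 ltac:(lia)).
  destruct (level10 q Hq) as [Hk [HPQ [HPQ2 [P1 [Q1 [P2 [Q2 [Hu [Hw Hv]]]]]]]]].
  assert (W1 := rr_wronskian q Hq). assert (W2 := rr_wronskian (q ^ 2) Hq2).
  rewrite HPQ in W1. rewrite HPQ2 in W2.
  assert (HE := E_pow_pos q Hq).
  pose proof (E_pos q Hq) as HA. pose proof (HE 2%nat ltac:(lia)) as HB.
  pose proof (HE 5%nat ltac:(lia)) as HC. pose proof (HE 10%nat ltac:(lia)) as HD.
  set (W := lacunary' (ehalf 5 3) q * rrQ q - rrP q * lacunary' (ehalf 5 1) q) in *.
  set (W' := lacunary' (ehalf 5 3) (q ^ 2) * rrQ (q ^ 2) - rrP (q ^ 2) * lacunary' (ehalf 5 1) (q ^ 2)) in *.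
  transitivity (modk q / q * (1 + q * W / (rrP q * rrQ q) + 4 * (q ^ 2 * W') / (rrP (q ^ 2) * rrQ (q ^ 2)))).
  { unfold modk', modk. fold W W'. field. lra. }
  rewrite HPQ, HPQ2.
  replace (q * W) with ((E q ^ 6 - E q * E (q ^ 5)) / 5) by lra.
  replace (q ^ 2 * W') with ((E (q ^ 2) ^ 6 - E (q ^ 2) * E (q ^ 10)) / 5) by lra.
  assert (Huw : wE q = uE q + 1).
  { apply Rmult_eq_reg_l with (modk q); [|lra]. rewrite <- Hw. 
    replace (modk q * (uE q + 1)) with (modk q * uE q + modk q) by ring. rewrite <- Hu. ring. }
  assert (Huv : vE q = uE q - 4).
  { apply Rmult_eq_reg_l with (modk q); [|lra]. rewrite <- Hv. 
    replace (modk q * (uE q - 4)) with (modk q * uE q - 4 * modk q) by ring. rewrite <- Hu. ring. }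
  unfold wE, uE, vE in Huw, Huv.
  set (a := E q) in *. set (b := E (q ^ 2)) in *. set (c := E (q ^ 5)) in *. set (d := E (q ^ 10)) in *.
  (* The relation [v + 4 w = 5 u] with denominators cleared; it merges the two eta quotients into
     one. *)
  assert (H : a ^ 5 * d ^ 2 + 4 * (b ^ 5 * c * d) = 5 * (a * b ^ 2 * c ^ 4)).
  { apply Rmult_eq_reg_l with (c / (q * a ^ 2 * b * d ^ 5)).
    2:{ apply Rgt_not_eq, Rdiv_lt_0_compat; auto. repeat apply Rmult_lt_0_compat; auto using pow_lt; lra. }
    transitivity (a ^ 3 * c / (q * b * d ^ 3) + 4 * (b ^ 4 * c ^ 2 / (q * a ^ 2 * d ^ 4))); [field; lra|].
    rewrite Huw, Huv. field. lra. }
  transitivity (modk q / q * ((a ^ 5 * d ^ 2 + 4 * (b ^ 5 * c * d)) / (5 * c * d ^ 2))); [field; lra|].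
  rewrite H. field. lra.
Qed.

(** The three quadratics are [modk q] times positive eta quotients, so the denominators of the
    primitives never vanish and [modk] itself need not be estimated. *)
Lemma modk_bounds q : 0 <= q < 1 ->
  0 < 1 - modk q ^ 2 /\ 0 < 1 + modk q - modk q ^ 2 /\ 0 < 1 - 4 * modk q - modk q ^ 2.
Proof.
  intros [[Hq|<-] Hq1].
  - assert (H : 0 < q < 1) by lra.
    destruct (level10 q H) as [Hk [_ [_ [_ [_ [_ [_ [Hu [Hw Hv]]]]]]]]].
    assert (HE := E_pow_pos q H).
    pose proof (E_pos q H).
    rewrite Hu, Hw, Hv. pose proof (vE_pos q H).
    split; [|split]; apply Rmult_lt_0_compat; auto; apply Rdiv_lt_0_compat;
      repeat apply Rmult_lt_0_compat; auto using pow_lt with arith; lra.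
  - replace (modk 0) with 0 by (unfold modk; ring). lra.
Qed.

Lemma modk'_0 : modk' 0 = 1.
Proof.
  unfold modk'. replace (0 ^ 2) with 0 by ring. rewrite rrP_0, rrQ_0. field.
Qed.

Lemma ex_derive_pentagonal q : 0 <= q < 1 -> ex_derive pentagonal q.
Proof.
  intros Hq. eexists. apply is_derive_lacunary; [intros n; now apply ehalf_ge|].
  rewrite Rabs_pos_eq; lra.
Qed.

Lemma pow_lt1 q n : 0 <= q < 1 -> (0 < n)%nat -> 0 <= q ^ n < 1.
Proof.
  intros Hq Hn. split; [apply pow_le; lra|]. apply pow_lt_1_compat; [lra|auto].
Qed.

Lemma E_of_pentagonal q : 0 < q < 1 -> E q = pentagonal q /\ forall n, (0 < n)%nat -> E (q ^ n) = pentagonal (q ^ n).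
Proof.
  intros Hq. split; [symmetry; now apply pentagonal_E|].
  intros n Hn. symmetry. apply pentagonal_E. now apply pow_in01.
Qed.

(* [g] replaces [f] so that nothing is asked of [f] around the endpoint [0]: [E] is only
   studied at positive arguments. *)
Lemma is_RInt_primitive (f g F : R -> R) b v : 0 < b ->
  (forall x, 0 < x <= b -> f x = g x) ->
  (forall x, 0 <= x <= b -> is_derive F x (g x)) ->
  (forall x, 0 <= x <= b -> ex_derive g x) ->
  F b - F 0 = v -> is_RInt f 0 b v.
Proof.
  intros Hb Hfg HF Hg <-. apply (is_RInt_ext g).
  - rewrite Rmin_left, Rmax_right by lra. intros x Hx. symmetry. apply Hfg. lra.
  - apply (is_RInt_derive F g); rewrite Rmin_left, Rmax_right by lra; auto.
    intros x Hx. apply (ex_derive_continuous g). now apply Hg.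
Qed.

(** * Primitives of the three integrands *)

Lemma is_derive_F1 q : 0 <= q < 1 ->
  is_derive (fun q => - ((1 + modk q ^ 2) / (1 + modk q - modk q ^ 2))) q
    (pentagonal q ^ 8 * pentagonal (q ^ 10) ^ 3 / pentagonal (q ^ 2) ^ 7).
Proof.
  intros Hq. destruct (modk_bounds q Hq) as [B1 [B2 B3]].
  assert (Hd := is_derive_modk q Hq). assert (Ud := is_derive_unique _ _ _ Hd).
  evar_last.
  - auto_derive; [|reflexivity].
    change (modk q * (modk q * 1)) with (modk q ^ 2).
    repeat split; try (eexists; eassumption); apply Rgt_not_eq; lra.
  - change (Derive (fun x => modk x)) with (Derive modk). rewrite Ud.
    transitivity ((1 - 4 * modk q - modk q ^ 2) / (1 + modk q - modk q ^ 2) ^ 2 * modk' q); [field; lra|].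
    (* For [q > 0] this is [v / w^2] times [k' / k] in eta quotients; at 0, where [k = 0] and
       [k' = 1], both sides are 1. *)
    destruct Hq as [[Hq|<-] Hq1].
    + assert (Hq' : 0 < q < 1) by lra. destruct (E_of_pentagonal q Hq') as [<- Hs].
      rewrite <- !Hs, modk'_E by (auto; lia).
      destruct (level10 q Hq') as [Hk [_ [_ [_ [_ [_ [_ [Hu [Hw Hv]]]]]]]]].
      rewrite Hw, Hv. unfold wE, vE.
      assert (HE := E_pow_pos q Hq').
      pose proof (E_pos q Hq') as HA. pose proof (HE 2%nat ltac:(lia)) as HB.
      pose proof (HE 5%nat ltac:(lia)) as HC. pose proof (HE 10%nat ltac:(lia)) as HD.
      field. repeat split; lra.
    + rewrite modk'_0, !pow_i, pentagonal_0 by lia. replace (modk 0) with 0 by (unfold modk; ring). field.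
Qed.

Lemma is_derive_F2 q : 0 <= q < 1 ->
  is_derive (fun q => / 4 * ((1 + modk q ^ 2) / (1 - modk q ^ 2))) q
    (q * pentagonal q ^ 3 * pentagonal (q ^ 10) ^ 8 / pentagonal (q ^ 5) ^ 7).
Proof.
  intros Hq. destruct (modk_bounds q Hq) as [B1 [B2 B3]].
  assert (Hd := is_derive_modk q Hq). assert (Ud := is_derive_unique _ _ _ Hd).
  evar_last.
  - auto_derive; [|reflexivity].
    change (modk q * (modk q * 1)) with (modk q ^ 2).
    repeat split; try (eexists; eassumption); apply Rgt_not_eq; lra.
  - change (Derive (fun x => modk x)) with (Derive modk). rewrite Ud.
    transitivity (modk q / (1 - modk q ^ 2) ^ 2 * modk' q); [field; lra|].
    destruct Hq as [[Hq|<-] Hq1].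
    + assert (Hq' : 0 < q < 1) by lra. destruct (E_of_pentagonal q Hq') as [<- Hs].
      rewrite <- !Hs, modk'_E by (auto; lia).
      destruct (level10 q Hq') as [Hk [_ [_ [_ [_ [_ [_ [Hu [Hw Hv]]]]]]]]].
      rewrite Hu. unfold uE.
      assert (HE := E_pow_pos q Hq').
      pose proof (E_pos q Hq') as HA. pose proof (HE 2%nat ltac:(lia)) as HB.
      pose proof (HE 5%nat ltac:(lia)) as HC. pose proof (HE 10%nat ltac:(lia)) as HD.
      field. repeat split; lra.
    + rewrite modk'_0, !pow_i, pentagonal_0 by lia. replace (modk 0) with 0 by (unfold modk; ring). field.
Qed.

Lemma is_derive_F3 q : 0 <= q < 1 ->
  is_derive (fun q => / 4 * ((1 + modk q ^ 2) / (1 - 4 * modk q - modk q ^ 2))) q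
    (pentagonal (q ^ 2) ^ 8 * pentagonal (q ^ 5) ^ 3 / pentagonal q ^ 7).
Proof.
  intros Hq. destruct (modk_bounds q Hq) as [B1 [B2 B3]].
  assert (Hd := is_derive_modk q Hq). assert (Ud := is_derive_unique _ _ _ Hd).
  evar_last.
  - auto_derive; [|reflexivity].
    change (modk q * (modk q * 1)) with (modk q ^ 2).
    repeat split; try (eexists; eassumption); apply Rgt_not_eq; lra.
  - change (Derive (fun x => modk x)) with (Derive modk). rewrite Ud.
    transitivity ((1 + modk q - modk q ^ 2) / (1 - 4 * modk q - modk q ^ 2) ^ 2 * modk' q); [field; lra|].
    destruct Hq as [[Hq|<-] Hq1].
    + assert (Hq' : 0 < q < 1) by lra. destruct (E_of_pentagonal q Hq') as [<- Hs].
      rewrite <- !Hs, modk'_E by (auto; lia).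
      destruct (level10 q Hq') as [Hk [_ [_ [_ [_ [_ [_ [Hu [Hw Hv]]]]]]]]].
      rewrite Hw, Hv. unfold wE, vE.
      assert (HE := E_pow_pos q Hq').
      pose proof (E_pos q Hq') as HA. pose proof (HE 2%nat ltac:(lia)) as HB.
      pose proof (HE 5%nat ltac:(lia)) as HC. pose proof (HE 10%nat ltac:(lia)) as HD.
      field. repeat split; lra.
    + rewrite modk'_0, !pow_i, pentagonal_0 by lia. replace (modk 0) with 0 by (unfold modk; ring). field.
Qed.

(** * Values at the fixed point of the Fricke involution *)

Lemma modk_q0 : 0 < modk q0 /\ 1 - modk q0 ^ 2 = modk q0 * (4 + 2 * sqrt 5).
Proof.
  destruct (level10 q0 q0_01) as [Hk [_ [_ [_ [_ [_ [_ [_ [_ Hv]]]]]]]]].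
  rewrite vE_q0 in Hv. split; [auto|]. lra.
Qed.

Lemma sqrt_unique x y : 0 <= x -> x ^ 2 = y -> sqrt y = x.
Proof. intros Hx <-. now apply sqrt_pow2. Qed.

(** From [u = 1/k - k = 4 + 2 sqrt 5] follows [(1/k + k)^2 = u^2 + 4 = 40 + 16 sqrt 5]. Each
    fraction is the square root of this number divided by [w = 5 + 2 sqrt 5], [u] or
    [v = 2 sqrt 5]. *)
Lemma F_q0 :
  2 * sqrt ((10 - 4 * sqrt 5) / 5) = (1 + modk q0 ^ 2) / (1 + modk q0 - modk q0 ^ 2) /\
  sqrt (10 - 4 * sqrt 5) = (1 + modk q0 ^ 2) / (1 - modk q0 ^ 2) /\
  sqrt ((10 + 4 * sqrt 5) / 5) = (1 + modk q0 ^ 2) / (1 - 4 * modk q0 - modk q0 ^ 2).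
Proof.
  destruct modk_q0 as [Hk Hu]. set (k := modk q0) in *.
  assert (H5 : sqrt 5 * sqrt 5 = 5) by (apply sqrt_sqrt; lra).
  assert (Hs : 0 < sqrt 5) by (apply sqrt_lt_R0; lra). set (s := sqrt 5) in *.
  assert (Hkk : 0 < k ^ 2) by now apply pow_lt.
  replace (1 + k - k ^ 2) with (k * (5 + 2 * s)) by lra.
  replace (1 - 4 * k - k ^ 2) with (k * (2 * s)) by lra. rewrite Hu.
  assert (Hsq : (1 + k ^ 2) ^ 2 = k ^ 2 * (40 + 16 * s)).
  { replace ((1 + k ^ 2) ^ 2) with ((1 - k ^ 2) ^ 2 + 4 * k ^ 2) by ring. rewrite Hu.
    replace ((k * (4 + 2 * s)) ^ 2 + 4 * k ^ 2) with (k ^ 2 * (20 + 16 * s + 4 * (s * s))) by ring.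
    rewrite H5. ring. }
  assert (Hpos : forall c, 0 < c -> 0 <= (1 + k ^ 2) / (k * c)).
  { intros c Hc. apply Rdiv_le_0_compat; [lra|now apply Rmult_lt_0_compat]. }
  assert (Hval : forall c y, 0 < c -> 40 + 16 * s = c ^ 2 * y -> ((1 + k ^ 2) / (k * c)) ^ 2 = y).
  { intros c y Hc Hy. unfold Rdiv. rewrite Rpow_mult_distr, Hsq, Hy. field. lra. }
  split; [|split].
  - rewrite (sqrt_unique ((1 + k ^ 2) / (k * (5 + 2 * s)) / 2)).
    + field. lra.
    + pose proof (Hpos (5 + 2 * s) ltac:(lra)). lra.
    + transitivity (((1 + k ^ 2) / (k * (5 + 2 * s))) ^ 2 / 4); [field; lra|].
      rewrite (Hval _ (4 * ((10 - 4 * s) / 5))); [field|lra|]. nra.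
  - apply sqrt_unique; [apply Hpos; lra|]. apply Hval; [lra|]. nra.
  - apply sqrt_unique; [apply Hpos; lra|]. apply Hval; [lra|]. nra.
Qed.

Theorem theorem2 :
  is_RInt (fun q => E q ^ 8 * E (q ^ 10) ^ 3 / E (q ^ 2) ^ 7)
    0 (exp (- 2 * PI / sqrt 10))
    (1 - 2 * sqrt ((10 - 4 * sqrt 5) / 5)) /\
  is_RInt (fun q => q * E q ^ 3 * E (q ^ 10) ^ 8 / E (q ^ 5) ^ 7)
    0 (exp (- 2 * PI / sqrt 10))
    (/ 4 * (sqrt (10 - 4 * sqrt 5) - 1)) /\
  is_RInt (fun q => E (q ^ 2) ^ 8 * E (q ^ 5) ^ 3 / E q ^ 7)
    0 (exp (- 2 * PI / sqrt 10))
    (/ 4 * (sqrt ((10 + 4 * sqrt 5) / 5) - 1)).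
Proof.
  replace (exp (- 2 * PI / sqrt 10)) with q0 by (unfold q0; f_equal; unfold Rdiv; ring).
  assert (Hq := q0_01). destruct F_q0 as [V1 [V2 V3]].
  assert (H0 : modk 0 = 0) by (unfold modk; ring).
  assert (Hf : forall f, (forall q, 0 < q < 1 -> f q) -> forall q, 0 < q <= q0 -> f q)
    by (intros f H q Hx; apply H; lra).
  assert (HE : forall q n, 0 <= q <= q0 -> (0 < n)%nat -> ex_derive pentagonal (q ^ n) /\ 0 < pentagonal (q ^ n)).
  { intros q n Hx Hn. pose proof (pow_lt1 q n ltac:(lra) Hn).
    split; [now apply ex_derive_pentagonal|now apply pentagonal_pos]. }
  assert (HE1 : forall q, 0 <= q <= q0 -> ex_derive pentagonal q /\ 0 < pentagonal q).
  { intros q Hx. split; [apply ex_derive_pentagonal|apply pentagonal_pos]; lra. }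
  split; [|split].
  - apply (is_RInt_primitive _ (fun q => pentagonal q ^ 8 * pentagonal (q ^ 10) ^ 3 / pentagonal (q ^ 2) ^ 7)
      (fun q => - ((1 + modk q ^ 2) / (1 + modk q - modk q ^ 2)))); [lra| | | |].
    + intros q Hx. destruct (E_of_pentagonal q ltac:(lra)) as [-> Hs]. now rewrite !Hs by lia.
    + intros q Hx. apply is_derive_F1. lra.
    + intros q Hx. destruct (HE q 10%nat Hx ltac:(lia)), (HE q 2%nat Hx ltac:(lia)), (HE1 q Hx).
      auto_derive. simpl in *. repeat split; auto; try (apply Rgt_not_eq; repeat apply Rmult_lt_0_compat; lra).
    (* As [modk] vanishes at 0, this primitive starts from [-1], the other two from [1/4]; these are
       the constants subtracted in the three values. *)
    + rewrite H0, V1. field. apply Rgt_not_eq. apply modk_bounds. lra.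
  - apply (is_RInt_primitive _ (fun q => q * pentagonal q ^ 3 * pentagonal (q ^ 10) ^ 8 / pentagonal (q ^ 5) ^ 7)
      (fun q => / 4 * ((1 + modk q ^ 2) / (1 - modk q ^ 2)))); [lra| | | |].
    + intros q Hx. destruct (E_of_pentagonal q ltac:(lra)) as [-> Hs]. now rewrite !Hs by lia.
    + intros q Hx. apply is_derive_F2. lra.
    + intros q Hx. destruct (HE q 10%nat Hx ltac:(lia)), (HE q 5%nat Hx ltac:(lia)), (HE1 q Hx).
      auto_derive. simpl in *. repeat split; auto; try (apply Rgt_not_eq; repeat apply Rmult_lt_0_compat; lra).
    + rewrite H0, V2. field. apply Rgt_not_eq. apply modk_bounds. lra.
  - apply (is_RInt_primitive _ (fun q => pentagonal (q ^ 2) ^ 8 * pentagonal (q ^ 5) ^ 3 / pentagonal q ^ 7)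
      (fun q => / 4 * ((1 + modk q ^ 2) / (1 - 4 * modk q - modk q ^ 2)))); [lra| | | |].
    + intros q Hx. destruct (E_of_pentagonal q ltac:(lra)) as [-> Hs]. now rewrite !Hs by lia.
    + intros q Hx. apply is_derive_F3. lra.
    + intros q Hx. destruct (HE q 2%nat Hx ltac:(lia)), (HE q 5%nat Hx ltac:(lia)), (HE1 q Hx).
      auto_derive. simpl in *. repeat split; auto; try (apply Rgt_not_eq; repeat apply Rmult_lt_0_compat; lra).
    + rewrite H0, V3. field. apply Rgt_not_eq. apply modk_bounds. lra.
Qed.
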